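(* Let $\mathfrak g$ be a semisimple Lie algebra over $\mathbb K=\mathbb R$ or $\mathbb C$; if $\mathbb K=\mathbb R$, assume that $\mathfrak g$ is split. Let $\mathfrak h$ be a Cartan subalgebra (split if $\mathbb K=\mathbb R$) and consider the corresponding direct decompositions $\mathfrak g=\mathfrak n_-\oplus\mathfrak b=\mathfrak n_-\oplus\mathfrak h\oplus\mathfrak n_+$, where $\mathfrak b=\mathfrak h\oplus\mathfrak n_+$ is the Borel subalgebra and $\mathfrak n_-,\mathfrak n_+$ are the maximal nilpotent subalgebras (sums of the negative, respectively positive, root spaces). Let $\lambda_1,\lambda_2\in\mathbb K$, $\lambda_1\neq\lambda_2$, and define a linear operator $N:\mathfrak g\to\mathfrak g$ by $N|_{\mathfrak n_-}=\lambda_1\mathrm{Id}$, $N|_{\mathfrak b}=\lambda_2\mathrm{Id}$ (this is a Nijenhuis operator). Then the corresponding Poisson pencil $\{\theta_N^s\}$ is Kronecker.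
   Context: A linear operator $N:\mathfrak g\to\mathfrak g$ on a Lie algebra $(\mathfrak g,[,])$ is called Nijenhuis if $[Nx,Ny]-N([Nx,y]+[x,Ny])+N^2[x,y]=0$ for all $x,y\in\mathfrak g$. For a Nijenhuis operator $N$, the operation $[x,y]_N:=[Nx,y]+[x,Ny]-N[x,y]$ is a Lie bracket on $\mathfrak g$, and every linear combination $s_1[,]+s_2[,]_N$ is a Lie bracket. If $\mathbb K=\mathbb C$, let $\theta_1,\theta_2$ be the (holomorphic) Lie–Poisson bivectors on $\mathfrak g^*$ corresponding to $[,]$ and $[,]_N$ respectively; the associated Poisson pencil is the family $\theta_N^s:=s_1\theta_1+s_2\theta_2$, $s=(s_1,s_2)\in\mathbb C^2$. If $\mathbb K=\mathbb R$, one complexifies $\mathfrak g$ and $N$ and takes the pencil $\{\theta_N^s\}_{s\in\mathbb C^2}$ so obtained on $(\mathfrak g^{\mathbb C})^*$. A Poisson pencil $\{\theta^s\}$ on a connected complex manifold $M$ is Kronecker at $x\in M$ if $\operatorname{rank}_{\mathbb C}\theta^s_x$ is constant with respect to $s\in\mathbb C^2\setminus\{0\}$; the pencil is called Kronecker (micro-Kronecker) if it is Kronecker at every point of some open dense subset of $M$. *)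

(* Defs.v *)
From HB Require Import structures.
From mathcomp Require Import all_boot all_order all_algebra.
From mathcomp Require Import complex ring lra.
From mathcomp Require Import all_classical all_reals topology normedtype.

Set Implicit Arguments.
Unset Strict Implicit.
Unset Printing Implicit Defensive.

Import Order.TTheory GRing.Theory Num.Theory.
Import numFieldNormedType.Exports.

Local Open Scope ring_scope.

HB.mixin Record Vector_isLieAlgebra (K : fieldType) (g : Type)
    of Vector K g := {
  lie : g -> g -> g;
  lie_linearl : forall y : g, linear (fun x => lie x y);
  lie_linearr : forall x : g, linear (lie x);
  liexx : forall x : g, lie x x = 0;
  lie_jacobi : forall x y z : g,
    lie x (lie y z) + lie y (lie z x) + lie z (lie x y) = 0
}.

#[short(type="lieAlgType")]
HB.structure Definition LieAlgebra (K : fieldType) :=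
  { g of Vector K g & Vector_isLieAlgebra K g }.

Section LieAlgebraTheory.
Variables (K : fieldType) (g : lieAlgType K).
Implicit Types (x y z : g) (U W h : {vspace g}) (N : 'End(g)).

HB.instance Definition _ x :=
  GRing.isLinear.Build K g g _ (@lie K g x) (lie_linearr x).

Lemma lieDr x y z : lie x (y + z) = lie x y + lie x z.
Proof. exact: linearD. Qed.

Lemma lieNr x y : lie x (- y) = - lie x y.
Proof. exact: linearN. Qed.

Lemma lieZr (a : K) x y : lie x (a *: y) = a *: lie x y.
Proof. exact: linearZ. Qed.

Lemma lieDl x y z : lie (x + y) z = lie x z + lie y z.
Proof. by have := lie_linearl z 1 x y; rewrite /= !scale1r. Qed.

Lemma lie_anti x y : lie x y = - lie y x.
Proof.
apply/eqP; rewrite -addr_eq0; apply/eqP.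
by have := liexx (x + y); rewrite lieDl !linearD /= !liexx addr0 add0r.
Qed.

Lemma lie_suml I (r : seq I) (F : I -> g) y :
  lie (\sum_(i <- r) F i) y = \sum_(i <- r) lie (F i) y.
Proof.
rewrite lie_anti linear_sum -sumrN; apply: eq_bigr => i _.
by rewrite [RHS]lie_anti.
Qed.

Lemma lieZl (a : K) x y : lie (a *: x) y = a *: lie x y.
Proof. by rewrite lie_anti linearZ /= -scalerN -lie_anti. Qed.

Definition ad x : 'End(g) := linfun (lie x).

Lemma adE x y : ad x y = lie x y.
Proof. exact: lfunE. Qed.

(* [U, W], the linear span of all brackets of elements of U and W;
   bilinearity allows one to take bracketed bases, see [memv_lie]. *)
Definition lie_prod U W : {vspace g} :=
  (<<[seq lie x y | x <- vbasis U, y <- vbasis W]>>)%VS.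

Lemma memv_lie U W x y : x \in U -> y \in W -> lie x y \in lie_prod U W.
Proof.
move=> xU yW; rewrite (coord_vbasis xU) (coord_vbasis yW).
rewrite lie_suml; apply: memv_suml => i _.
rewrite lieZl memvZ //= linear_sum; apply: memv_suml => j _.
rewrite linearZ memvZ //=; apply: memv_span; apply/allpairsP.
by exists ((vbasis U)`_i, (vbasis W)`_j); rewrite !mem_nth ?size_tuple.
Qed.

Definition derived_series U (n : nat) : {vspace g} :=
  iter n (fun W => lie_prod W W) U.

Definition lower_central_series U (n : nat) : {vspace g} :=
  iter n (lie_prod U) U.

Definition lie_solvable U := exists n, derived_series U n = 0%VS.

Definition lie_nilpotent U := exists n, lower_central_series U n = 0%VS.

Definition lie_subalgebra U := forall x y, x \in U -> y \in U -> lie x y \in U.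

Definition lie_ideal U := forall x y, y \in U -> lie x y \in U.

Definition lie_semisimple :=
  forall U, lie_ideal U -> lie_solvable U -> U = 0%VS.

Definition cartan_subalgebra h :=
  [/\ lie_subalgebra h, lie_nilpotent h &
      forall x, (forall y, y \in h -> lie x y \in h) -> x \in h].

(* All characteristic roots of [ad x] lie in K, for every x in h. *)
Definition split_cartan_subalgebra h :=
  cartan_subalgebra h /\
  forall x, x \in h ->
    exists s : seq K,
      char_poly (passmx.mxof (vbasis fullv) (vbasis fullv) (ad x))
        = \prod_(a <- s) ('X - a%:P).

Definition split_lie_algebra := exists h, split_cartan_subalgebra h.

(* Weights are linear functionals on h, i.e. elements of 'Hom(subvs_of h, K^o);
   the intersection over a basis of h is characterized in [root_spaceP]. *)
Definition root_space h (a : 'Hom(subvs_of h, K^o)) : {vspace g} :=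
  (\bigcap_(t <- vbasis (fullv : {vspace subvs_of h}))
      lker (ad (vsval t) - (a t : K) *: \1%VF))%VS.

Lemma root_spaceP h (a : 'Hom(subvs_of h, K^o)) y :
  reflect (forall t : subvs_of h, lie (vsval t) y = (a t : K) *: y)
          (y \in root_space a).
Proof.
have ker t : (y \in lker (ad (vsval t) - (a t : K) *: \1%VF))
             = (lie (vsval t) y == (a t : K) *: y).
  by rewrite memv_ker !lfunE /= !lfunE /= lfunE /= !lfunE subr_eq0 ?adE.
apply: (iffP idP) => [yA t | yA]; last first.
  rewrite /root_space big_seq; apply: (big_ind (fun W => y \in W)).
  - exact: memvf.
  - by move=> U W yU yW; rewrite memv_cap yU.
  - by move=> t _; rewrite ker yA.
have yB : forall t, t \in vbasis (fullv : {vspace subvs_of h}) ->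
    lie (vsval t) y = (a t : K) *: y.
  move=> t0 t0B; apply/eqP; rewrite -ker.
  move: yA; rewrite /root_space (big_rem _ t0B) /=.
  by rewrite memv_cap => /andP[].
rewrite (coord_vbasis (memvf t)) !linear_sum lie_suml scaler_suml.
apply: eq_bigr => i _.
rewrite !linearZ lieZl /= yB ?mem_nth ?size_tuple //.
by rewrite scalerA.
Qed.

Definition is_root h (a : 'Hom(subvs_of h, K^o)) : bool :=
  (a != 0) && (root_space a != 0%VS).

(* The set of roots being finite, a system of positive roots is given by
   the list P of its elements; the negative roots are then the opposites of
   the members of P. *)
Record positive_system h (P : seq 'Hom(subvs_of h, K^o)) : Prop := {
  positive_is_root : forall a, a \in P -> is_root a;
  positive_or_negative : forall a, is_root a -> (a \in P) (+) (- a \in P);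
  positive_add : forall a b,
    a \in P -> b \in P -> is_root (a + b) -> a + b \in P
}.

Definition nplus h (P : seq 'Hom(subvs_of h, K^o)) : {vspace g} :=
  (\sum_(a <- P) root_space a)%VS.

Definition nminus h (P : seq 'Hom(subvs_of h, K^o)) : {vspace g} :=
  (\sum_(a <- P) root_space (- a))%VS.

Definition borel h (P : seq 'Hom(subvs_of h, K^o)) : {vspace g} :=
  (h + nplus P)%VS.

Definition nijenhuis N := forall x y,
  lie (N x) (N y) - N (lie (N x) y + lie x (N y)) + N (N (lie x y)) = 0.

Definition lie_deformed N x y : g := lie (N x) y + lie x (N y) - N (lie x y).

End LieAlgebraTheory.

Section Bivectors.
Variables (C : numFieldType) (V : vectType C).

Definition dual_space := 'Hom(V, C^o).

(* A bivector field on V^*: its value at a point xi of V^* is a bilinear form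
   on the cotangent space T^*_xi V^* = (V^* )^*, identified with V. *)
Definition bivector_field := dual_space -> V -> V -> C.

(* {f, g}(xi) = xi [df_xi, dg_xi] *)
Definition lie_poisson (br : V -> V -> V) : bivector_field :=
  fun xi x y => xi (br x y).

Definition pencil (th1 th2 : bivector_field) (s : C * C) : bivector_field :=
  fun xi x y => s.1 * th1 xi x y + s.2 * th2 xi x y.

Definition bivector_rank (th : bivector_field) (xi : dual_space) : nat :=
  let e := vbasis (fullv : {vspace V}) in
  \rank (\matrix_(i < \dim (fullv : {vspace V}),
                  j < \dim (fullv : {vspace V})) th xi e`_i e`_j).

Definition kronecker_at (th : C * C -> bivector_field) (xi : dual_space) : Prop :=
  forall s t : C * C, s != 0 -> t != 0 ->
    bivector_rank (th s) xi = bivector_rank (th t) xi.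

(* The standard topology of the finite-dimensional space V^*, read in linear
   coordinates C^n. *)
Definition dual_coord (U : set dual_space) :
    set 'rV[C]_(\dim (fullv : {vspace dual_space})) :=
  [set v | U (passmx.vecof (vbasis fullv) v)].

Definition kronecker (th : C * C -> bivector_field) : Prop :=
  exists U : set dual_space,
    [/\ open (dual_coord U), dense (dual_coord U) &
        forall xi, U xi -> kronecker_at th xi].

End Bivectors.

Definition nijenhuis_pencil (C : numFieldType) (g : lieAlgType C)
    (N : 'End(g)) : C * C -> bivector_field g :=
  pencil (lie_poisson (@lie C g)) (lie_poisson (lie_deformed N)).

(* The pair (x, y) stands for x + i y. *)
Definition complexification (R : rcfType) (V : Type) : Type := (V * V)%type.

Section ComplexifyVector.
Import VectorInternalTheory.
Variables (R : rcfType) (V : vectType R).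
Local Notation VC := (complexification R V).
Implicit Types (z : VC) (c : R[i]).

HB.instance Definition _ := GRing.Zmodule.copy VC (V * V)%type.

Definition complexification_scale c z : VC :=
  (complex.Re c *: z.1 - complex.Im c *: z.2,
   complex.Re c *: z.2 + complex.Im c *: z.1).

Fact complexification_scaleA a b z :
  complexification_scale a (complexification_scale b z)
  = complexification_scale (a * b) z.
Proof.
case: a b z => [a1 a2] [b1 b2] [x y]; rewrite /complexification_scale /=.
rewrite !scalerDr !scalerN !scalerA !scalerBl !scalerDl !opprD.
by congr pair; rewrite [X in _ + X = _]addrC addrACA.
Qed.

Fact complexification_scale1 : left_id 1 complexification_scale.
Proof.
by case=> x y; rewrite /complexification_scale /= !scale1r !scale0r subr0 addr0.
Qed.

Fact complexification_scaleDr : right_distributive complexification_scale +%R.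
Proof.
move=> [a1 a2] [x y] [x' y']; rewrite /complexification_scale /=.
by congr pair; rewrite /= !scalerDr ?opprD addrACA.
Qed.

Fact complexification_scaleDl z :
  {morph complexification_scale^~ z : a b / a + b}.
Proof.
case: z => [x y] [a1 a2] [b1 b2]; rewrite /complexification_scale /=.
by congr pair; rewrite /= !scalerDl ?opprD addrACA.
Qed.

HB.instance Definition _ := GRing.Zmodule_isLmodule.Build R[i] VC
  complexification_scaleA complexification_scale1
  complexification_scaleDr complexification_scaleDl.

Lemma complexificationZ c z :
  c *: z = (complex.Re c *: z.1 - complex.Im c *: z.2,
            complex.Re c *: z.2 + complex.Im c *: z.1).
Proof. by []. Qed.

Fact complexification_vect_iso : Vector.axiom (dim V) VC.
Proof.
pose f z : 'rV[R[i]]_(dim V) := \row_j (v2r z.1 0 j +i* v2r z.2 0 j)%C.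
exists f.
  move=> c z w; apply/rowP=> j; rewrite !mxE complexificationZ /=.
  rewrite linearD linearB linearD linearD !linearZ !mxE.
  case: c => a b; apply/eqP; rewrite eq_complex /=.
  by rewrite mulrN !eqxx.
exists (fun v : 'rV[R[i]]_(dim V) =>
  (r2v (\row_j complex.Re (v 0 j)), r2v (\row_j complex.Im (v 0 j)))).
  case=> x y; congr pair; apply: (can_inj v2rK); rewrite r2vK;
  by apply/rowP=> j; rewrite !mxE.
move=> v; apply/rowP=> j; rewrite mxE /= !r2vK !mxE.
by case: (v 0 j).
Qed.

HB.instance Definition _ :=
  Lmodule_hasFinDim.Build R[i] VC complexification_vect_iso.

End ComplexifyVector.

Section ComplexifyLie.
Import VectorInternalTheory.
Variables (R : rcfType) (g : lieAlgType R).
Local Notation gC := (complexification R g).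
Implicit Types (z w : gC).

Definition complexification_lie z w : gC :=
  (lie z.1 w.1 - lie z.2 w.2, lie z.1 w.2 + lie z.2 w.1).

Let coord j (x : g) := v2r x 0 j.

Let coordE j : (forall x y, coord j (x + y) = coord j x + coord j y)
  * (forall x, coord j (- x) = - coord j x)
  * (forall a x, coord j (a *: x) = a * coord j x)
  * (coord j 0 = 0).
Proof.
rewrite /coord; split; last by rewrite linear0 mxE.
split; last by move=> a x; rewrite linearZ mxE.
by split=> [x y|x]; rewrite (linearD, linearN) mxE.
Qed.

Let coord_inj x y : (forall j, coord j x = coord j y) -> x = y.
Proof.
move=> xy; apply: (can_inj v2rK); apply/rowP; exact: xy.
Qed.

Fact complexification_lie_anti z w :
  complexification_lie z w = - complexification_lie w z.
Proof.
rewrite /complexification_lie; congr pair; rewrite /=.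
  by rewrite opprB (lie_anti z.1 w.1) (lie_anti z.2 w.2) opprK addrC.
by rewrite opprD (lie_anti z.1 w.2) (lie_anti z.2 w.1) addrC.
Qed.

Fact complexification_lie_linearr z : linear (complexification_lie z).
Proof.
move=> c w1 w2; rewrite !complexificationZ /complexification_lie /=.
by congr pair; apply: coord_inj => j;
  rewrite !(lieDr, lieNr, lieZr) !coordE; ring.
Qed.

Fact complexification_lie_linearl w :
  linear (complexification_lie^~ w).
Proof.
move=> c z1 z2 /=.
by rewrite ![complexification_lie _ w]complexification_lie_anti
  complexification_lie_linearr opprD scalerN.
Qed.

Fact complexification_liexx z : complexification_lie z z = 0.
Proof.
rewrite /complexification_lie !liexx subr0 (lie_anti z.1) addNr.
by [].
Qed.

Fact complexification_lie_jacobi z1 z2 z3 :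
  complexification_lie z1 (complexification_lie z2 z3)
  + complexification_lie z2 (complexification_lie z3 z1)
  + complexification_lie z3 (complexification_lie z1 z2) = 0.
Proof.
have J j (x y z : g) := congr1 (coord j) (lie_jacobi x y z).
case: z1 z2 z3 => [a1 b1] [a2 b2] [a3 b3]; rewrite /complexification_lie /=.
congr pair; apply: coord_inj => j.
  have := (J j a1 a2 a3, J j a1 b2 b3, J j b1 a2 b3, J j b1 b2 a3).
  by rewrite /= !(lieDr, lieNr) !coordE => -[[[]]]; lra.
have := (J j b1 b2 b3, J j b1 a2 a3, J j a1 b2 a3, J j a1 a2 b3).
by rewrite /= !(lieDr, lieNr) !coordE => -[[[]]]; lra.
Qed.

HB.instance Definition _ := Vector_isLieAlgebra.Build R[i] gC
  complexification_lie_linearl complexification_lie_linearr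
  complexification_liexx complexification_lie_jacobi.

Lemma complexification_lieE z w :
  lie z w = (lie z.1 w.1 - lie z.2 w.2, lie z.1 w.2 + lie z.2 w.1).
Proof. by []. Qed.

Definition complexify_map (N : 'End(g)) z : gC := (N z.1, N z.2).

Fact complexify_map_linear N : linear (complexify_map N).
Proof.
move=> c z w; rewrite /complexify_map !complexificationZ.
by rewrite /= !linearD linearN !linearZ.
Qed.

HB.instance Definition _ N := GRing.isLinear.Build R[i] gC gC _
  (complexify_map N) (complexify_map_linear N).

Definition complexify_end (N : 'End(g)) : 'End(gC) := linfun (complexify_map N).

Lemma complexify_endE N z : complexify_end N z = (N z.1, N z.2).
Proof. exact: lfunE. Qed.

End ComplexifyLie.

(* Main.v *)
From HB Require Import structures.
Require Import Defs.
From mathcomp Require Import all_boot all_order all_algebra perm.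
From mathcomp Require Import complex ring zify.
From mathcomp Require Import all_classical all_reals topology normedtype.

Set Implicit Arguments.
Unset Strict Implicit.
Unset Printing Implicit Defensive.

Import Order.TTheory GRing.Theory Num.Theory passmx.
Import numFieldNormedType.Exports.
Local Open Scope ring_scope.

(** The pencil of brackets [s1 * lie + s2 * lie_deformed N] is Kronecker because
   one point [xi0] of the dual is explicit enough to compute the rank of all its
   members, and because that rank is the largest possible.

   Let [d] be the dimension of [n_-]. The proof uses a principal sl2-triple
   [(H, e, f)] with [H] in [h] and [e] in [n_+]: every simple root takes the value 2
   on [H], so that the eigenspaces of [ad H] define a grading of [g] by heights in
   which [n_-] and [b] are the parts of negative and of nonnegative degree. Let [B]
   be the Killing form.

   Upper bound ([rank_pencil_le]): all ranks are at most [2 d]. For the original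
   bracket this says that [ad u] has rank at most [2 d] for every [u]
   ([rank_ad]). It holds for [u] in [b], whose bracket with [b] lies in [n_+]; and
   up to terms of second order every element near [H] is conjugate into [b], which
   suffices for the vanishing of minors ([det_jet]). For a member
   of the pencil put [A := s1 + s2 * N]; since [N] is Nijenhuis, [A] maps the bracket
   of that member to the original bracket ([pencil_conjugation]), so the bound
   carries over when [A] is invertible, and by polynomiality always.

   Lower bound ([principal_point]): let [xi0 := B (e + H)]. It is zero
   outside the degrees -1 and 0, and so vanishes on the brackets of [n_-] with itself,
   of degree at most -2, and of [b] with itself, of positive degree. Hence every
   member of the pencil is antidiagonal with respect to [g = n_- + b], and its
   off-diagonal block is [B (lie (mu1 * H + mu2 * e) x) y] for [x] in [n_-] and [y] in
   [b], where [mu1] and [mu2] are the eigenvalues of [A]. They are not both zero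
   because [lam1] and [lam2] differ. A nonzero combination of [H] and [e] maps [n_-]
   injectively modulo [n_+] ([principal_injective], by sl2-theory), so the rank is
   [2 d] for all nonzero [s].

   Propagation ([rank_spread]): the values of [c] for which the member with
   parameters [(c, 1)] drops rank are common roots of minors that are polynomials in
   [c] with coefficients polynomial in [xi]. At [xi0] two combinations of minors have no
   common root, and a resultant keeps it so on the complement of a hypersurface,
   which is open and dense.

   The existence of the triple ([principal_grading_exists]) is the structure
   theory of split semisimple Lie algebras: weight spaces ([joint_geig_weight]),
   Engel's theorem ([engel]), Cartan's criterion ([killing_nondegenerate]), root
   spaces as genuine eigenspaces ([weight_space_eigen]), positivity of the form on
   rational combinations of roots, and the invertibility of the Gram matrix of the
   simple roots ([gram_unit]). In the real case the triple and its grading, found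
   over the reals, are extended to the complexification
   ([complexify_grading]). *)

(** * Subspaces and traces *)

Section LinearAlgebra.
Variables (F : fieldType) (V : vectType F).
Implicit Types (U W : {vspace V}) (u v w : V) (f g p : 'End(V)).

(** A subspace of maximal dimension among those contained in [P]. *)
Lemma vspace_of_pred (P : V -> Prop) :
  P 0 -> (forall a u v, P u -> P v -> P (a *: u + v)) ->
  exists U : {vspace V}, forall v, v \in U <-> P v.
Proof.
move=> P0 PD.
pose good n := `[< exists U : {vspace V}, \dim U = n /\ forall v, v \in U -> P v >].
have ex : exists n, good n.
  exists 0%N; apply/asboolP; exists 0%VS; rewrite dimv0; split=> // v.
  by rewrite memv0 => /eqP->.
have ub n : good n -> (n <= \dim {:V})%N.
  by move=> /asboolP[U [<- _]]; rewrite dimvS ?subvf.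
case: (ex_maxnP ex ub) => n /asboolP[U [dU UP]] max.
exists U => v; split=> [/UP//|Pv]; apply: contraT => vU.
have : good (\dim (U + <[v]>)).
  apply/asboolP; exists (U + <[v]>)%VS; split=> // w /memv_addP[u uU [w' /vlineP[k ->] ->]].
  by rewrite addrC; apply: PD => //; exact: UP.
move/max; rewrite -dU => le; move: vU.
have /eqP -> : (U == U + <[v]>)%VS by rewrite eqEdim addvSl.
by rewrite memvE addvSr.
Qed.

(** A singular matrix factors as [L *m R] through its rank, and [R *m L] is a
   smaller nilpotent matrix with the same trace; an invertible nilpotent matrix has
   size zero. *)
Lemma mxtrace_nilpotent n (A : 'M[F]_n) k :
  iter k (mulmx A) 1%:M = 0 -> \tr A = 0.
Proof.
elim/ltn_ind: n k A => n IHn k A Ak.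
have [rA|rA] := ltnP (\rank A) n.
  have [L [R LR]] : exists (L : 'M_(n, \rank A)) (R : 'M_(\rank A, n)), L *m R = A.
    by exists (col_base A), (row_base A); exact: mulmx_base.
  have -> : \tr A = \tr (R *m L) by rewrite mxtrace_mulC LR.
  apply: (IHn _ rA k.+1).
  have E j : iter j.+1 (mulmx (R *m L)) 1%:M = R *m (iter j (mulmx A) 1%:M *m L).
    elim: j => [|j IHj]; first by rewrite /= mulmx1 mul1mx.
    by rewrite iterS IHj [in RHS]iterS !mulmxA -(mulmxA R L R) LR.
  by rewrite E Ak mul0mx mulmx0.
have uA : A \in unitmx.
  by rewrite -row_full_unit /row_full eqn_leq rank_leq_col rA.
have n0 : n = 0%N.
  have : iter k (mulmx A) 1%:M \in unitmx.
    by elim: (k) => [|j IHj]; rewrite ?unitmx1 //= unitmx_mul uA.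
  rewrite Ak; case: n {IHn rA uA} A Ak => // n A _.
  by rewrite unitmxE det0 unitr0.
by move: A {Ak uA rA IHn}; rewrite n0 => A; rewrite /mxtrace big_ord0.
Qed.

Definition lftrace f : F := \tr (mxof (vbasis {:V}) (vbasis {:V}) f).

Lemma lftraceD f g : lftrace (f + g) = lftrace f + lftrace g.
Proof. by rewrite /lftrace linearD /= mxtraceD. Qed.

Lemma lftraceZ a f : lftrace (a *: f) = a * lftrace f.
Proof. by rewrite /lftrace linearZ /= mxtraceZ. Qed.

Lemma lftraceN f : lftrace (- f) = - lftrace f.
Proof. by rewrite -scaleN1r lftraceZ mulN1r. Qed.

Lemma lftraceB f g : lftrace (f - g) = lftrace f - lftrace g.
Proof. by rewrite lftraceD lftraceN. Qed.

Lemma lftrace0 : lftrace 0 = 0.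
Proof. by rewrite -(scale0r 0) lftraceZ mul0r. Qed.

Lemma lftrace_sum I (r : seq I) (P : pred I) (fs : I -> 'End(V)) :
  lftrace (\sum_(i <- r | P i) fs i) = \sum_(i <- r | P i) lftrace (fs i).
Proof. by apply: (big_morph _ lftraceD lftrace0). Qed.

Lemma lftraceC f g : lftrace (f \o g)%VF = lftrace (g \o f)%VF.
Proof.
by rewrite /lftrace !(mxof_comp _ _ (vbasisP {:V})) mxtrace_mulC.
Qed.

Lemma lftrace_nilpotent f k : (forall v, iter k f v = 0) -> lftrace f = 0.
Proof.
move=> fk; apply: (@mxtrace_nilpotent _ _ k).
have bf := basis_free (vbasisP {:V}).
set e := vbasis _; set M := mxof _ _ _.
have E j (v : 'rV_(\dim {:V})) :
   v *m iter j (mulmx M) 1%:M = rVof e (iter j f (vecof e v)).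
  elim: j v => [|j IHj] v /=; first by rewrite mulmx1 vecofK ?vbasisP.
  rewrite mulmxA IHj mul_mxof rVofK ?vbasisP //.
  by rewrite -iterSr.
apply/row_matrixP => i; rewrite rowE E fk linear0.
by rewrite row0.
Qed.

(** The projection factors through [W], where the reversed product is the identity. *)
Lemma lftrace_proj p W : (forall v, p v \in W) -> {in W, forall v, p v = v} ->
  lftrace p = (\dim W)%:R.
Proof.
move=> pW pid.
have bV := vbasisP {:V}; have bS := vbasisP {:subvs_of W}.
have lin : linear (fun v => vsproj W (p v)).
  by move=> a u v /=; rewrite !linearP.
pose q : {linear V -> subvs_of W} := HB.pack (fun v => vsproj W (p v))
   (GRing.isLinear.Build F _ _ _ _ lin).
have lini : linear (vsval : subvs_of W -> V) by move=> a u v; rewrite linearP.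
pose i : {linear subvs_of W -> V} := HB.pack (vsval : subvs_of W -> V)
   (GRing.isLinear.Build F _ _ _ _ lini).
have -> : p = (linfun i \o linfun q)%VF.
  by apply/lfunP => v; rewrite comp_lfunE !lfunE /= vsprojK.
rewrite /lftrace (mxof_comp _ _ bS) mxtrace_mulC -(mxof_comp _ _ bV).
have -> : (linfun q \o linfun i = \1)%VF.
  apply/lfunP => v; rewrite comp_lfunE id_lfunE !lfunE /=.
  by rewrite pid ?subvsP // vsvalK.
by rewrite mxof1 ?(basis_free bS) // mxtrace1 dimvf.
Qed.

End LinearAlgebra.

(** * Generalized eigenvectors of inner derivations *)

Section SumOf.
Variables (F : fieldType) (V : vectType F).
Implicit Types (u v w : V) (S T : V -> Prop).

(** The additive closure of [S]. *)
Inductive sumof S : V -> Prop :=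
| sumof_nil : sumof S 0
| sumof_cons u v : S u -> sumof S v -> sumof S (u + v).

Lemma sumof1 S u : S u -> sumof S u.
Proof. by move=> Su; rewrite -(addr0 u); apply: sumof_cons Su _; constructor. Qed.

Lemma sumofD S u v : sumof S u -> sumof S v -> sumof S (u + v).
Proof.
move=> Su Sv; elim: Su => [|x y Sx _ IH]; first by rewrite add0r.
by rewrite -addrA; constructor.
Qed.

Lemma sumof_bind S T v : (forall u, S u -> sumof T u) -> sumof S v -> sumof T v.
Proof.
move=> ST; elim=> [|x y Sx _ IH]; first by constructor.
by apply: sumofD => //; apply: ST.
Qed.

Lemma sumof_sub S (U : {vspace V}) v :
  (forall u, S u -> u \in U) -> sumof S v -> v \in U.
Proof.
by move=> SU; elim=> [|x y Sx _ IH]; rewrite ?mem0v // memvD // SU.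
Qed.

End SumOf.

Section GeneralizedEigenvectors.
Variables (F : fieldType) (g : lieAlgType F).
Implicit Types (x y u v w : g) (a b c : F) (U W : {vspace g}) (N : 'End(g)).

Lemma lie_derivation x u v : lie x (lie u v) = lie (lie x u) v + lie u (lie x v).
Proof.
have := lie_jacobi x u v.
rewrite (lie_anti v x) lieNr (lie_anti v (lie x u)) => /eqP.
by rewrite subr_eq0 subr_eq => /eqP->.
Qed.

Lemma lieNl x y : lie (- x) y = - lie x y.
Proof. by rewrite lie_anti lieNr -lie_anti. Qed.

Lemma lieBr x y z : lie x (y - z : g) = lie x y - lie x z.
Proof. by rewrite lieDr lieNr. Qed.

Lemma lieBl x y z : lie (x - y : g) z = lie x z - lie y z.
Proof. by rewrite lieDl lieNl. Qed.

Lemma lie0r x : lie x (0 : g) = 0.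
Proof. exact: linear0. Qed.

Lemma lie0l x : lie (0 : g) x = 0.
Proof. by rewrite lie_anti lie0r oppr0. Qed.

Lemma ad_lie x y : ad (lie x y) = ((ad x \o ad y) - (ad y \o ad x))%VF.
Proof.
apply/lfunP => v; rewrite add_lfunE opp_lfunE !comp_lfunE !adE.
by rewrite (lie_derivation x y) addrK.
Qed.

Definition shift x a v : g := lie x v - a *: v.

Lemma shiftP x a b u v : shift x a (b *: u + v) = b *: shift x a u + shift x a v.
Proof.
rewrite /shift lieDr lieZr scalerDr opprD scalerBr !scalerA (mulrC a).
by rewrite addrACA.
Qed.

Lemma iter_shiftP n x a b u v :
  iter n (shift x a) (b *: u + v)
    = b *: iter n (shift x a) u + iter n (shift x a) v.
Proof. by elim: n => //= n ->; rewrite shiftP. Qed.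

Lemma shift0 x a : shift x a 0 = 0.
Proof. by rewrite /shift lie0r scaler0 subr0. Qed.

Lemma shiftZ x a b u : shift x a (b *: u) = b *: shift x a u.
Proof. by have := shiftP x a b u 0; rewrite shift0 !addr0. Qed.

Lemma shiftB x a u v : shift x a (u - v) = shift x a u - shift x a v.
Proof. by rewrite addrC -scaleN1r shiftP scaleN1r addrC. Qed.

Lemma iter_shift0 n x a : iter n (shift x a) 0 = 0.
Proof. by elim: n => //= n ->; exact: shift0. Qed.

Lemma iter_shift_leq n m x a v : (n <= m)%N ->
  iter n (shift x a) v = 0 -> iter m (shift x a) v = 0.
Proof. by move/subnK<-; rewrite iterD => ->; rewrite iter_shift0. Qed.

Definition geig x a v : Prop := exists n, iter n (shift x a) v = 0.

Lemma geig0 x a : geig x a 0.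
Proof. by exists 0. Qed.

Lemma geig_lin x a b u v : geig x a u -> geig x a v -> geig x a (b *: u + v).
Proof.
move=> [n un] [m vm]; exists (maxn n m).
rewrite iter_shiftP (iter_shift_leq (leq_maxl n m) un).
by rewrite (iter_shift_leq (leq_maxr n m) vm) scaler0 addr0.
Qed.

Lemma geigD x a u v : geig x a u -> geig x a v -> geig x a (u + v).
Proof. by move=> u0 v0; rewrite -(scale1r u); apply: geig_lin. Qed.

Lemma geigZ x a b u : geig x a u -> geig x a (b *: u).
Proof. by move=> u0; rewrite -(addr0 (_ *: _)); apply: geig_lin => //; exact: geig0. Qed.

Lemma geigB x a u v : geig x a u -> geig x a v -> geig x a (u - v).
Proof. by move=> u0 v0; rewrite addrC -scaleN1r; apply: geig_lin. Qed.

Lemma shift_geig x a v : geig x a (shift x a v) -> geig x a v.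
Proof. by move=> [n vn]; exists n.+1; rewrite iterSr. Qed.

Lemma geig_shift x a b v : geig x a v -> geig x a (shift x b v).
Proof.
move=> [n vn]; exists n.
elim: n v vn => [v /= ->|n IHn v]; first exact: shift0.
rewrite !iterSr => /IHn; congr (iter _ _ _ = _).
rewrite /shift !lieBr !lieZr !scalerBr !scalerA (mulrC b) !opprB addrACA.
by rewrite [RHS]addrACA; congr (_ + _); rewrite addrC.
Qed.

(** The operator [ad x] is a derivation, so its generalized eigenspaces
   multiply like the eigenvalues add. *)
Lemma geig_lie x a b u v : geig x a u -> geig x b v -> geig x (a + b) (lie u v).
Proof.
case=> n + [m]; move: {2}(n + m)%N (leqnn (n + m)) => k.
elim: k n m u v => [|k IHk] [|n] m u v.
- by move=> _ /= -> _; rewrite lie0l; exact: geig0.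
- by [].
- by move=> _ /= -> _; rewrite lie0l; exact: geig0.
case: m => [|m]; first by move=> _ _ /= ->; rewrite lie0r; exact: geig0.
move=> nmk un vm; apply: shift_geig.
have -> : shift x (a + b) (lie u v) = lie (shift x a u) v + lie u (shift x b v).
  rewrite /shift lie_derivation lieBl lieBr lieZl lieZr scalerDl opprD.
  by rewrite addrACA.
apply: geigD.
- by apply: (IHk n m.+1); rewrite -?iterSr.
- by apply: (IHk n.+1 m); rewrite -?iterSr //; move: nmk; rewrite addnS.
Qed.

Lemma geig_shift_inj x a b v : a != b -> geig x b v -> shift x a v = 0 -> v = 0.
Proof.
move=> ab [n]; elim: n v => [//|n IHn] v; rewrite iterSr => vn va.
have sb : shift x b v = (a - b) *: v.
  move/eqP: va; rewrite /shift subr_eq0 => /eqP->.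
  by rewrite scalerBl.
have := IHn (shift x b v) vn; rewrite {1 2}sb.
have -> : shift x a ((a - b) *: v) = 0.
  by rewrite -(addr0 (_ *: _)) shiftP va scaler0 shift0 addr0.
move=> /(_ erefl)/eqP; rewrite scaler_eq0 subr_eq0 (negPf ab) => /eqP//.
Qed.

Lemma geig_uniq n x a b v : a != b -> geig x b v ->
  iter n (shift x a) v = 0 -> v = 0.
Proof.
move=> ab; elim: n v => [//|n IHn] v vb; rewrite iterSr => vn.
by apply: (geig_shift_inj ab vb); apply: IHn vn; exact: geig_shift.
Qed.

(** On a generalized eigenspace for [b] the operator [ad x - a] is [b - a] plus a
   nilpotent operator. Solving by iteration keeps the solution in every
   predicate [Q] stable under linear combinations and [ad x]. *)
Lemma geig_shift_surj (Q : g -> Prop) x a b v :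
  (forall c u w, Q u -> Q w -> Q (c *: u + w)) ->
  (forall u, Q u -> Q (lie x u)) -> a != b ->
  Q v -> geig x b v -> exists u, [/\ Q u, geig x b u & shift x a u = v].
Proof.
move=> Ql Qx ab Qv [n]; elim: n v Qv => [|n IHn] v Qv.
  move=> /= v0; exists v; split=> //; first by rewrite v0; exact: geig0.
  by rewrite v0 shift0.
have Qs c u : Q u -> Q (shift x c u).
  by move=> Qu; rewrite /shift -scaleNr addrC; apply: Ql => //; exact: Qx.
rewrite iterSr => vn; have [u [Qu ub uv]] := IHn _ (Qs b v Qv) vn.
have ba : b - a != 0 by rewrite subr_eq0 eq_sym.
have Q1 : Q (v - u) by rewrite addrC -scaleN1r; apply: Ql.
have gv : geig x b v by exists n.+1; rewrite iterSr.
exists ((b - a)^-1 *: (v - u)); split.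
- rewrite -(addr0 (_ *: _)); apply: (Ql) => //.
  by rewrite -(addNr u) -scaleN1r; apply: Ql.
- by apply: geigZ; apply: geigB.
rewrite shiftZ shiftB uv.
have -> : shift x a v - shift x b v = (b - a) *: v.
  by rewrite /shift opprB addrC addrA subrK scalerBl.
by rewrite scalerA mulVf // scale1r.
Qed.

(** The factors are split off one at a time: the components of [shift x a v] for
   eigenvalues other than [a] are lifted through the shift by [geig_shift_surj]. *)
Lemma geig_split (Q : g -> Prop) x (s : seq F) v :
  (forall c u w, Q u -> Q w -> Q (c *: u + w)) ->
  (forall u, Q u -> Q (lie x u)) ->
  Q v -> foldl (fun w a => shift x a w) v s = 0 ->
  sumof (fun u => Q u /\ exists a, geig x a u) v.
Proof.
move=> Ql Qx; elim: s v => [|a s IHs] v Qv /=.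
  by move=> ->; constructor.
have Qs c u : Q u -> Q (shift x c u).
  by move=> Qu; rewrite /shift -scaleNr addrC; apply: Ql => //; exact: Qx.
move/(IHs _ (Qs a v Qv)) => sv.
have Q0 : Q 0 by rewrite -(addNr v) -scaleN1r; apply: Ql.
have [u [w [Qu [us wa svE]]]] : exists u w, Q u /\
    [/\ sumof (fun u => Q u /\ exists a, geig x a u) u, geig x a w &
     shift x a v = shift x a u + w].
  elim: sv => [|u1 v1 [Qu1 [b u1b]] _ [u [w [Qu [us wa ->]]]]].
    exists 0, 0; split=> //; split; [by constructor | exact: geig0|].
    by rewrite shift0 addr0.
  have [ab|ab] := eqVneq a b.
    exists u, (u1 + w); split=> //; split=> //; last by rewrite addrCA.
    by apply: geigD => //; rewrite ab.
  have [u' [Qu' u'b <-]] := geig_shift_surj Ql Qx ab Qu1 u1b.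
  exists (u' + u), w; split; first by rewrite -(scale1r u'); apply: Ql.
  split=> //; first by apply: sumof_cons => //; split=> //; exists b.
  by rewrite -(scale1r u') shiftP !scale1r addrA.
rewrite -(subrK u v); apply: sumofD => //; apply: sumof1; split.
  by rewrite addrC -scaleN1r; apply: Ql.
exists a; apply: shift_geig.
by rewrite addrC -scaleN1r shiftP svE scaleN1r addrA addNr add0r.
Qed.

(** The Cayley-Hamilton theorem for the matrix of [ad x]. *)
Lemma char_poly_split x (s : seq F) v :
  char_poly (mxof (vbasis {:g}) (vbasis {:g}) (ad x)) = \prod_(a <- s) ('X - a%:P) ->
  foldl (fun w a => shift x a w) v s = 0.
Proof.
have bV := vbasisP {:g}.
set e := vbasis _; set M := mxof _ _ _ => cE.
have E w : foldl (fun w a => shift x a w) w s =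
    vecof e (foldl (fun r a => r *m (M - a%:M)) (rVof e w) s).
  elim: s w {cE} => [|a s IHs] w /=; first by rewrite rVofK.
  rewrite IHs; congr (vecof _ (foldl _ _ _)).
  rewrite mulmxBr mul_mx_scalar mul_mxof rVofK // adE.
  by rewrite /shift linearB linearZ.
rewrite E {E}; move: (rVof e v) => r.
suff -> : foldl (fun r a => r *m (M - a%:M)) r s = 0 by rewrite linear0.
move: M cE r; case: (\dim {:g}) => [|n] M cE r.
  by apply/rowP => -[].
have := Cayley_Hamilton M; rewrite cE rmorph_prod /=.
have -> : \prod_(a <- s) horner_mx M ('X - a%:P) = \prod_(a <- s) (M - a%:M).
  by apply: eq_bigr => a _; rewrite rmorphB /= horner_mx_X horner_mx_C.
move=> prod0.
suff -> : foldl (fun r a => r *m (M - a%:M)) r s = r *m \prod_(a <- s) (M - a%:M).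
  by rewrite prod0 mulmx0.
elim: (s) r => [|a s' IHs] r; first by rewrite big_nil mulmx1.
by rewrite /= IHs big_cons -mulmxA.
Qed.

End GeneralizedEigenvectors.

(** * Engel's theorem *)

Section Engel.
Variables (F : fieldType) (g : lieAlgType F).
Implicit Types (x y u v w : g) (a b c : F) (U W K : {vspace g}).
Implicit Types (L : g -> Prop).

Definition stable_under L U := forall x u, L x -> u \in U -> lie x u \in U.

Definition bracket_closed L := forall x y, L x -> L y -> L (lie x y).

(** [U] is the span of [L], in a form that allows inductions on the elements of
   [U]. *)
Definition lspan L U := (forall x, L x -> x \in U) /\
  (forall u, u \in U -> sumof (fun v => exists a x, L x /\ v = a *: x) u).

Lemma lspan_exists L : exists U, lspan L U.
Proof.
have [|a u v su sv|U UP] := @vspace_of_pred _ g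
    (sumof (fun v => exists a x, L x /\ v = a *: x)).
- by constructor.
- apply: sumofD => //; elim: su => [|_ w [b [x [Lx ->]]] _ IH].
    by rewrite scaler0; constructor.
  rewrite scalerDr; apply: sumofD => //; apply: sumof1.
  by exists (a * b), x; rewrite scalerA.
exists U; split=> [x Lx|u /UP //].
by apply/UP/sumof1; exists 1, x; rewrite scale1r.
Qed.

Lemma lspan_min L U W : lspan L U -> (forall x, L x -> x \in W) -> (U <= W)%VS.
Proof.
move=> [_ UL] LW; apply/subvP => u /UL; apply: sumof_sub => _ [a [x [Lx ->]]].
by rewrite memvZ // LW.
Qed.

Lemma iter_lie_lin n x a u v :
  iter n (lie x) (a *: u + v) = a *: iter n (lie x) u + iter n (lie x) v.
Proof. by elim: n => //= n ->; rewrite lieDr lieZr. Qed.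

Lemma iter_lie0 n x : iter n (lie x) 0 = 0.
Proof. by elim: n => //= n ->; rewrite lie0r. Qed.

Lemma iter_lie_leq n m x v : (n <= m)%N -> iter n (lie x) v = 0 ->
  iter m (lie x) v = 0.
Proof. by move/subnK<-; rewrite iterD => ->; rewrite iter_lie0. Qed.

Lemma span_ad_nilpotent L U x :
  lspan L U -> (forall y, L y -> exists n, iter n (lie x) y = 0) ->
  forall u, u \in U -> exists n, iter n (lie x) u = 0.
Proof.
move=> [_ UL] nil u /UL; elim=> [|_ v [a [y [Ly ->]]] _ [n vn]].
  by exists 0%N.
have [m ym] := nil y Ly; exists (maxn m n).
rewrite iter_lie_lin (iter_lie_leq (leq_maxl m n) ym).
by rewrite (iter_lie_leq (leq_maxr m n) vn) scaler0 addr0.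
Qed.

Lemma lspan_stable L U : bracket_closed L -> lspan L U -> stable_under L U.
Proof.
move=> Lc [LU UL] x u Lx /UL; elim=> [|_ v [a [y [Ly ->]]] _ vU].
  by rewrite lie0r mem0v.
by rewrite lieDr lieZr memvD // memvZ // LU //; apply: Lc.
Qed.

Lemma lspan_act L K U W x u : lspan L K -> (forall y v, L y -> v \in U -> lie y v \in W) ->
  x \in K -> u \in U -> lie x u \in W.
Proof.
move=> [_ KL] LW /KL xK uU; elim: xK => [|_ v [a [y [Ly ->]]] _ vU].
  by rewrite lie0l mem0v.
by rewrite lieDl lieZl memvD // memvZ // LW.
Qed.

(** Engel's theorem in Jacobson's form, for a set [L] of operators closed under
   brackets, acting on the quotient of [U] by [U']. By induction on the dimension
   of the span [S] of [L]: a maximal proper subspace [K] of [S] spanned by elements of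
   [L] is completed to [S] by one element [x] of [L] that normalizes [K]; by
   induction [K] annihilates some vector modulo [U'], and iterating [x] on it
   reaches a vector annihilated by all of [L]. *)
Theorem engel L U' U : bracket_closed L ->
  (forall x y, L x -> L y -> exists n, iter n (lie x) y = 0) ->
  stable_under L U' -> stable_under L U ->
  (U' <= U)%VS -> U' != U ->
  (forall x u, L x -> u \in U -> exists n, iter n (lie x) u \in U') ->
  exists u, [/\ u \in U, u \notin U' & forall x, L x -> lie x u \in U'].
Proof.
have [S LS] := lspan_exists L.
move: {2}(\dim S) (leqnn (\dim S)) => d.
elim/ltn_ind: d L S LS U' U => d IH L S LS U' U dS Lc Lnil U'st Ust U'U U'nU Unil.
have LSin := LS.1.
(* a maximal proper subspace of S spanned by its elements in L *)
have [S0|Sn0] := eqVneq S 0%VS.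
  have /subvPn[u uU uU'] : ~~ (U <= U')%VS.
    by apply: contra U'nU => UU'; rewrite eqEsubv U'U.
  exists u; split=> // x /LSin; rewrite S0 memv0 => /eqP->.
  by rewrite lie0l mem0v.
pose good n := `[< exists L' K, [/\ \dim K = n, lspan L' K, bracket_closed L',
    forall x, L' x <-> L x /\ x \in K & K != S] >].
have ex : exists n, good n.
  exists 0%N; apply/asboolP; exists (fun x => L x /\ x = 0), 0%VS.
  split=> //; rewrite ?dimv0 //; last by rewrite eq_sym.
  - split=> [x [_ ->]|u]; first exact: mem0v.
    by rewrite memv0 => /eqP->; constructor.
  - move=> x y [Lx x0] [Ly _]; split; first exact: Lc.
    by rewrite x0 lie0l.
  by move=> x; rewrite memv0; split=> -[Lx /eqP].
have ub n : good n -> (n <= \dim S)%N.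
  move=> /asboolP[L' [K [<- L'K _ L'E _]]].
  by rewrite dimvS // (lspan_min L'K) // => x /L'E[/LSin].
case: (ex_maxnP ex ub) => n /asboolP[L' [K [dK L'K L'c L'E KS]]] max {ub ex}.
have L'L x : L' x -> L x by move/L'E=> [].
have KleS : (K <= S)%VS by apply: (lspan_min L'K) => x /L'E[/LSin].
have ltKS : (\dim K < d)%N.
  apply: leq_trans dS; rewrite ltn_neqAle dimvS // andbT.
  by apply: contra KS => /eqP eqd; rewrite eqEdim KleS eqd /=.
have IH' := IH _ ltKS L' K L'K.
have L'nil x y : L' x -> L' y -> exists n, iter n (lie x) y = 0.
  by move=> /L'L Lx /L'L Ly; apply: Lnil.
have Sst : stable_under L' S.
  by move=> x u /L'L Lx uS; apply: (lspan_stable Lc LS).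
have Kst : stable_under L' K by apply: lspan_stable.
(* a maximal L'-stable subspace M of S with no element of L outside K; the
   induction hypothesis applied to S modulo M provides x *)
pose goodM m := `[< exists M : {vspace g}, [/\ \dim M = m, (K <= M)%VS, (M <= S)%VS,
   stable_under L' M & forall x, L x -> x \in M -> x \in K] >].
have exM : exists m, goodM m.
  by exists (\dim K); apply/asboolP; exists K; split.
have ubM m : goodM m -> (m <= \dim S)%N.
  by move=> /asboolP[M [<- _ MS _ _]]; rewrite dimvS.
case: (ex_maxnP exM ubM) => m /asboolP[M [dM KM MS Mst MK]] maxM {ubM exM}.
have MnS : M != S.
  apply: contra KS => /eqP MS'; rewrite eqEsubv KleS /=.
  apply: (lspan_min LS) => x Lx; apply: MK => //.
  by rewrite MS' LSin.
have [|v [vS vM L'v]] := IH' M S (leqnn _) L'c L'nil Mst Sst MS MnS.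
  move=> x u L'x uS; have [|k uk] := @span_ad_nilpotent L S x LS _ u uS.
    by move=> y Ly; apply: Lnil; [exact: L'L | exact: Ly].
  by exists k; rewrite uk mem0v.
have [x [Lx xMv xK]] : exists x, [/\ L x, x \in (M + <[v]>)%VS & x \notin K].
  apply/not_existsP => none.
  have : goodM (\dim (M + <[v]>)).
    apply/asboolP; exists (M + <[v]>)%VS; split=> //.
    - by apply: subv_trans (addvSl _ _).
    - by rewrite subv_add MS -memvE.
    - move=> y _ L'y /memv_addP[w wM [_ /vlineP[c ->] ->]].
      rewrite lieDr lieZr; apply: (subvP (addvSl _ _)).
      by rewrite memvD ?memvZ ?L'v //; apply: Mst.
    move=> y Ly yMv; apply: contraT => yK; case: (none y).
    by split.
  move/maxM; rewrite -dM => le; move: vM.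
  have /eqP -> : (M == M + <[v]>)%VS by rewrite eqEdim addvSl.
  by rewrite memvE addvSr.
have L'x y : L' y -> lie y x \in K.
  move=> L'y; apply: MK; first by apply: Lc => //; exact: L'L.
  case/memv_addP: xMv => w wM [_ /vlineP[c ->] ->].
  by rewrite lieDr lieZr memvD ?memvZ ?L'v //; apply: Mst.
have xS := LSin x Lx.
have Kx y : y \in K -> lie y x \in K.
  move=> yK; apply: (lspan_act L'K _ yK (memv_line x)) => z w L'z /vlineP[c ->].
  by rewrite lieZr memvZ // L'x.
have KK y z : y \in K -> z \in K -> lie y z \in K.
  by move=> yK zK; apply: (lspan_act L'K _ yK zK) => *; apply: Kst.
(* by maximality K together with x spans everything *)
have KxS : (K + <[x]>)%VS = S.
  apply/eqP/negPn/negP => nS.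
  have : good (\dim (K + <[x]>)).
    apply/asboolP; exists (fun y => L y /\ y \in (K + <[x]>)%VS), (K + <[x]>)%VS.
    split=> //.
    - split=> [y []//|u /memv_addP[k kK [_ /vlineP[c ->] ->]]].
      rewrite addrC; apply: sumofD.
        apply: sumof1; exists c, x; split=> //; split=> //.
        by apply: (subvP (addvSr _ _)); exact: memv_line.
      case: L'K => _ /(_ k kK); apply: sumof_bind => _ [a [y [/L'E[Ly yK] ->]]].
      apply: sumof1; exists a, y; split=> //; split=> //.
      exact: (subvP (addvSl _ _)).
    move=> y z [Ly yK] [Lz zK]; split; first exact: Lc.
    apply: (subvP (addvSl _ _)).
    case/memv_addP: yK => k kK [_ /vlineP[c ->] ->].
    case/memv_addP: zK => k' k'K [_ /vlineP[c' ->] ->].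
    rewrite lieDl !lieDr !lieZl !lieZr liexx !scaler0 addr0 memvD //.
      by rewrite memvD ?KK // memvZ // Kx.
    by rewrite memvZ // lie_anti memvN Kx.
  move/max; rewrite -dK => le; move: xK.
  have /eqP -> : (K == K + <[x]>)%VS by rewrite eqEdim addvSl.
  by rewrite memvE addvSr.
have [|||w [wU wU' L'w]] := IH' U' U (leqnn _) L'c L'nil _ _ U'U U'nU _.
- by move=> y u /L'L; apply: U'st.
- by move=> y u /L'L; apply: Ust.
- by move=> y u /L'L; apply: Unil.
have Kw u : u \in U -> (forall y, L' y -> lie y u \in U') ->
    forall y, y \in K -> lie y u \in U'.
  move=> uU L'u y yK; apply: (lspan_act L'K _ yK (memv_line u)) => z t L'z /vlineP[c ->].
  by rewrite lieZr memvZ // L'u.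
(* iterate x on w until it falls into U' *)
have [k0 wk0] := Unil x w Lx wU.
have exk : exists k, iter k (lie x) w \in U' by exists k0.
case: (ex_minnP exk) => -[|k] kU' kmin; first by rewrite kU' in wU'.
have inv j : iter j (lie x) w \in U /\
    forall y, L' y -> lie y (iter j (lie x) w) \in U'.
  elim: j => [//|j [IHU IHL]]; split; first exact: Ust.
  move=> y L'y; rewrite iterS lie_derivation memvD //; last first.
    by apply: U'st => //; apply: IHL.
  by apply: Kw => //; apply: L'x.
have [uU L'u] := inv k.
exists (iter k (lie x) w); split=> //.
  by apply/negP => /kmin; rewrite ltnn.
move=> y /LSin; rewrite -KxS => /memv_addP[z zK [_ /vlineP[c ->] ->]].
by rewrite lieDl lieZl memvD ?memvZ // Kw.
Qed.

End Engel.

(** * Weight spaces of a split Cartan subalgebra *)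

Section Weights.
Variables (F : numFieldType) (g : lieAlgType F) (h : {vspace g}).
Hypothesis hC : split_cartan_subalgebra h.
Implicit Types (x y u v w : g) (a b c : F) (U W : {vspace g}).
Local Notation weight := 'Hom(subvs_of h, F^o).
Implicit Types (r s : weight).

Lemma iter_shift_lie n x v : iter n (shift x 0) v = iter n (lie x) v.
Proof. by elim: n => //= n ->; rewrite /shift scale0r subr0. Qed.

Lemma cartan_lie x y : x \in h -> y \in h -> lie x y \in h.
Proof. by case: hC => -[hs _ _] _; apply: hs. Qed.

Lemma cartan_geig x y : x \in h -> y \in h -> geig x 0 y.
Proof.
case: hC => -[_ [n hn] _] _ xh yh; exists n; rewrite iter_shift_lie.
suff : iter n (lie x) y \in lower_central_series h n by rewrite hn memv0 => /eqP.
by elim: n {hn} => //= n IHn; apply: memv_lie.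
Qed.

Lemma cartan_split x : x \in h ->
  exists s : seq F, forall v : g, foldl (fun w a => shift x a w) v s = 0.
Proof.
by case: hC => _ hsp /hsp[s sE]; exists s => w; apply: char_poly_split sE.
Qed.

Lemma weight_space_exists r : exists U : {vspace g}, forall v,
  v \in U <-> forall t : subvs_of h, geig (vsval t) (r t) v.
Proof.
apply: vspace_of_pred => [t|a u v ur vr t]; first exact: geig0.
exact: geig_lin.
Qed.

(** Generalized weight space; for semisimple [g] it turns out to be the
   root space [root_space r]. *)
Definition weight_space r : {vspace g} := sval (cid (weight_space_exists r)).

Lemma weight_spaceP r v :
  v \in weight_space r <-> forall t : subvs_of h, geig (vsval t) (r t) v.
Proof. exact: (svalP (cid (weight_space_exists r))). Qed.

Lemma weight_space_lie r s u v :
  u \in weight_space r -> v \in weight_space s -> lie u v \in weight_space (r + s).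
Proof.
move=> /weight_spaceP ur /weight_spaceP vs; apply/weight_spaceP => t.
by rewrite add_lfunE; apply: geig_lie.
Qed.

Lemma cartan_sub_weight0 x : x \in h -> x \in weight_space 0.
Proof.
move=> xh; apply/weight_spaceP => t; rewrite zero_lfunE.
by apply: cartan_geig => //; exact: subvsP.
Qed.

Lemma weight_space_cartan r x v :
  x \in h -> v \in weight_space r -> lie x v \in weight_space r.
Proof.
by move=> /cartan_sub_weight0 xh vr; rewrite -(add0r r); apply: weight_space_lie.
Qed.

Lemma geig_uniform x a W : (forall v, v \in W -> geig x a v) ->
  exists n, forall v, v \in W -> iter n (shift x a) v = 0.
Proof.
move=> Wx.
have /choice[f fP] v : exists n, v \in W -> iter n (shift x a) v = 0.
  have [vW|vW] := boolP (v \in W); last by exists 0%N.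
  by have [n vn] := Wx v vW; exists n.
have [n fn] : exists n, forall i : 'I_(\dim W), (f ((vbasis W)`_i)%R <= n)%N.
  exists (\max_(i < \dim W) f ((vbasis W)`_i)%R)%N => i.
  exact: (leq_bigmax (F := fun i : 'I_(\dim W) => f ((vbasis W)`_i)%R)).
exists n => v vW; rewrite (coord_vbasis vW); elim/big_ind: _ => [|u w u0 w0|i _].
- exact: iter_shift0.
- by rewrite -(scale1r u) iter_shiftP u0 w0 scaler0 addr0.
rewrite -[_ *: _]addr0 iter_shiftP iter_shift0 addr0.
rewrite (iter_shift_leq (fn i)) ?scaler0 //.
by apply: fP; rewrite vbasis_mem // mem_nth ?size_tuple.
Qed.

(** [ad x - a] is nilpotent on [W]. *)
Lemma lftrace_geig (p : 'End(g)) x a W :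
  (forall v, p v \in W) -> {in W, forall v, p v = v} ->
  (forall v, v \in W -> lie x v \in W) ->
  (forall v, v \in W -> geig x a v) ->
  lftrace (ad x \o p)%VF = a * (\dim W)%:R.
Proof.
move=> pW pid xW Wx; have [n Wn] := geig_uniform Wx.
have := @lftrace_nilpotent _ _ ((ad x - a *: \1) \o p)%VF n.+1.
rewrite comp_lfunDl lftraceD comp_lfunNl lftraceN -comp_lfunZl lftraceZ comp_lfun1l.
rewrite (lftrace_proj pW pid) => H; apply/eqP; rewrite -subr_eq0; apply/eqP/H => v {H}.
rewrite iterSr.
set A := (X in iter n X); have AW w : A w = shift x a (p w).
  by rewrite /A add_lfunE opp_lfunE !comp_lfunE scale_lfunE adE.
have sW w : w \in W -> shift x a w \in W.
  by move=> wW; rewrite memvB ?memvZ ?xW.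
have Av : A v \in W by rewrite AW sW.
have E m w : w \in W -> iter m A w = iter m (shift x a) w.
  elim: m w => // m IHm w wW; rewrite !iterSr AW (pid w wW).
  by rewrite IHm // sW.
by rewrite E // Wn.
Qed.

Lemma ad_lin a x y : ad (a *: x + y) = a *: ad x + ad y.
Proof.
by apply/lfunP => v; rewrite add_lfunE scale_lfunE !adE lieDl lieZl.
Qed.

Lemma ad0 : ad (0 : g) = 0.
Proof. by apply/lfunP => v; rewrite adE lie0l zero_lfunE. Qed.

Lemma ad_sum (I : Type) (q : seq I) (P : pred I) (c : I -> F) (f : I -> g) :
  ad (\sum_(i <- q | P i) c i *: f i) = \sum_(i <- q | P i) c i *: ad (f i).
Proof.
elim/big_rec2: _ => [|i x y _ <-]; first exact: ad0.
by rewrite ad_lin.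
Qed.

(** Jointly generalized eigenvectors of a basis of [h] are weight vectors: on
   the space of all of them, the unique eigenvalue of each element of [h] is
   its normalized trace, hence linear. *)
Lemma joint_geig_weight (al : nat -> F) u :
  (forall i, (i < \dim h)%N -> geig (vbasis h)`_i (al i) u) ->
  exists r, u \in weight_space r.
Proof.
move=> ual; pose th (t : subvs_of h) : F^o :=
  \sum_(i < \dim h) coord (vbasis h) i (vsval t) * al i.
have thl : linear th.
  move=> a t t'; rewrite /th scaler_sumr -big_split /=; apply: eq_bigr => i _.
  by rewrite linearP /= mulrDl -mulrA.
pose thL : {linear subvs_of h -> F^o} := HB.pack th
  (GRing.isLinear.Build F _ _ _ _ thl).
exists (linfun thL); apply/weight_spaceP => t; rewrite lfunE /=.
have [J JP] := @vspace_of_pred _ g (fun u => forall i, (i < \dim h)%N ->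
   geig (vbasis h)`_i (al i) u) (fun i _ => geig0 _ _)
   (fun a u v Hu Hv i il => geig_lin a (Hu i il) (Hv i il)).
have bh i : (i < \dim h)%N -> (vbasis h)`_i \in h.
  by move=> il; rewrite vbasis_mem // mem_nth // size_tuple.
have Jst y v : y \in h -> v \in J -> lie y v \in J.
  move=> yh /JP vJ; apply/JP => i il; rewrite -(add0r (al i)).
  by apply: geig_lie; [apply: cartan_geig => //; exact: bh | exact: vJ].
have [s sP] := cartan_split (subvsP t).
have uJ : u \in J by apply/JP.
have := @geig_split _ g (fun v => v \in J) (vsval t) s u _ _ uJ (sP u).
move=> /(_ (fun c v w vJ wJ => rpredD (rpredZ c vJ) wJ)).
move=> /(_ (fun v => @Jst _ v (subvsP t))).
elim=> [|v w [vJ [c vc]] _ IH]; first exact: geig0.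
apply: geigD IH; have [->|v0] := eqVneq v 0; first exact: geig0.
have [W WP] := @vspace_of_pred _ g (fun v => v \in J /\ geig (vsval t) c v)
   (conj (mem0v J) (geig0 _ _))
   (fun a u v Hu Hv => conj (rpredD (rpredZ a Hu.1) Hv.1) (geig_lin a Hu.2 Hv.2)).
have Wst y v' : y \in h -> v' \in W -> lie y v' \in W.
  move=> yh /WP[v'J v'c]; apply/WP; split; first exact: Jst.
  by rewrite -(add0r c); apply: geig_lie => //; apply: cartan_geig => //; exact: subvsP.
suff <- : c = th t by [].
have dW : (\dim W)%:R != 0 :> F.
  rewrite pnatr_eq0 dimv_eq0; apply: contra v0 => /eqP W0.
  by rewrite -memv0 -W0; apply/WP.
apply: (mulIf dW).
have pW v' : projv W v' \in W by exact: memv_proj.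
have pid : {in W, forall v', projv W v' = v'} by move=> v'; exact: projv_id.
rewrite -(lftrace_geig pW pid (fun v' => @Wst _ v' (subvsP t))); last by move=> v' /WP[].
have -> : ad (vsval t) = \sum_(i < \dim h) coord (vbasis h) i (vsval t) *: ad (vbasis h)`_i.
  by rewrite -ad_sum -coord_vbasis // subvsP.
rewrite (big_morph (fun f : 'End(g) => (f \o projv W)%VF)
  (fun f f' => comp_lfunDl f f' _) (comp_lfun0l _ _)) lftrace_sum mulr_suml.
apply: eq_bigr => i _; have bi := bh i (ltn_ord i).
rewrite -comp_lfunZl lftraceZ (lftrace_geig (a := al i) pW pid) ?mulrA //.
  by move=> v'; apply: Wst.
by move=> v' /WP[/JP v'J _]; apply: v'J.
Qed.

(** The basis elements of [h] are diagonalized one after the other; [k] counts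
   those already done. *)
Lemma weight_decomp W v :
  (forall x u, x \in h -> u \in W -> lie x u \in W) -> v \in W ->
  sumof (fun u => u \in W /\ exists r, u \in weight_space r) v.
Proof.
move=> Wst vW.
have bh i : (i < \dim h)%N -> (vbasis h)`_i \in h.
  by move=> il; rewrite vbasis_mem // mem_nth // size_tuple.
suff H k : (k <= \dim h)%N -> sumof (fun u => u \in W /\ exists al : nat -> F,
    forall i, (i < k)%N -> geig (vbasis h)`_i (al i) u) v.
  apply: sumof_bind (H _ (leqnn _)) => u [uW [al ual]]; apply: sumof1; split=> //.
  exact: joint_geig_weight ual.
elim: k => [_|k IHk kl].
  by apply: sumof1; split=> //; exists (fun _ => 0).
apply: sumof_bind (IHk (ltnW kl)) => u [uW [al ual]].
have [s sP] := cartan_split (bh k kl).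
pose Q w := w \in W /\ forall i, (i < k)%N -> geig (vbasis h)`_i (al i) w.
have Ql c w w' : Q w -> Q w' -> Q (c *: w + w').
  move=> [wW wa] [w'W w'a]; split; first by rewrite memvD ?memvZ.
  by move=> i ik; apply: geig_lin; [exact: wa|exact: w'a].
have Qx w : Q w -> Q (lie (vbasis h)`_k w).
  move=> [wW wa]; split; first by apply: Wst => //; exact: bh.
  move=> i ik; rewrite -(add0r (al i)); apply: geig_lie; last exact: wa.
  by apply: cartan_geig; apply: bh => //; exact: ltn_trans ik kl.
apply: sumof_bind (geig_split Ql Qx (conj uW ual) (sP u)) => w [[wW wa] [a wka]].
apply: sumof1; split=> //; exists (fun i => if i == k then a else al i) => i.
rewrite ltnS leq_eqVlt => /predU1P[->|ik]; first by rewrite eqxx.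
by rewrite (ltn_eqF ik); apply: wa.
Qed.

(** Choose [t] on which [r] and the head of [q] differ: a power of the shift of
   [ad t] kills the component in the head and is injective on the weight space
   of [r]. *)
Lemma weight_space_indep r (q : seq weight) v :
  r \notin q -> v \in weight_space r ->
  v \in (\sum_(s <- q) weight_space s)%VS -> v = 0.
Proof.
elim: q v => [|s q IHq] v; first by rewrite big_nil memv0 => _ _ /eqP.
rewrite inE negb_or big_cons => /andP[rs rq] vr /memv_addP[u us [w wq vE]].
have [t rst] : exists t, r t != s t.
  apply: contrapT => /forallNP rsE; move/eqP: rs; apply; apply/lfunP => t.
  by apply/eqP/negPn/negP/rsE.
have /weight_spaceP/(_ t)[n un] := us.
have vt : geig (vsval t) (r t) v by move/weight_spaceP: vr.
have st m c p x : x \in weight_space p -> iter m (shift (vsval t) c) x \in weight_space p.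
  move=> xp; elim: m => //= m; set y := iter _ _ _ => yp.
  by rewrite memvB ?memvZ // weight_space_cartan // subvsP.
apply: (@geig_uniq _ _ n (vsval t) (s t) (r t)) => //; first by rewrite eq_sym.
apply: IHq => //; first exact: st.
rewrite vE -(scale1r u) iter_shiftP un scaler0 add0r.
elim: (n) {un} => //= m; set y := iter _ _ _ => yp.
have qst x : x \in (\sum_(s <- q) weight_space s)%VS ->
    lie (vsval t) x \in (\sum_(s <- q) weight_space s)%VS.
  elim: (q) x => [|p q' IH] x; first by rewrite !big_nil !memv0 => /eqP->; rewrite lie0r.
  rewrite !big_cons => /memv_addP[x1 x1p [x2 x2q ->]]; rewrite lieDr memv_add ?IH //.
  by rewrite weight_space_cartan // subvsP.
by rewrite memvB ?memvZ // qst.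
Qed.

Lemma weights_exist : exists q : seq weight,
  [/\ uniq q, forall r, (r \in q) = (weight_space r != 0%VS) &
     (\sum_(r <- q) weight_space r)%VS = fullv].
Proof.
have H v : exists q : seq weight, v \in (\sum_(s <- q) weight_space s)%VS.
  have := @weight_decomp fullv v (fun _ _ _ _ => memvf _) (memvf _).
  elim=> [|u w [_ [r ur]] _ [q wq]]; first by exists nil; rewrite mem0v.
  by exists (r :: q); rewrite big_cons memv_add.
have [q0 q0f] : exists q : seq weight, (fullv <= \sum_(s <- q) weight_space s)%VS.
  have -> : fullv = <<vbasis {:g}>>%VS by rewrite (span_basis (vbasisP _)).
  elim: (vbasis _ : seq g) => [|v l [q lq]]; first by exists nil; rewrite span_nil big_nil subvv.
  have [q' vq'] := H v; exists (q' ++ q); rewrite span_cons big_cat /=.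
  by apply: addvS => //; rewrite -memvE.
pose q := [seq r <- undup q0 | weight_space r != 0%VS].
have qS r : weight_space r != 0%VS -> r \in q0 ->
    (weight_space r <= \sum_(r <- q) weight_space r)%VS.
  move=> r0 rq; have rq' : r \in q by rewrite mem_filter r0 mem_undup.
  by rewrite (big_rem _ rq') /= addvSl.
have qf : (\sum_(r <- q) weight_space r)%VS = fullv.
  apply/eqP; rewrite eqEsubv subvf /=; apply: subv_trans q0f _.
  rewrite big_seq; apply: (big_ind (fun U => U <= _)%VS) => [|U W|r rq].
  - exact: sub0v.
  - by rewrite subv_add => -> ->.
  by have [->|/qS->//] := eqVneq (weight_space r) 0%VS; exact: sub0v.
exists q; split=> //; first by rewrite filter_uniq ?undup_uniq.
move=> r; apply/idP/idP => [|r0]; first by rewrite mem_filter => /andP[].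
apply: contraT => rq; move: r0; rewrite -vpick0.
by rewrite (weight_space_indep rq (memv_pick _)) ?eqxx // qf memvf.
Qed.

Definition weights : seq weight := sval (cid weights_exist).

Lemma weights_uniq : uniq weights.
Proof. by case: (svalP (cid weights_exist)). Qed.

Lemma mem_weights r : (r \in weights) = (weight_space r != 0%VS).
Proof. by case: (svalP (cid weights_exist)). Qed.

Lemma sum_weight_space : (\sum_(r <- weights) weight_space r)%VS = fullv.
Proof. by case: (svalP (cid weights_exist)). Qed.

Lemma weight_sum_eq0 (f : weight -> g) :
  (forall r, f r \in weight_space r) -> \sum_(r <- weights) f r = 0 ->
  forall r, f r = 0.
Proof.
move=> fr f0 r; have [rq|] := boolP (r \in weights); last first.
  by rewrite mem_weights negbK => /eqP r0; apply/eqP; rewrite -memv0 -r0.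
apply: (@weight_space_indep r (rem r weights) (f r)) => //.
  by rewrite mem_rem_uniq ?weights_uniq // inE eqxx.
move: f0; rewrite (big_rem _ rq) /= => /eqP; rewrite addr_eq0 => /eqP->.
rewrite memvN; elim: (rem r weights) => [|s q IH]; first by rewrite !big_nil mem0v.
by rewrite !big_cons memv_add.
Qed.

Definition weight_proj r : 'End(g) :=
  sumv_pi_for (erefl (\sum_(r <- weights) weight_space r)%VS) r.

Lemma weight_proj_mem r v : weight_proj r v \in weight_space r.
Proof. exact: memv_sum_pi. Qed.

Lemma weight_proj_sum v : \sum_(r <- weights) weight_proj r v = v.
Proof.
rewrite sumv_pi_uniq_sum ?sum_weight_space ?memvf //.
by rewrite filter_predT weights_uniq.
Qed.

Lemma weight_ind (Q : g -> Prop) :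
  Q 0 -> (forall u v, Q u -> Q v -> Q (u + v)) ->
  (forall r v, v \in weight_space r -> Q v) -> forall v, Q v.
Proof.
move=> Q0 QD Qr v; rewrite -(weight_proj_sum v).
by apply: big_ind => // r _; apply: (Qr r); exact: weight_proj_mem.
Qed.

Lemma weight_proj_id r s v : v \in weight_space r ->
  weight_proj s v = if s == r then v else 0.
Proof.
move=> vr; pose f s := weight_proj s v - if s == r then v else 0.
have fm p : f p \in weight_space p.
  rewrite /f memvB ?weight_proj_mem //; case: eqP => [->//|_]; exact: mem0v.
suff /(weight_sum_eq0 fm)/(_ s)/eqP : \sum_(p <- weights) f p = 0.
  by rewrite subr_eq0 => /eqP.
rewrite sumrB weight_proj_sum; apply/eqP; rewrite subr_eq0; apply/eqP.
have [rw|] := boolP (r \in weights); last first.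
  rewrite mem_weights negbK => /eqP r0; move: vr; rewrite r0 memv0 => /eqP->.
  by rewrite big1 // => p _; case: ifP.
rewrite (big_rem _ rw) /= eqxx big_seq big1 ?addr0 // => p.
by rewrite mem_rem_uniq ?weights_uniq // inE => /andP[/negPf->].
Qed.

Lemma weight_proj_combination (S : pred weight) (c : weight -> F) r v :
  v \in weight_space r ->
  \sum_(s <- weights | S s) c s *: weight_proj s v = if S r then c r *: v else 0.
Proof.
move=> vr; have E s : c s *: weight_proj s v = if s == r then c r *: v else 0.
  by rewrite (weight_proj_id s vr); case: eqP => [->//|_]; rewrite scaler0.
rewrite (eq_bigr _ (fun s _ => E s)) big_mkcond.
rewrite (eq_bigr (fun s => if s == r then (if S r then c r *: v else 0) else 0)); last first.
  by move=> s _; case: eqP => [->//|_]; case: ifP.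
rewrite -big_mkcond -big_filter.
have [rw|] := boolP (r \in weights).
  by rewrite filter_pred1_uniq ?weights_uniq // big_seq1.
rewrite mem_weights negbK => /eqP r0; move: vr; rewrite r0 memv0 => /eqP->.
by rewrite scaler0 if_same big1.
Qed.

Lemma lftrace_weights f : lftrace f = \sum_(r <- weights) lftrace (f \o weight_proj r)%VF.
Proof.
rewrite -lftrace_sum; congr lftrace; apply/lfunP => v.
rewrite sum_lfunE -{1}(weight_proj_sum v) linear_sum /=.
by apply: eq_bigr => r _; rewrite comp_lfunE.
Qed.

Lemma lftrace_cartan r (x : subvs_of h) :
  lftrace (ad (vsval x) \o weight_proj r)%VF = r x * (\dim (weight_space r))%:R.
Proof.
apply: lftrace_geig; first exact: weight_proj_mem.
- by move=> v vr; rewrite (weight_proj_id _ vr) eqxx.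
- by move=> v; apply: weight_space_cartan; exact: subvsP.
by move=> v /weight_spaceP.
Qed.

(** Engel's theorem for the action of [h] on the quotient of its weight space for
   zero by [h] would produce an element that normalizes [h] outside [h]. *)
Lemma cartan_weight0 : weight_space 0 = h.
Proof.
apply/eqP; rewrite eq_sym; apply: contraT => hn0.
have hs : (h <= weight_space 0%R)%VS by apply/subvP; exact: cartan_sub_weight0.
have [||||x u xh|v [v0 vh hv]] := @engel _ g (fun x => x \in h) h (weight_space 0) _ _ _ _ hs hn0 _.
- by move=> x y; exact: cartan_lie.
- by move=> x y xh yh; have [n] := cartan_geig xh yh; rewrite iter_shift_lie; exists n.
- by move=> x y; exact: cartan_lie.
- by move=> x y; exact: weight_space_cartan.
- move=> /weight_spaceP/(_ (vsproj h x)); rewrite vsprojK // zero_lfunE.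
  by move=> [n]; rewrite iter_shift_lie => un; exists n; rewrite un mem0v.
case: hC => -[_ _ hn] _; suff : v \in h by rewrite (negPf vh).
by apply: hn => y yh; rewrite lie_anti memvN; apply: hv.
Qed.

(** Only finitely many of the [s + n r] are weights, so root vectors are
   ad-nilpotent. *)
Lemma weight_vector_nilpotent r x v : r != 0 -> x \in weight_space r ->
  exists n, iter n (lie x) v = 0.
Proof.
move=> r0 xr.
have H s w : w \in weight_space s -> exists n, iter n (lie x) w = 0.
  move=> ws; have ww n : iter n (lie x) w \in weight_space (s + r *+ n).
    elim: n => [|n IH]; first by rewrite mulr0n addr0.
    by rewrite mulrS addrCA; apply: weight_space_lie.
  apply: contrapT => /forallNP nz.
  have inw n : s + r *+ n \in weights.
    rewrite mem_weights; apply: contra_notN (nz n) => /eqP E.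
    by apply/eqP; rewrite -memv0 -E.
  have inj : injective (fun n : 'I_(size weights).+1 => s + r *+ n).
    move=> i j /addrI/eqP; rewrite -!(scaler_nat _ r) -subr_eq0 -scalerBl scaler_eq0 (negPf r0) orbF.
    by rewrite subr_eq0 eqr_nat => /eqP/val_inj.
  have : (size [seq (s + r *+ nat_of_ord n)%R | n : 'I_(size weights).+1] <= size weights)%N.
    apply: uniq_leq_size; first by rewrite map_inj_uniq ?enum_uniq.
    by move=> _ /mapP[n _ ->].
  by rewrite size_map -cardE card_ord ltnn.
elim/weight_ind: v => [|u w [n un] [m wm]|s w ws]; last exact: H ws.
  by exists 0%N.
exists (maxn n m); rewrite -(scale1r u) iter_lie_lin.
rewrite (iter_lie_leq (leq_maxl n m) un).
by rewrite (iter_lie_leq (leq_maxr n m) wm) scaler0 addr0.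
Qed.

End Weights.

(** * The Killing form and Cartan's criterion *)

(** An injective linear map from [V] to its dual is onto. *)
Lemma bilinear_repr (F : fieldType) (V : vectType F) (B : V -> V -> F) :
  (forall y, linear (fun x => B x y : F^o)) -> (forall x, linear (B x : V -> F^o)) ->
  (forall x, (forall y, B x y = 0) -> x = 0) ->
  forall phi : 'Hom(V, F^o), exists d, forall y, phi y = B d y.
Proof.
move=> Bl Br Bnd phi.
pose Bx x : {linear V -> F^o} := HB.pack (B x : V -> F^o)
  (GRing.isLinear.Build F _ _ _ _ (Br x)).
have Pl : linear (fun x => linfun (Bx x)).
  move=> a x y; apply/lfunP => z; rewrite add_lfunE scale_lfunE !lfunE /=.
  exact: Bl.
pose P0 : {linear V -> 'Hom(V, F^o)} := HB.pack (fun x => linfun (Bx x))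
  (GRing.isLinear.Build F _ _ _ _ Pl).
have ker0 : ({:V} :&: lker (linfun P0) = 0)%VS.
  apply/eqP; rewrite -subv0; apply/subvP => x; rewrite memv_cap memv_ker lfunE /=.
  move=> /andP[_ /eqP x0]; rewrite memv0; apply/eqP/Bnd => y.
  have E := congr1 (fun f : 'Hom(V, F^o) => f y) x0.
  exact: etrans (esym (lfunE (Bx x) y)) (etrans E (zero_lfunE _ _)).
have : limg (linfun P0) = fullv.
  apply/eqP; rewrite eqEdim subvf limg_dim_eq // !dimvf /=.
  by rewrite /dim /= muln1.
move/(congr1 (fun U : {vspace _} => phi \in U)); rewrite memvf => /memv_imgP[d _ ->].
by exists d => y; rewrite !lfunE.
Qed.

Section KillingForm.
Variables (F : fieldType) (g : lieAlgType F).
Implicit Types (x y z u v w : g) (U W D : {vspace g}).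

Definition killing x y : F := lftrace (ad x \o ad y)%VF.

Lemma killingC x y : killing x y = killing y x.
Proof. exact: lftraceC. Qed.

Lemma killing_linl a x y z : killing (a *: x + y) z = a * killing x z + killing y z.
Proof.
rewrite /killing.
have -> : ad (a *: x + y) = a *: ad x + ad y.
  by apply/lfunP => v; rewrite add_lfunE scale_lfunE !adE lieDl lieZl.
by rewrite comp_lfunDl lftraceD -comp_lfunZl lftraceZ.
Qed.

Lemma killing_linr a x y z : killing x (a *: y + z) = a * killing x y + killing x z.
Proof. by rewrite ![killing x _]killingC killing_linl. Qed.

Lemma killing_inv x y z : killing (lie x y) z = killing x (lie y z).
Proof.
rewrite /killing !ad_lie comp_lfunDl comp_lfunDr comp_lfunNl comp_lfunNr !lftraceB.
congr (_ - _); first by rewrite comp_lfunA.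
by rewrite [LHS]lftraceC comp_lfunA [LHS]lftraceC.
Qed.

Lemma killing_derivation (E : 'End(g)) x y :
  (forall u v, E (lie u v) = lie (E u) v + lie u (E v)) ->
  killing (E x) y = lftrace (E \o ad (lie x y))%VF.
Proof.
move=> dE; have adE' u : ad (E u) = ((E \o ad u) - (ad u \o E))%VF.
  apply/lfunP => v; rewrite add_lfunE opp_lfunE !comp_lfunE !adE dE.
  by rewrite addrK.
rewrite /killing adE' ad_lie comp_lfunDl comp_lfunDr comp_lfunNl comp_lfunNr !lftraceB.
congr (_ - _); first by rewrite comp_lfunA.
by rewrite -comp_lfunA [LHS]lftraceC -comp_lfunA.
Qed.

Lemma lie_prod_sub U W D :
  (forall x y, x \in U -> y \in W -> lie x y \in D) -> (lie_prod U W <= D)%VS.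
Proof.
move=> UWD; apply/span_subvP => _ /allpairsP[[x y] [/= xU yW ->]].
by rewrite UWD ?vbasis_mem.
Qed.

Lemma lie_prod_ideal U : lie_ideal U -> lie_ideal (lie_prod U U).
Proof.
move=> Ui z y yU; rewrite -adE memv_preim; apply: subvP yU; apply: lie_prod_sub.
move=> x w xU wU; rewrite -memv_preim adE lie_derivation.
by rewrite memvD // memv_lie //; apply: Ui.
Qed.

Lemma derived_series_ideal U n : lie_ideal U -> lie_ideal (derived_series U n).
Proof. by move=> Ui; elim: n => //= n; apply: lie_prod_ideal. Qed.

Lemma perfect_derived U : lie_ideal U ->
  exists n, let D := derived_series U n in lie_prod D D = D.
Proof.
move=> Ui.
have ex : exists m, `[< exists n, \dim (derived_series U n) = m >].
  by exists (\dim U); apply/asboolP; exists 0%N.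
case: (ex_minnP ex) => _ /asboolP[n <-] min; exists n => /=.
apply/eqP; rewrite eqEdim; apply/andP; split.
  by apply: lie_prod_sub => x y _; apply: derived_series_ideal.
by apply: min; apply/asboolP; exists n.+1.
Qed.

(** A stable proper subspace [W] of maximal dimension, to which [engel] applies. *)
Lemma engel_proper (L : g -> Prop) U : bracket_closed L ->
  (forall x y, L x -> L y -> exists n, iter n (lie x) y = 0) ->
  stable_under L U -> U != 0%VS ->
  (forall x u, L x -> u \in U -> exists n, iter n (lie x) u = 0) ->
  exists W, [/\ (W <= U)%VS, W != U & forall x u, L x -> u \in U -> lie x u \in W].
Proof.
move=> Lc Lnil Ust Un0 Unil.
pose good m := `[< exists W, [/\ \dim W = m, (W <= U)%VS, W != U & stable_under L W] >].
have ex : exists m, good m.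
  exists 0%N; apply/asboolP; exists 0%VS; split.
  - exact: dimv0.
  - exact: sub0v.
  - by rewrite eq_sym.
  - by move=> x u _; rewrite !memv0 => /eqP->; rewrite lie0r.
have ub m : good m -> (m <= \dim U)%N.
  by move=> /asboolP[W [<- WU _ _]]; rewrite dimvS.
case: (ex_maxnP ex ub) => m /asboolP[W [dW WU WnU Wst]] max.
exists W; split=> // x u Lx uU.
have [|v [vU vW Lv]] := engel Lc Lnil Wst Ust WU WnU _.
  by move=> y w Ly wU; have [n wn] := Unil y w Ly wU; exists n; rewrite wn mem0v.
have Wv y w : L y -> w \in (W + <[v]>)%VS -> lie y w \in W.
  move=> Ly /memv_addP[w1 w1W [_ /vlineP[c ->] ->]].
  by rewrite lieDr lieZr memvD ?memvZ ?Lv //; apply: Wst.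
have [E|ne] := eqVneq (W + <[v]>)%VS U; first by apply: Wv => //; rewrite E.
have : good (\dim (W + <[v]>)).
  apply/asboolP; exists (W + <[v]>)%VS; split=> //; first by rewrite subv_add WU -memvE.
  by move=> y w Ly wW; apply: (subvP (addvSl _ _)); apply: Wv.
move/max; rewrite -dW => le; move: vW.
have /eqP -> : (W == W + <[v]>)%VS by rewrite eqEdim addvSl.
by rewrite memvE addvSr.
Qed.

End KillingForm.

Section Strings.
Variables (F : numFieldType) (g : lieAlgType F) (h : {vspace g}).
Hypothesis hC : split_cartan_subalgebra h.
Implicit Types (x y u v w : g) (a b c : F) (U W : {vspace g}).
Local Notation weight := 'Hom(subvs_of h, F^o).
Implicit Types (r s : weight).
Local Notation ws := (@weight_space F g h).
Local Notation proj := (weight_proj hC).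
Local Notation weights := (weights hC).

Lemma lftrace_sqr (p : 'End(g)) x a W :
  (forall v, p v \in W) -> {in W, forall v, p v = v} ->
  (forall v, v \in W -> lie x v \in W) ->
  (forall v, v \in W -> geig x a v) ->
  lftrace ((ad x \o ad x) \o p)%VF = a ^+ 2 * (\dim W)%:R.
Proof.
move=> pW pid xW Wx; have [n Wn] := geig_uniform Wx.
rewrite expr2 -mulrA -(lftrace_geig pW pid xW Wx) -lftraceZ.
apply/eqP; rewrite -subr_eq0 -lftraceB; apply/eqP/(@lftrace_nilpotent _ _ _ n.+1) => v.
rewrite iterSr; set A := (X in iter n X).
have AW w : A w = lie x (shift x a (p w)).
  rewrite /A add_lfunE opp_lfunE scale_lfunE !comp_lfunE !adE.
  by rewrite /shift lieBr lieZr.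
have sW w : w \in W -> lie x (shift x a w) \in W.
  by move=> wW; rewrite xW // memvB ?memvZ ?xW.
have Av : A v \in W by rewrite AW sW.
have com w : shift x a (lie x w) = lie x (shift x a w).
  by rewrite /shift lieBr lieZr.
have com' m w : iter m (shift x a) (lie x w) = lie x (iter m (shift x a) w).
  by elim: m => //= m ->; rewrite com.
have E m w : w \in W -> iter m A w = iter m (lie x) (iter m (shift x a) w).
  elim: m w => // m IHm w wW; rewrite iterSr AW (pid w wW) IHm ?sW //.
  by rewrite com' -iterSr -iterSr.
by rewrite E // Wn // iter_lie0.
Qed.

(** By polarization from the trace of the square of one element. *)
Lemma killing_cartan (x y : subvs_of h) :
  killing (vsval x) (vsval y)
    = \sum_(r <- weights) (r x : F) * (r y : F) * (\dim (ws r))%:R.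
Proof.
have sq (z : subvs_of h) : killing (vsval z) (vsval z)
    = \sum_(r <- weights) (r z : F) ^+ 2 * (\dim (ws r))%:R.
  rewrite /killing (lftrace_weights hC); apply: eq_bigr => r _.
  apply: lftrace_sqr; first exact: weight_proj_mem.
  - by move=> v vr; rewrite (weight_proj_id hC _ vr) eqxx.
  - by move=> v; apply: (weight_space_cartan hC); exact: subvsP.
  by move=> v /weight_spaceP.
have two0 : 2 != 0 :> F by rewrite pnatr_eq0.
apply: (mulfI two0).
have := sq (x + y); rewrite linearD /= -[vsval x + vsval y](_ : 1 *: vsval x + vsval y = _); last first.
  by rewrite scale1r.
rewrite killing_linl !killing_linr !mul1r !sq (killingC (vsval y)).
rewrite -addrA addrCA addrC => /eqP.
have -> : \sum_(r <- weights) (r (x + y) : F) ^+ 2 * (\dim (ws r))%:R =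
   \sum_(r <- weights) (r x : F) ^+ 2 * (\dim (ws r))%:R
   + \sum_(r <- weights) (r y : F) ^+ 2 * (\dim (ws r))%:R
   + 2 * \sum_(r <- weights) (r x : F) * (r y : F) * (\dim (ws r))%:R.
  rewrite mulr_sumr -!big_split /=; apply: eq_bigr => r _.
  by rewrite linearD /=; ring.
move=> /eqP E; move: E; set A := \sum_(r <- _) _; set B := \sum_(r <- _) _.
set C := \sum_(r <- _) _; set K := killing _ _ => E.
apply/eqP; rewrite -subr_eq0; apply/eqP.
have : (A + B + 2 * C) - (A + B + 2 * C) = 0 by rewrite subrr.
by rewrite -{1}E => <-; ring.
Qed.

(** On a sum of weight spaces stable under both [ad u] and [ad v] the operator
   [ad c] is the commutator of their restrictions, so its trace is zero. *)
Lemma string_trace al u v (c : subvs_of h) (S : pred weight) :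
  u \in ws al -> v \in ws (- al) -> vsval c = lie u v ->
  (forall r, S r -> S (r + al) \/ ws (r + al) = 0%VS) ->
  (forall r, S r -> S (r - al) \/ ws (r - al) = 0%VS) ->
  \sum_(r <- weights | S r) (r c : F) * (\dim (ws r))%:R = 0.
Proof.
move=> ua va cE Sa Sb; pose p : 'End(g) := \sum_(r <- weights | S r) proj r.
have pE r w : S r \/ ws r = 0%VS -> w \in ws r -> p w = w.
  move=> Sr wr; rewrite sum_lfunE (eq_bigr (fun s => 1 *: proj s w)); last first.
    by move=> s _; rewrite scale1r.
  rewrite (weight_proj_combination hC S (fun _ => 1) wr) scale1r.
  case: Sr wr => [->//|->]; rewrite memv0 => /eqP->; exact: if_same.
have st x be : x \in ws be -> (forall r, S r -> S (r + be) \/ ws (r + be) = 0%VS) ->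
    (p \o (ad x \o p))%VF = (ad x \o p)%VF.
  move=> xb Sr; apply/lfunP => w; rewrite !comp_lfunE /= adE.
  rewrite {2}/p sum_lfunE [lie x _]linear_sum linear_sum /=; apply: eq_bigr => r rS.
  apply: (pE (r + be)); first exact: Sr.
  by rewrite addrC; apply: weight_space_lie => //; exact: weight_proj_mem.
have -> : \sum_(r <- weights | S r) (r c : F) * (\dim (ws r))%:R = lftrace (ad (vsval c) \o p)%VF.
  rewrite /p (big_morph (fun f : 'End(g) => (ad (vsval c) \o f)%VF)
    (fun f f' => comp_lfunDr _ f f') (comp_lfun0r _ _)) lftrace_sum.
  by apply: eq_bigr => r _; rewrite lftrace_cartan.
rewrite cE ad_lie comp_lfunDl comp_lfunNl lftraceB; apply/eqP; rewrite subr_eq0.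
rewrite -!comp_lfunA -(st v (- al)) // -[X in _ == lftrace (_ \o X)](st u al) //.
by rewrite !comp_lfunA -(comp_lfunA (ad u \o p)%VF) lftraceC !comp_lfunA.
Qed.

(** [string_trace] for the full string of weights [r + k al] through [r], [k] an
   integer, is a linear relation between [r c] and [al c] with integer coefficients,
   the one of [r c] being positive. *)
Lemma string_rational al u v (c : subvs_of h) r :
  u \in ws al -> v \in ws (- al) -> vsval c = lie u v -> r \in weights ->
  exists q : rat, r c = ratr q * (al c : F) :> F.
Proof.
move=> ua va cE rw.
pose S s := `[< exists k : int, s = r + (k%:~R : F) *: al >].
have /choice[k kP] s : exists k : int, S s -> s = r + (k%:~R : F) *: al.
  by have [/asboolP[k sk]|nS] := boolP (S s); [exists k|exists 0].
have S1 s : S s -> S (s + al) \/ ws (s + al) = 0%VS.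
  move=> /asboolP[j ->]; left; apply/asboolP; exists (j + 1).
  by rewrite intrD scalerDl scale1r addrA.
have S2 s : S s -> S (s - al) \/ ws (s - al) = 0%VS.
  move=> /asboolP[j ->]; left; apply/asboolP; exists (j - 1).
  by rewrite intrB scalerBl scale1r addrA.
have := string_trace ua va cE S1 S2.
have -> : \sum_(s <- weights | S s) (s c : F) * (\dim (ws s))%:R =
   (r c : F) * (\sum_(s <- weights | S s) \dim (ws s))%:R
   + (al c : F) * (\sum_(s <- weights | S s) k s * (\dim (ws s))%:Z)%:~R.
  rewrite natr_sum rmorph_sum !mulr_sumr -big_split /=; apply: eq_bigr => s Ss.
  rewrite {1}(kP s Ss) add_lfunE scale_lfunE rmorphM /= -[(k s)%:~R *: _]/(_ * _).
  by rewrite mulrDl; congr (_ + _); rewrite mulrCA -mulrA.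
set D := (\sum_(s <- weights | S s) \dim (ws s))%N; set K := \sum_(s <- _ | _) _.
have D0 : (0 < D)%N.
  have Sr : S r by apply/asboolP; exists 0; rewrite scale0r addr0.
  rewrite /D -big_filter (bigD1_seq r) ?filter_uniq ?weights_uniq ?mem_filter ?Sr //=.
  by rewrite addn_gt0 lt0n dimv_eq0 -(mem_weights hC) rw.
move/eqP; rewrite addr_eq0 => /eqP E; exists (- (K%:~R / D%:R)).
rewrite rmorphN rmorphM fmorphV /= ratr_int ratr_nat.
have D0' : D%:R != 0 :> F by rewrite pnatr_eq0 -lt0n.
apply: (mulIf D0'); rewrite E !mulNr; congr (- _).
by rewrite mulrAC divfK // mulrC.
Qed.

End Strings.

Section Semisimple.
Variables (F : numFieldType) (g : lieAlgType F) (h : {vspace g}).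
Hypothesis hC : split_cartan_subalgebra h.
Hypothesis gss : lie_semisimple g.
Implicit Types (x y u v w : g) (a b c : F) (U W D : {vspace g}).
Local Notation weight := 'Hom(subvs_of h, F^o).
Implicit Types (r s al be : weight).
Local Notation ws := (@weight_space F g h).
Local Notation proj := (weight_proj hC).
Local Notation weights := (weights hC).

Lemma geig_weights_nilpotent x : x \in h ->
  (forall r, r \in weights -> r (vsproj h x) = 0) ->
  forall v, exists n, iter n (lie x) v = 0.
Proof.
move=> xh x0 v; rewrite -(weight_proj_sum hC v) big_seq.
elim/big_ind: _ => [|u w [n un] [m wm]|s sw]; first by exists 0%N.
  exists (maxn n m); rewrite -(scale1r u) iter_lie_lin.
  rewrite (iter_lie_leq (leq_maxl n m) un).
  by rewrite (iter_lie_leq (leq_maxr n m) wm) scaler0 addr0.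
have /weight_spaceP/(_ (vsproj h x)) := weight_proj_mem hC s v.
by rewrite vsprojK // x0 // => -[n]; rewrite iter_shift_lie; exists n.
Qed.

(** In an ideal on which the Killing form vanishes, a bracket of opposite root
   vectors is annihilated by every weight: its Killing square is a sum of
   rational squares times the square of one weight. *)
Lemma isotropic_bracket D al u v r : lie_ideal D ->
  (forall x y, x \in D -> killing x y = 0) ->
  u \in D -> u \in ws al -> v \in ws (- al) -> r \in weights ->
  r (vsproj h (lie u v)) = 0.
Proof.
move=> Di D0 uD ua va rw.
have ch : lie u v \in h.
  by rewrite -(cartan_weight0 hC) -(subrr al); apply: weight_space_lie.
set c := vsproj h (lie u v); have cE : vsval c = lie u v by rewrite vsprojK.
have cD : lie u v \in D by rewrite lie_anti memvN Di.
have [alw|] := boolP (al \in weights); last first.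
  rewrite mem_weights negbK => /eqP al0; move: ua; rewrite al0 memv0 => /eqP u0.
  by rewrite /c u0 lie0l !linear0.
have rat s : s \in weights -> exists q : rat, s c = ratr q * (al c : F) :> F.
  by move=> sw; apply: string_rational ua va cE sw.
suff al0 : al c = 0 :> F by have [q ->] := rat r rw; rewrite al0 mulr0.
apply/eqP/negPn/negP => alc.
have := D0 _ (lie u v) cD; rewrite -{1 2}cE (killing_cartan hC) => /eqP.
rewrite (eq_big_seq (fun s => (al c : F) ^+ 2 * (((s c : F) / (al c : F)) ^+ 2 * (\dim (ws s))%:R))); last first.
  by move=> s _; rewrite mulrA -exprMn [(al c : F) * _]mulrC divfK // expr2.
rewrite -mulr_sumr mulf_eq0 expf_eq0 (negPf alc) /= big_seq psumr_eq0; last first.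
  move=> s /rat[q ->]; rewrite mulfK // mulr_ge0 ?ler0n // -rmorphXn /=.
  by rewrite ler0q sqr_ge0.
move=> /allP/(_ al alw); rewrite alw /= divff // expr1n mul1r pnatr_eq0 dimv_eq0 => /eqP al0.
by move: alw; rewrite mem_weights al0 eqxx.
Qed.

(** Cartan's criterion: if the ideal [D] is perfect and isotropic, then all
   its homogeneous elements are ad-nilpotent, and by Engel's theorem
   [lie_prod D D] is a proper subspace of [D] unless [D] is zero. *)
Lemma perfect_isotropic_eq0 D : lie_ideal D -> lie_prod D D = D ->
  (forall x y, x \in D -> killing x y = 0) -> D = 0%VS.
Proof.
move=> Di Dp D0; have DI x y : x \in D -> lie x y \in D.
  by move=> xD; rewrite lie_anti memvN Di.
have hom v : v \in D -> sumof (fun u => u \in D /\ exists r, u \in ws r) v.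
  by move=> vD; apply: weight_decomp => // x u _; apply: Di.
have projD v r : v \in D -> proj r v \in D.
  move=> /hom; elim=> [|u w [uD [s us]] _ IH]; first by rewrite linear0 mem0v.
  rewrite linearD /= memvD // (weight_proj_id hC _ us).
  by case: ifP => // _; exact: mem0v.
have Dh x r : x \in D -> x \in h -> r \in weights -> r (vsproj h x) = 0.
  move=> xD xh rw.
  have [|a v w v0 w0|T TP] := @vspace_of_pred _ g (fun v => r (vsproj h (proj 0 v)) = 0).
  - by rewrite !linear0.
  - by rewrite linearD linearZ /= linearD linearZ /= linearD linearZ /= v0 w0 scaler0 addr0.
  have : x \in T.
    move: xD; rewrite -{1}Dp; apply: subvP; apply: lie_prod_sub => v w vD wD.
    rewrite -(weight_proj_sum hC v) -(weight_proj_sum hC w) lie_suml.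
    apply: memv_suml => al _; rewrite linear_sum; apply: memv_suml => be _ /=.
    apply/TP; have vw := weight_space_lie (weight_proj_mem hC al v) (weight_proj_mem hC be w).
    rewrite (weight_proj_id hC _ vw) eq_sym; case: ifP => [|_]; last by rewrite !linear0.
    rewrite addr_eq0 => /eqP alE; apply: (isotropic_bracket (al := al) Di D0) => //.
    - exact: projD.
    - exact: weight_proj_mem.
    - by rewrite alE opprK; exact: weight_proj_mem.
  move/TP; rewrite (_ : proj 0 x = x) //.
  by rewrite (@weight_proj_id _ _ _ hC 0) ?eqxx // cartan_weight0.
pose L x := x \in D /\ exists r, x \in ws r.
have Lnil x : L x -> forall v, exists n, iter n (lie x) v = 0.
  move=> [xD [r xr]] v; have [r0|r0] := eqVneq r 0; last first.
    exact: weight_vector_nilpotent r0 xr.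
  have xh : x \in h by rewrite -(cartan_weight0 hC) -r0.
  by apply: geig_weights_nilpotent => // s; apply: Dh.
apply/eqP/negPn/negP => Dn0.
have [||||W [WD WnD LW]] := @engel_proper _ g L D _ _ _ Dn0 _.
- move=> x y [xD [r xr]] [yD [s ys]]; split; first exact: Di.
  by exists (r + s); apply: weight_space_lie.
- by move=> x y Lx _; apply: Lnil.
- by move=> x y [xD _]; apply: Di.
- by move=> x u Lx _; apply: Lnil.
case/eqP: WnD; apply/eqP; rewrite eqEsubv WD -{1}Dp /=; apply: lie_prod_sub => x y /hom.
elim=> [|u v Lu _ IH] yD; first by rewrite lie0l mem0v.
by rewrite lieDl memvD ?IH // LW.
Qed.

(** The derived series of the radical of the form stabilizes at a perfect
   isotropic ideal, which is zero by [perfect_isotropic_eq0]; so the radical is a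
   solvable ideal. *)
Theorem killing_nondegenerate x : (forall y, killing x y = 0) -> x = 0.
Proof.
have [||K KP] := @vspace_of_pred _ g (fun x => forall y, killing x y = 0).
- by move=> y; rewrite /killing ad0 comp_lfun0l lftrace0.
- by move=> a u v u0 v0 y; rewrite killing_linl u0 v0 mulr0 addr0.
have Ki : lie_ideal K.
  move=> z y /KP y0; apply/KP => w.
  by rewrite killingC -killing_inv killingC y0.
have [n /= Dp] := perfect_derived Ki.
have DK : (derived_series K n <= K)%VS.
  elim: (n) => [|m IH]; first exact: subvv.
  apply: lie_prod_sub => u v _ vD; apply: Ki; exact: (subvP IH).
have D0 := perfect_isotropic_eq0 (@derived_series_ideal _ g K n Ki) Dp
  (fun u v uD => (KP u).1 (subvP DK u uD) v).
have K0 : K = 0%VS by apply: gss => //; exists n.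
by move/KP; rewrite K0 memv0 => /eqP.
Qed.

Lemma killing_repr (phi : 'Hom(g, F^o)) : exists d, forall y, phi y = killing d y.
Proof.
apply: bilinear_repr; last exact: killing_nondegenerate.
- by move=> y a u v; exact: killing_linl.
- by move=> y a u v; exact: killing_linr.
Qed.

Lemma killing_weight_eq0 r s x y : r + s != 0 -> x \in ws r -> y \in ws s ->
  killing x y = 0.
Proof.
move=> rs xr ys; rewrite /killing (lftrace_weights hC) big1 // => t _.
have -> : ((ad x \o ad y) \o proj t = ((ad x \o ad y) \o proj t) \o proj t)%VF.
  apply/lfunP => v; rewrite !comp_lfunE.
  by rewrite (weight_proj_id hC t (weight_proj_mem hC t v)) eqxx.
rewrite lftraceC -(lftrace0 g); congr lftrace; apply/lfunP => v.
rewrite !comp_lfunE !adE zero_lfunE.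
have w := weight_space_lie xr (weight_space_lie ys (weight_proj_mem hC t v)).
rewrite (weight_proj_id hC t w); case: eqP => // /eqP.
by rewrite addrA -{1}(add0r t) (inj_eq (addIr t)) eq_sym (negPf rs).
Qed.

Lemma killing_weight0 x : x \in h -> (forall y, y \in h -> killing x y = 0) -> x = 0.
Proof.
move=> xh x0; apply: killing_nondegenerate => y.
rewrite -(weight_proj_sum hC y) big_seq.
elim/big_ind: _ => [|u v u0 v0|s _].
- by rewrite killingC /killing ad0 comp_lfun0l lftrace0.
- by rewrite -(scale1r u) killing_linr u0 v0 mulr0 addr0.
have [->|s0] := eqVneq s 0.
  by apply: x0; have := weight_proj_mem hC 0 y; rewrite (cartan_weight0 hC).
apply: (@killing_weight_eq0 0 s); rewrite ?add0r // ?weight_proj_mem //.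
exact: cartan_sub_weight0.
Qed.

Lemma cartan_weights_eq0 x : x \in h ->
  (forall r, r \in weights -> r (vsproj h x) = 0) -> x = 0.
Proof.
move=> xh x0; apply: killing_weight0 => // y yh.
rewrite -(vsprojK xh) -(vsprojK yh) (killing_cartan hC) big_seq big1 // => r rw.
by rewrite x0 // !mul0r.
Qed.

(** A commutator of elements of [h] has trace zero on every weight space. *)
Lemma cartan_abelian x y : x \in h -> y \in h -> lie x y = 0.
Proof.
move=> xh yh; apply: cartan_weights_eq0 => [|r rw]; first exact: (cartan_lie hC).
have x0 := cartan_sub_weight0 hC xh; have y0 := cartan_sub_weight0 hC yh.
have y0' : y \in ws (- 0) by rewrite oppr0.
have cE : vsval (vsproj h (lie x y)) = lie x y by rewrite vsprojK // (cartan_lie hC).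
have := @string_trace _ g h hC 0 x y _ (pred1 r) x0 y0' cE.
rewrite -big_filter filter_pred1_uniq ?weights_uniq // big_seq1.
have S1 s : pred1 r s -> pred1 r (s + 0) \/ ws (s + 0) = 0%VS.
  by move=> /eqP->; left; rewrite addr0 /= eqxx.
have S2 s : pred1 r s -> pred1 r (s - 0) \/ ws (s - 0) = 0%VS.
  by move=> /eqP->; left; rewrite subr0 /= eqxx.
move=> /(_ S1 S2)/eqP; rewrite mulf_eq0 pnatr_eq0 dimv_eq0 => /orP[/eqP//|r0].
by move: rw; rewrite mem_weights r0.
Qed.

(** Let [d] represent the functional [y -> tr (E \o ad y)] for the Killing form;
   then [E x - lie d x] is orthogonal to everything. *)
Lemma derivation_inner (E : 'End(g)) :
  (forall u v, E (lie u v) = lie (E u) v + lie u (E v)) -> exists d, E = ad d.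
Proof.
move=> dE.
have lin : linear (fun y : g => lftrace (E \o ad y)%VF : F^o).
  by move=> a y z; rewrite ad_lin comp_lfunDr lftraceD -comp_lfunZr lftraceZ.
pose P : {linear g -> F^o} := HB.pack (fun y : g => lftrace (E \o ad y)%VF : F^o)
  (GRing.isLinear.Build F _ _ _ _ lin).
have [d dP] := killing_repr (linfun P).
exists d; apply/lfunP => x; apply/eqP; rewrite adE -subr_eq0; apply/eqP.
apply: killing_nondegenerate => y.
rewrite addrC -scaleN1r killing_linl killing_inv -dP lfunE /= killing_derivation //.
by rewrite mulN1r addNr.
Qed.

(** The semisimple part of [ad x] is a derivation, hence inner; so is the
   nilpotent part, which is then the adjoint of an element of [h] with all
   weights zero. *)
Lemma weight_space_eigen r (t : subvs_of h) v : v \in ws r ->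
  lie (vsval t) v = (r t : F) *: v.
Proof.
have th := subvsP t.
pose S : 'End(g) := \sum_(s <- weights) (s t : F) *: proj s.
have SE s w : w \in ws s -> S w = (s t : F) *: w.
  move=> wsw; rewrite sum_lfunE (eq_bigr (fun p : weight => (p t : F) *: proj p w)); last first.
    by move=> p _; rewrite scale_lfunE.
  exact: (weight_proj_combination hC predT (fun p : weight => p t) wsw).
have Sd u w : S (lie u w) = lie (S u) w + lie u (S w).
  have hom p q u' w' : u' \in ws p -> w' \in ws q ->
      S (lie u' w') = lie (S u') w' + lie u' (S w').
    move=> pu qw; rewrite (SE _ _ (weight_space_lie pu qw)) (SE _ _ pu) (SE _ _ qw).
    by rewrite lieZl lieZr add_lfunE scalerDl.
  elim/(weight_ind hC): u => [|u1 u2 I1 I2|p u up].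
  - by rewrite lie0l linear0 !lie0l addr0.
  - by rewrite lieDl linearD /= I1 I2 linearD /= !lieDl addrACA.
  elim/(weight_ind hC): w => [|w1 w2 I1 I2|q w wq]; last exact: hom up wq.
  - by rewrite !linear0 addr0.
  - by rewrite lieDr !linearD /= I1 I2 addrACA.
have [|d dE] := @derivation_inner (ad (vsval t) - S) _.
  move=> u w; rewrite !add_lfunE !opp_lfunE !adE Sd lie_derivation.
  by rewrite lieBl lieBr opprD addrACA.
have dh : d \in h.
  case: hC => -[_ _ hn] _; apply: hn => y yh; rewrite -adE -dE add_lfunE opp_lfunE adE.
  rewrite (SE 0) ?zero_lfunE ?scale0r ?subr0 ?cartan_lie //.
  exact: cartan_sub_weight0.
have d0 : d = 0.
  apply: cartan_weights_eq0 => // s sw.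
  have : lftrace (ad (vsval (vsproj h d)) \o proj s)%VF = 0.
    rewrite vsprojK // -dE comp_lfunDl comp_lfunNl lftraceB lftrace_cartan.
    have -> : (S \o proj s)%VF = (s t : F) *: proj s.
      by apply/lfunP => w; rewrite comp_lfunE (SE s) ?weight_proj_mem // scale_lfunE.
    rewrite lftraceZ (@lftrace_proj _ _ _ (ws s)) ?subrr //.
      by move=> w; exact: weight_proj_mem.
    by move=> w ww; rewrite (weight_proj_id hC _ ww) eqxx.
  move/eqP; rewrite lftrace_cartan mulf_eq0 pnatr_eq0 dimv_eq0 => /orP[/eqP//|s0].
  by move: sw; rewrite mem_weights s0.
move=> vr; have := congr1 (fun f : 'End(g) => f v) dE.
rewrite d0 ad0 zero_lfunE add_lfunE opp_lfunE adE (SE r) // => /eqP.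
by rewrite subr_eq0 => /eqP.
Qed.

Lemma weight_spaceE r : ws r = root_space r.
Proof.
apply/vspaceP => v; apply/idP/root_spaceP => [vr t|vr].
  exact: weight_space_eigen.
apply/weight_spaceP => t; exists 1%N.
by rewrite /= /shift vr subrr.
Qed.

End Semisimple.

(** * Roots *)

Section Roots.
Variables (F : numFieldType) (g : lieAlgType F) (h : {vspace g}).
Hypothesis hC : split_cartan_subalgebra h.
Hypothesis gss : lie_semisimple g.
Implicit Types (x y u v w : g) (a b c : F) (U W D : {vspace g}).
Local Notation weight := 'Hom(subvs_of h, F^o).
Implicit Types (r s al be : weight).
Local Notation ws := (@weight_space F g h).
Local Notation proj := (weight_proj hC).
Local Notation weights := (weights hC).

Lemma killing0r x : killing x 0 = 0.
Proof. by rewrite /killing ad0 comp_lfun0r lftrace0. Qed.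

Lemma killingZr a x y : killing x (a *: y) = a * killing x y.
Proof. by rewrite -(addr0 (_ *: _)) killing_linr killing0r addr0. Qed.

Lemma killing_sumr I (q : seq I) (Q : pred I) (f : I -> g) x :
  killing x (\sum_(i <- q | Q i) f i) = \sum_(i <- q | Q i) killing x (f i).
Proof.
apply: (big_morph (killing x) _ (killing0r x)) => u v.
by rewrite -(scale1r u) killing_linr mul1r scale1r.
Qed.

Lemma killing_proj x y r : x \in ws r -> killing x y = killing x (proj (- r) y).
Proof.
move=> xr; rewrite -{1}(weight_proj_sum hC y) killing_sumr.
have [rw|] := boolP (- r \in weights).
  rewrite (bigD1_seq (- r)) ?weights_uniq //= big1 ?addr0 // => s sr.
  apply: (killing_weight_eq0 hC _ xr (weight_proj_mem hC s y)).
  by rewrite addrC addr_eq0.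
move=> rw; rewrite big_seq big1 => [|s sw].
  move: rw; rewrite mem_weights negbK => /eqP r0.
  have := weight_proj_mem hC (- r) y; rewrite r0 memv0 => /eqP->.
  by rewrite killing0r.
apply: (killing_weight_eq0 hC _ xr (weight_proj_mem hC s y)).
by rewrite addrC addr_eq0; apply: contraNneq rw => <-.
Qed.

Lemma weight_dual_exists r : exists t : subvs_of h,
  forall x : subvs_of h, killing (vsval t) (vsval x) = r x.
Proof.
have lin : linear (fun y : g => r (vsproj h (proj 0 y)) : F^o).
  by move=> a u v; rewrite !linearP.
pose P : {linear g -> F^o} := HB.pack (fun y : g => r (vsproj h (proj 0 y)) : F^o)
  (GRing.isLinear.Build F _ _ _ _ lin).
have [d dP] := killing_repr hC gss (linfun P).
exists (vsproj h (proj 0 d)) => x.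
have xw : vsval x \in ws 0 by apply: cartan_sub_weight0 => //; exact: subvsP.
rewrite vsprojK; last by have := weight_proj_mem hC 0 d; rewrite (cartan_weight0 hC).
rewrite killingC; have := killing_proj d xw; rewrite oppr0 => <-.
rewrite killingC -dP lfunE /=.
by rewrite (weight_proj_id hC 0 xw) eqxx vsvalK.
Qed.

Definition weight_dual r : subvs_of h := sval (cid (weight_dual_exists r)).

Lemma weight_dualP r (x : subvs_of h) : killing (vsval (weight_dual r)) (vsval x) = r x.
Proof. exact: (svalP (cid (weight_dual_exists r))). Qed.

(** The form transported from [h] to the weights by duality. *)
Definition ip r s : F := r (weight_dual s).

Lemma ipC r s : ip r s = ip s r.
Proof. by rewrite /ip -weight_dualP killingC weight_dualP. Qed.

Lemma ipDl r s al : ip (r + s) al = ip r al + ip s al.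
Proof. by rewrite /ip add_lfunE. Qed.

Lemma ipZl a r al : ip (a *: r) al = a * ip r al.
Proof. by rewrite /ip scale_lfunE. Qed.

Lemma ip0l al : ip 0 al = 0.
Proof. by rewrite /ip zero_lfunE. Qed.

Lemma ipNl r al : ip (- r) al = - ip r al.
Proof. by rewrite /ip opp_lfunE. Qed.

Lemma ip_suml I (q : seq I) (Q : pred I) (f : I -> weight) al :
  ip (\sum_(i <- q | Q i) f i) al = \sum_(i <- q | Q i) ip (f i) al.
Proof. by apply: (big_morph (ip^~ al) _ (ip0l al)) => r s; exact: ipDl. Qed.

Lemma ipE r s : ip r s = \sum_(p <- weights) ip p r * ip p s * (\dim (ws p))%:R.
Proof. by rewrite {1}/ip -weight_dualP (killing_cartan hC). Qed.

Lemma weight_dual_eq0 r : (forall p, p \in weights -> ip p r = 0) -> r = 0.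
Proof.
move=> r0; have t0 : vsval (weight_dual r) = 0.
  apply: (@cartan_weights_eq0 _ _ _ hC gss (vsval (weight_dual r))); first exact: subvsP.
  by move=> p pw; rewrite vsvalK; exact: r0.
apply/lfunP => x; rewrite -weight_dualP t0 zero_lfunE killingC.
exact: killing0r.
Qed.

Lemma lie_root_pair al u v : u \in ws al -> v \in ws (- al) ->
  lie u v = killing u v *: vsval (weight_dual al).
Proof.
move=> ua va; have uvh : lie u v \in h.
  by rewrite -(cartan_weight0 hC) -(subrr al); apply: weight_space_lie.
apply/eqP; rewrite -subr_eq0; apply/eqP; apply: (killing_weight0 hC gss).
  by rewrite memvB ?memvZ // subvsP.
move=> x xh; rewrite addrC -scaleNr killing_linl killing_inv.
have -> : lie v x = (al (vsproj h x) : F) *: v.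
  rewrite lie_anti -{1}(vsprojK xh) (weight_space_eigen hC gss _ va).
  by rewrite opp_lfunE scaleNr opprK.
by rewrite killingZr -{1}(vsprojK xh) weight_dualP mulNr mulrC addNr.
Qed.

Lemma root_pair_exists al : al \in weights ->
  exists u v, [/\ u \in ws al, v \in ws (- al) & lie u v = vsval (weight_dual al)].
Proof.
rewrite mem_weights => a0; pose u := vpick (ws al).
have u0 : u != 0 by rewrite /u vpick0.
have ua : u \in ws al := memv_pick _.
have [y uy] : exists y, killing u y != 0.
  apply: contrapT => /forallNP nu; case/eqP: u0.
  apply: (killing_nondegenerate hC gss) => y.
  by apply/eqP/negPn/negP/nu.
have va := weight_proj_mem hC (- al) y.
exists u, ((killing u y)^-1 *: proj (- al) y); split=> //; first exact: memvZ.
by rewrite lieZr (lie_root_pair ua va) -killing_proj // scalerA mulVf // scale1r.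
Qed.

Lemma weights_opp al : al \in weights -> - al \in weights.
Proof.
have [->|a0] := eqVneq al 0; first by rewrite oppr0.
move=> aw; have [u [v [ua va uv]]] := root_pair_exists aw.
rewrite mem_weights; apply: contra a0 => /eqP na0.
move: va; rewrite na0 memv0 => /eqP v0; apply/eqP/weight_dual_eq0 => p _.
rewrite /ip; have : vsval (weight_dual al) = 0 by rewrite -uv v0 lie0r.
move=> E; have -> : weight_dual al = 0 by apply: val_inj.
by rewrite linear0.
Qed.

(** [ip al al] equals its own square times a nonnegative rational number, because
   all [ip s al] are rational multiples of [ip al al] by [string_rational]. *)
Lemma ip_rational_self al : al \in weights -> al != 0 ->
  exists2 q : rat, 0 < q & ip al al = ratr q.
Proof.
move=> aw a0; have [u [v [ua va uv]]] := root_pair_exists aw.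
have /choice[q qP] s : exists q : rat, s \in weights -> ip s al = ratr q * ip al al.
  have [sw|] := boolP (s \in weights); last by exists 0.
  by have [q] := string_rational ua va (esym uv) sw; exists q.
pose S : rat := \sum_(p <- weights) q p ^+ 2 * (\dim (ws p))%:R.
have E : ip al al = ip al al ^+ 2 * ratr S.
  rewrite {1}ipE /S rmorph_sum mulr_sumr big_seq [RHS]big_seq /=; apply: eq_bigr => p pw.
  by rewrite (qP p pw) rmorphM rmorphXn /= ratr_nat; ring.
have c0 : ip al al != 0.
  apply: contra a0 => /eqP c0; apply/eqP/weight_dual_eq0 => p pw.
  by rewrite qP // c0 mulr0.
have S1 : ip al al * ratr S = 1.
  by apply: (mulfI c0); rewrite mulr1 {3}E expr2 mulrA.
have S0 : S != 0.
  by apply: contra_eq_neq S1 => ->; rewrite rmorph0 mulr0 eq_sym oner_eq0.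
exists S^-1; last by rewrite fmorphV /= -[RHS]mul1r -S1 mulfK // fmorph_eq0.
rewrite invr_gt0 lt0r S0 /=; apply: sumr_ge0 => p _.
by rewrite mulr_ge0 ?sqr_ge0 ?ler0n.
Qed.

Lemma ip_rational r al : r \in weights -> al \in weights ->
  exists q : rat, ip r al = ratr q.
Proof.
move=> rw aw; have [->|a0] := eqVneq al 0.
  by exists 0; rewrite ipC ip0l rmorph0.
have [u [v [ua va uv]]] := root_pair_exists aw.
have [q qE] := string_rational ua va (esym uv) rw.
have [q' _ q'E] := ip_rational_self aw a0.
by exists (q * q'); rewrite rmorphM /= -q'E.
Qed.

(** Otherwise the weights [be - k al], with [k] a natural number, form a set
   stable under both root vectors, and its trace is negative instead of zero. *)
Lemma ip_neg_root al be : al \in weights -> al != 0 -> be \in weights ->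
  ip be al < 0 -> al + be \in weights.
Proof.
move=> aw a0 bw neg; apply: contraLR neg => abw.
have [u [v [ua va uv]]] := root_pair_exists aw.
have [qa qa0 qaE] := ip_rational_self aw a0.
have [qb qbE] := ip_rational bw aw.
rewrite qbE ltrq0; apply/negP => qb0.
pose S s := `[< exists k : nat, s = be - (k%:R : F) *: al >].
have /choice[k kP] s : exists k : nat, S s -> s = be - (k%:R : F) *: al.
  by have [/asboolP[k sk]|nS] := boolP (S s); [exists k|exists 0%N].
have S1 s : S s -> S (s + al) \/ ws (s + al) = 0%VS.
  move=> /asboolP[[|j] ->].
    right; rewrite scale0r subr0 addrC; apply/eqP; apply: contraR abw.
    by rewrite mem_weights.
  left; apply/asboolP; exists j.
  by rewrite -addn1 natrD scalerDl scale1r opprD addrA subrK.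
have S2 s : S s -> S (s - al) \/ ws (s - al) = 0%VS.
  move=> /asboolP[j ->]; left; apply/asboolP; exists j.+1.
  by rewrite -addn1 natrD scalerDl scale1r opprD addrA.
have := string_trace hC ua va (esym uv) S1 S2.
rewrite (eq_bigr (fun s => - ratr ((- qb + (k s)%:R * qa) * (\dim (ws s))%:R))); last first.
  move=> s Ss; have -> : (s (weight_dual al) : F) = ip s al by [].
  rewrite {1}(kP s Ss) ipDl ipNl ipZl qbE qaE -rmorphN /=.
  have -> : ((\dim (ws s))%:R : F) = ratr (\dim (ws s))%:R by rewrite ratr_nat.
  have -> : ((k s)%:R : F) = ratr (k s)%:R by rewrite ratr_nat.
  by rewrite -rmorphM -rmorphB -rmorphM /=; congr ratr; ring.
rewrite sumrN => /eqP; rewrite oppr_eq0 psumr_eq0 => [|s Ss]; last first.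
  by rewrite ler0q mulr_ge0 ?ler0n // addr_ge0 ?oppr_ge0 ?mulr_ge0 ?ler0n // ltW.
move=> /allP/(_ be bw)/implyP.
have Sb : S be by apply/asboolP; exists 0%N; rewrite scale0r subr0.
move=> /(_ Sb); rewrite fmorph_eq0 mulf_eq0 pnatr_eq0 dimv_eq0 => /orP[|b0]; last first.
  by move: bw; rewrite mem_weights b0.
rewrite paddr_eq0 ?oppr_ge0 ?mulr_ge0 ?ler0n ?(ltW qa0) ?(ltW qb0) //.
by rewrite oppr_eq0 => /andP[/eqP qb00]; move: qb0; rewrite qb00 ltxx.
Qed.

Section PositiveSystem.
Variable P : seq weight.
Hypothesis Ppos : positive_system P.

Lemma is_rootE al : is_root al = (al != 0) && (al \in weights).
Proof. by rewrite /is_root mem_weights (weight_spaceE hC gss). Qed.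

Lemma positive_weight al : al \in P -> al \in weights.
Proof. by move/(positive_is_root Ppos); rewrite is_rootE => /andP[]. Qed.

Lemma positive_neq0 al : al \in P -> al != 0.
Proof. by move/(positive_is_root Ppos)/andP=> []. Qed.

Lemma positive_opp al : al \in P -> - al \notin P.
Proof.
move=> aP; have := positive_or_negative Ppos (positive_is_root Ppos aP).
by rewrite aP /=.
Qed.

(** Otherwise a vanishing sum of positive roots could be shortened by merging
   two of them with negative inner product. *)
Lemma positive_sum_neq0 (q : seq weight) :
  {subset q <= P} -> q != [::] -> \sum_(al <- q) al != 0.
Proof.
have [n] := ubnP (size q); elim: n q => // n IHn [//|al q] + qP _.
rewrite ltnS => qn; rewrite big_cons; apply/negP => /eqP s0.
have aP : al \in P by apply: qP; rewrite mem_head.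
have a0 := positive_neq0 aP; have aw := positive_weight aP.
have [qa qa0 qaE] := ip_rational_self aw a0.
have qP' be : be \in q -> be \in P by move=> bq; apply: qP; rewrite inE bq orbT.
have [|nb] := boolP (has (fun be => ip be al < 0) q).
  move=> /hasP[be bq neg]; have bP := qP' be bq.
  have abw := ip_neg_root aw a0 (positive_weight bP) neg.
  have ab0 : al + be != 0.
    rewrite addrC addr_eq0; apply: contraTneq bP => ->; exact: positive_opp.
  have abP : al + be \in P by apply: (positive_add Ppos) => //; rewrite is_rootE ab0.
  have /negP[] : \sum_(r <- (al + be) :: rem be q) r != 0.
    apply: IHn => //=.
      by rewrite size_rem // prednK //; case: (q) bq.
    by move=> r; rewrite inE => /predU1P[->//|/mem_rem/qP'].
  by move: s0; rewrite (big_rem _ bq) /= addrA big_cons => ->.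
have := ip0l al; rewrite -s0 ipDl ip_suml qaE => /eqP.
apply/negP; rewrite gt_eqF // ltr_pwDl ?ltr0q // big_seq sumr_ge0 // => be bq.
move: nb => /hasPn/(_ be bq).
have [qb ->] := ip_rational (positive_weight (qP' be bq)) aw.
by rewrite ltrq0 ler0q -leNgt.
Qed.

(** The positive roots that are not a sum of two positive roots. *)
Definition simple_roots : seq weight :=
  [seq al <- undup P | ~~ has (fun be => al - be \in P) P].

Lemma simple_positive al : al \in simple_roots -> al \in P.
Proof. by rewrite mem_filter mem_undup => /andP[]. Qed.

(** By induction on the number of positive roots obtained from [al] by subtracting
   a nonempty sum of positive roots. *)
Lemma positive_sum_simple al : al \in P -> exists q : seq weight,
  [/\ q != [::], {subset q <= simple_roots} & al = \sum_(be <- q) be].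
Proof.
pose below be ga := `[< exists q : seq weight,
  [/\ q != [::], {subset q <= P} & be = ga + \sum_(de <- q) de] >].
have [n] := ubnP (count (below al) (undup P)).
elim: n al => // n IHn al; rewrite ltnS => aln aP.
have [/hasP[be bP abP]|simple] := boolP (has (fun be => al - be \in P) P); last first.
  exists [:: al]; split=> //; last by rewrite big_seq1.
  by move=> r; rewrite inE => /eqP->; rewrite mem_filter simple mem_undup.
have step (b c : weight) : b \in P -> c \in P -> al = b + c ->
    (count (below b) (undup P) < count (below al) (undup P))%N.
  move=> bP' cP alE; rewrite -!size_filter.
  apply: (@uniq_leq_size _ (b :: [seq x <- undup P | below b x])) => /=.
    rewrite filter_uniq ?undup_uniq // andbT mem_filter negb_and; apply/orP; left.
    apply/negP => /asboolP[q [q0 qP /eqP]].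
    by rewrite -{1}(addr0 b) (inj_eq (addrI b)) eq_sym (negPf (positive_sum_neq0 qP q0)).
  move=> x; rewrite inE mem_filter => /predU1P[->|/andP[/asboolP[q [q0 qP bE]] xP]].
    rewrite mem_filter mem_undup bP' andbT; apply/asboolP; exists [:: c]; split=> //.
      by move=> r; rewrite inE => /eqP->.
    by rewrite big_seq1.
  rewrite mem_filter xP andbT; apply/asboolP; exists (c :: q); split=> //.
    by move=> r; rewrite inE => /predU1P[->|/qP].
  by rewrite big_cons alE bE addrAC addrA.
have alE : al = be + (al - be) by rewrite addrC subrK.
have [q1 [q10 q1S q1E]] := IHn be (leq_trans (step _ _ bP abP alE) aln) bP.
have alE' : al = (al - be) + be by rewrite subrK.
have [q2 [q20 q2S q2E]] := IHn _ (leq_trans (step _ _ abP bP alE') aln) abP.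
exists (q1 ++ q2); split; first by case: (q1) q10.
  by move=> r; rewrite mem_cat => /orP[/q1S|/q2S].
by rewrite big_cat /= -q1E -q2E.
Qed.

Lemma simple_diff al be : al \in simple_roots -> be \in simple_roots -> al != be ->
  al - be \notin weights.
Proof.
move=> aS bS ab; have aP := simple_positive aS; have bP := simple_positive bS.
apply/negP => w; have : is_root (al - be) by rewrite is_rootE subr_eq0 ab.
move=> /(positive_or_negative Ppos).
have nS (x y : weight) : x \in simple_roots -> y \in P -> x - y \notin P.
  by rewrite mem_filter => /andP[/hasPn nx _] yP; exact: nx.
by rewrite opprB (negPf (nS _ _ aS bP)) (negPf (nS _ _ bS aP)).
Qed.

Lemma simple_obtuse al be : al \in simple_roots -> be \in simple_roots -> al != be ->
  ip al be <= 0.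
Proof.
move=> aS bS ab; have aw := positive_weight (simple_positive aS).
have bw := positive_weight (simple_positive bS).
have [q qE] := ip_rational aw bw; rewrite qE lerq0 leNgt; apply/negP => q0.
have /negP[] := simple_diff aS bS ab; rewrite addrC.
have := @ip_neg_root (- be) al (weights_opp bw) _ aw.
apply; first by rewrite oppr_eq0 positive_neq0 // simple_positive.
by rewrite ipC ipNl ipC qE oppr_lt0 ltr0q.
Qed.

End PositiveSystem.

End Roots.

(** * The Gram matrix of the simple roots *)

Lemma common_denominator k (x : 'I_k -> rat) : (forall i, 0 <= x i) ->
  exists M (n : 'I_k -> nat), (0 < M)%N /\ forall i, x i * M%:R = (n i)%:R.
Proof.
move=> x0; pose den (i : 'I_k) := `|denq (x i)|%N.
exists (\prod_i den i)%N, (fun i => (`|numq (x i)| * \prod_(j | j != i) den j)%N).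
split; first by rewrite prodn_gt0 // => i; rewrite absz_gt0 denq_neq0.
move=> i; rewrite (bigD1 i) //= !natrM mulrA; congr (_ * _).
have -> : (den i)%:R = (denq (x i))%:~R :> rat.
  by rewrite -{1}(gez0_abs (denq_ge0 (x i))).
rewrite -[X in X * _](divq_num_den (x i)) divfK ?intr_eq0 ?denq_neq0 //.
by rewrite -{1}(@gez0_abs (numq (x i))) // numq_ge0.
Qed.

Section PrincipalElement.
Variables (F : numFieldType) (g : lieAlgType F) (h : {vspace g}).
Hypothesis hC : split_cartan_subalgebra h.
Hypothesis gss : lie_semisimple g.
Local Notation weight := 'Hom(subvs_of h, F^o).
Variable P : seq weight.
Hypothesis Ppos : positive_system P.
Implicit Types (x y u v w : g) (a b c : F) (U W D : {vspace g}).
Implicit Types (r s al be : weight).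
Local Notation ws := (@weight_space F g h).
Local Notation weights := (weights hC).
Local Notation ip := (ip hC gss).
Local Notation k := (size (simple_roots P)).
Local Notation d i := ((simple_roots P)`_i).

Lemma simple_mem (i : 'I_k) : d i \in simple_roots P.
Proof. exact: mem_nth. Qed.

Lemma simple_weight (i : 'I_k) : d i \in weights.
Proof. exact/(positive_weight hC gss Ppos)/simple_positive/simple_mem. Qed.

Lemma simple_inj (i j : 'I_k) : (d i == d j) = (i == j).
Proof. by rewrite nth_uniq // filter_uniq // undup_uniq. Qed.

(** After clearing denominators, the relation is a vanishing sum of positive
   roots. *)
Lemma simple_nonneg_relation (x : 'I_k -> rat) : (forall i, 0 <= x i) ->
  \sum_i (ratr (x i) : F) *: d i = 0 -> forall i, x i = 0.
Proof.
move=> x0 s0; have [M [n [M0 nE]]] := common_denominator x0.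
pose q := flatten [seq nseq (n i) (d i) | i <- enum 'I_k].
have q0 : \sum_(al <- q) al = (M%:R : F) *: \sum_i (ratr (x i) : F) *: d i.
  rewrite /q big_flatten /= big_map scaler_sumr big_enum /=; apply: eq_bigr => i _.
  rewrite big_nseq iter_addr_0 scalerA -[LHS]scaler_nat; congr (_ *: _).
  have -> : (n i)%:R = ratr (n i)%:R :> F by rewrite ratr_nat.
  by rewrite -nE rmorphM /= ratr_nat mulrC.
have qnil : q = [::].
  apply/eqP; apply: contraTT isT => qn; have : \sum_(al <- q) al != 0.
    apply: (positive_sum_neq0 hC gss Ppos) => // al /flattenP[_ /mapP[i _ ->]].
    by rewrite mem_nseq => /andP[_ /eqP->]; exact/simple_positive/simple_mem.
  by rewrite q0 s0 scaler0 eqxx.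
move=> i; have : n i = 0%N.
  apply/eqP; rewrite -leqn0 leqNgt; apply/negP => ni.
  have : d i \in q.
    apply/flattenP; exists (nseq (n i) (d i)); last by rewrite mem_nseq ni eqxx.
    by apply/mapP; exists i => //; rewrite mem_enum.
  by rewrite qnil.
move=> n0; have /eqP := nE i; rewrite n0 mulf_eq0 pnatr_eq0.
by rewrite (gtn_eqF M0) orbF => /eqP.
Qed.

Lemma ipZr r s a : ip r (a *: s) = a * ip r s.
Proof. by rewrite ipC ipZl ipC. Qed.

Lemma ip_sumr I (q : seq I) (Q : pred I) (f : I -> weight) al :
  ip al (\sum_(i <- q | Q i) f i) = \sum_(i <- q | Q i) ip al (f i).
Proof. by rewrite ipC ip_suml; apply: eq_bigr => i _; rewrite ipC. Qed.

(** The form is positive definite on rational combinations of roots. *)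
Lemma ip_definite (x : 'I_k -> rat) (w := \sum_i (ratr (x i) : F) *: d i) :
  ip w w <= 0 -> w = 0.
Proof.
have rat r : r \in weights -> exists q : rat, ip r w = ratr q.
  move=> rw; rewrite /w ip_sumr.
  have /choice[q qE] (i : 'I_k) : exists q : rat, ip r (d i) = ratr q.
    by apply: ip_rational => //; exact: simple_weight.
  exists (\sum_i x i * q i); rewrite rmorph_sum; apply: eq_bigr => i _.
  by rewrite ipZr qE rmorphM.
have pos r : r \in weights -> 0 <= ip r w * ip r w * (\dim (ws r))%:R.
  by move=> /rat[q ->]; rewrite -expr2 -rmorphXn /= mulr_ge0 ?ler0n // ler0q sqr_ge0.
move=> w0; have : \sum_(r <- weights) ip r w * ip r w * (\dim (ws r))%:R == 0.
  rewrite eq_le -ipE w0 ipE big_seq; apply: sumr_ge0; exact: pos.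
rewrite big_seq psumr_eq0; last exact: pos.
move=> /allP all0; apply: (weight_dual_eq0 (hC := hC) (gss := gss)) => r rw.
have := all0 r rw; rewrite rw /= !mulf_eq0 pnatr_eq0 dimv_eq0 orbb => /orP[/eqP//|r0].
by move: rw; rewrite mem_weights r0.
Qed.

Variable G : 'M[rat]_k.
Hypothesis GE : forall i j, ratr (G i j) = ip (d i) (d j).

Lemma gram_obtuse i j : i != j -> G i j <= 0.
Proof.
move=> ij; rewrite -(lerq0 F) GE; apply: (simple_obtuse _ _ Ppos); try exact: simple_mem.
by rewrite simple_inj.
Qed.

(** If a rational combination of simple roots vanishes, then its positive and
   its negative part are equal vectors with nonpositive inner product. *)
Lemma gram_kernel_le0 (c : 'I_k -> rat) :
  (forall j, \sum_i c i * G i j = 0) -> forall i, c i <= 0.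
Proof.
move=> c0; pose x i := Num.max (c i) 0; pose y i := Num.max (- c i) 0.
have x0 i : 0 <= x i by rewrite le_max lexx orbT.
have y0 i : 0 <= y i by rewrite le_max lexx orbT.
have cE i : c i = x i - y i.
  rewrite /x /y; case: (leP (c i) 0) => ci.
    by rewrite max_l ?oppr_ge0 // sub0r opprK.
  by rewrite max_r ?subr0 // oppr_le0 ltW.
have xy i : x i * y i = 0.
  rewrite /x /y; case: (leP (c i) 0) => ci; first by rewrite mul0r.
  by rewrite max_r ?mulr0 // oppr_le0 ltW.
have xyG j : \sum_i x i * G i j = \sum_i y i * G i j.
  apply/eqP; rewrite -subr_eq0 -sumrB; apply/eqP; rewrite -[RHS](c0 j); apply: eq_bigr => i _.
  by rewrite -mulrBl -cE.
suff x00 i : x i = 0 by move=> i; rewrite cE x00 sub0r oppr_le0.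
apply: simple_nonneg_relation => //; apply: ip_definite.
have -> : ip (\sum_i (ratr (x i) : F) *: d i) (\sum_i (ratr (x i) : F) *: d i)
    = ratr (\sum_j x j * \sum_i x i * G i j).
  rewrite ip_sumr rmorph_sum; apply: eq_bigr => j _ /=.
  rewrite ipZr rmorphM /= ip_suml rmorph_sum; congr (_ * _); apply: eq_bigr => i' _.
  by rewrite ipZl rmorphM /= GE.
rewrite lerq0; apply: sumr_le0 => j _; rewrite xyG mulr_sumr; apply: sumr_le0 => i' _.
have [->|ij] := eqVneq i' j; first by rewrite mulrA xy mul0r.
by rewrite mulr_ge0_le0 // mulr_ge0_le0 // gram_obtuse.
Qed.

Lemma gram_unit : G \in unitmx.
Proof.
rewrite -row_free_unit -kermx_eq0; apply/rowV0P => c /sub_kermxP cG.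
have c0 j : \sum_i c 0 i * G i j = 0.
  by have := congr1 (fun M : 'rV_k => M 0 j) cG; rewrite !mxE.
have le0 := gram_kernel_le0 c0.
have ge0 i : - c 0 i <= 0.
  apply: (gram_kernel_le0 (c := fun i => - c 0 i)) => j.
  transitivity (- \sum_i c 0 i * G i j); last by rewrite c0 oppr0.
  by rewrite -sumrN; apply: eq_bigr => i' _; rewrite mulNr.
apply/rowP => i; rewrite mxE; apply/eqP; rewrite eq_le le0 /=.
by rewrite -oppr_le0 ge0.
Qed.

End PrincipalElement.

(** * The principal grading *)

(** Everything that the study of the pencil uses of the root structure: a
   principal sl2-triple, the projections [pr k] onto the eigenspaces of [ad H]
   for the eigenvalues [2 * k], zero for [`|k| > m], and an invariant form. These
   data extend to the complexification componentwise, which settles the real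
   case. *)
Record principal_grading (F : numFieldType) (g : lieAlgType F)
    (B : g -> g -> F) (H e f : g) (m : nat) (pr : int -> 'End(g)) : Prop := {
  grading_form_linear : forall a x y z, B (a *: x + y) z = a * B x z + B y z;
  grading_form_sym : forall x y, B x y = B y x;
  grading_form_inv : forall x y z, B (lie x y) z = B x (lie y z);
  grading_form_nondegenerate : forall x, (forall y, B x y = 0) -> x = 0;
  grading_He : lie H e = 2%:R *: e;
  grading_Hf : lie H f = - 2%:R *: f;
  grading_ef : lie e f = H;
  grading_eigen : forall k v, lie H (pr k v) = (2 * k)%:~R *: pr k v;
  grading_comm : forall k v, pr k (lie H v) = lie H (pr k v);
  grading_sum : forall v, \sum_(i < m.*2.+1) pr (i%:Z - m%:Z) v = v;
  grading0_abelian : forall u v, lie (pr 0 u) (pr 0 v) = 0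
}.

Section PrincipalGrading.
Variables (F : numFieldType) (g : lieAlgType F) (h : {vspace g}).
Hypothesis hC : split_cartan_subalgebra h.
Hypothesis gss : lie_semisimple g.
Local Notation weight := 'Hom(subvs_of h, F^o).
Variable P : seq weight.
Hypothesis Ppos : positive_system P.
Implicit Types (x y u v w : g) (a b c : F) (U W D : {vspace g}).
Implicit Types (r s al be : weight).
Local Notation ws := (@weight_space F g h).
Local Notation proj := (weight_proj hC).
Local Notation weights := (weights hC).
Local Notation ip := (ip hC gss).
Local Notation dual := (weight_dual hC gss).
Local Notation k := (size (simple_roots P)).
Local Notation d i := ((simple_roots P)`_i).

Lemma lie_sumr I (q : seq I) (Q : pred I) (f : I -> g) x :
  lie x (\sum_(i <- q | Q i) f i) = \sum_(i <- q | Q i) lie x (f i).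
Proof. exact: linear_sum. Qed.

(** [e] is a sum of simple root vectors and [f] a combination of opposite ones;
   the coefficients [c] solve the linear system that makes every simple root
   take the value 2 on [H]. *)
Lemma principal_triple : exists (H : subvs_of h) (e f : g),
  [/\ forall al, al \in simple_roots P -> al H = 2 :> F,
      lie (vsval H) e = 2 *: e, lie (vsval H) f = - 2 *: f & lie e f = vsval H].
Proof.
have /choice[G0 G0E] (p : 'I_k * 'I_k) : exists q : rat, ratr q = ip (d p.1) (d p.2).
  by have [q ->] := ip_rational gss (simple_weight hC gss Ppos p.1) (simple_weight hC gss Ppos p.2); exists q.
pose G := \matrix_(i, j) G0 (i, j).
have GE i j : ratr (G i j) = ip (d i) (d j) by rewrite mxE G0E.
have Gu := gram_unit Ppos GE.
pose GF : 'M[F]_k := map_mx ratr G; pose c : 'rV[F]_k := const_mx 2 *m invmx GF.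
have cG (i : 'I_k) : \sum_j c 0 j * ip (d j) (d i) = 2.
  have : (c *m GF) 0 i = 2 by rewrite /c mulmxKV ?map_unitmx // mxE.
  by rewrite mxE => <-; apply: eq_bigr => j _; rewrite [GF _ _]mxE GE.
pose H := \sum_j c 0 j *: dual (d j).
have dH (i : 'I_k) : (d i) H = 2 :> F.
  rewrite -(cG i) linear_sum /=; apply: eq_bigr => j _; rewrite linearZ /= ipC.
  by [].
have sH al : al \in simple_roots P -> al H = 2 :> F.
  by move=> /(nthP 0)[i ik <-]; exact: (dH (Ordinal ik)).
have /choice[ef efE] (i : 'I_k) : exists ef : g * g,
    [/\ ef.1 \in ws (d i), ef.2 \in ws (- d i) & lie ef.1 ef.2 = vsval (dual (d i))].
  have [u [v [ua va uv]]] := root_pair_exists gss (simple_weight hC gss Ppos i).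
  by exists (u, v).
exists H, (\sum_i (ef i).1), (\sum_i c 0 i *: (ef i).2); split=> //.
- rewrite lie_sumr scaler_sumr; apply: eq_bigr => i _; have [ei _ _] := efE i.
  by rewrite (weight_space_eigen hC gss _ ei) dH.
- rewrite lie_sumr scaler_sumr; apply: eq_bigr => i _; have [_ fi _] := efE i.
  rewrite lieZr (weight_space_eigen hC gss _ fi) opp_lfunE dH.
  by rewrite !scalerA mulrC.
rewrite lie_suml linear_sum /=; apply: eq_bigr => i _; have [ei fi eif] := efE i.
rewrite lie_sumr (bigD1 i) //= lieZr eif big1 ?addr0 // => j ji.
have [_ fj _] := efE j; have := weight_space_lie ei fj.
have := simple_diff hC gss Ppos (simple_mem i) (simple_mem j).
rewrite simple_inj eq_sym ji mem_weights negbK => /(_ isT)/eqP->.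
by rewrite memv0 lieZr => /eqP->; rewrite scaler0.
Qed.

(** [z] is the height: the number of simple roots in the decomposition of a
   positive root, and the opposite for negative roots. *)
Lemma principal_height (H : subvs_of h) :
  (forall al, al \in simple_roots P -> al H = 2 :> F) ->
  exists z : weight -> int, forall r, r \in weights ->
    [/\ r H = (2 * z r)%:~R :> F, z r = 0 -> r = 0, 0 < z r -> r \in P &
        z r < 0 -> - r \in P].
Proof.
move=> sH.
have posH al : al \in P -> exists2 n : nat, (0 < n)%N & al H = (2 * n)%:R :> F.
  move=> aP; have [q [q0 qS ->]] := positive_sum_simple hC gss Ppos aP.
  exists (size q); first by rewrite lt0n size_eq0.
  rewrite sum_lfunE big_seq (eq_bigr (fun=> 2)) => [|be bq]; last exact/sH/qS.
  by rewrite -big_seq big_const_seq count_predT iter_addr_0 natrM mulr_natr.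
suff /choice[z zP] r : exists z : int, r \in weights ->
    [/\ r H = (2 * z)%:~R :> F, z = 0 -> r = 0, 0 < z -> r \in P & z < 0 -> - r \in P].
  by exists z.
have [rw|] := boolP (r \in weights); last by exists 0.
have [->|r0] := eqVneq r 0.
  by exists 0 => _; split=> //; rewrite zero_lfunE.
have root : is_root r by rewrite (is_rootE hC gss) r0.
have := positive_or_negative Ppos root; have [rP _|rP] := boolP (r \in P).
  by have [n n0 nE] := posH r rP; exists n%:Z => _; split=> //; case: (n) n0.
move=> /= nrP; have [n n0 nE] := posH _ nrP; exists (- n%:Z) => _; split=> //.
- by rewrite -[r]opprK opp_lfunE nE mulrN intrN.
- by case: (n) n0.
by case: (n) n0.
Qed.

(** [pr k] is the sum of the weight projections of height [k]. *)
Theorem principal_grading_exists :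
  exists (H e f : g) m pr, [/\ principal_grading (@killing F g) H e f m pr,
    forall k v, k < 0 -> pr k v \in nminus P &
    forall k v, 0 <= k -> pr k v \in borel P].
Proof.
have [H [e [f [sH He Hf ef]]]] := principal_triple.
have [z zP] := principal_height sH.
pose m := (\max_(r <- weights) `|z r|)%N.
pose pr n : 'End(g) := \sum_(r <- weights | z r == n) proj r.
have prE n r v : v \in ws r -> pr n v = if z r == n then v else 0.
  move=> vr; rewrite sum_lfunE (eq_bigr (fun s => 1 *: proj s v)); last first.
    by move=> s _; rewrite scale1r.
  rewrite (weight_proj_combination hC (fun s => z s == n) (fun _ => 1) vr).
  by rewrite scale1r.
have wsw r v : v \in ws r -> v != 0 -> r \in weights.
  move=> vr v0; rewrite mem_weights; apply: contra v0 => /eqP r0.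
  by move: vr; rewrite r0 memv0.
have Hv r v : v \in ws r -> lie (vsval H) v = (2 * z r)%:~R *: v.
  move=> vr; have [->|v0] := eqVneq v 0; first by rewrite lie0r scaler0.
  rewrite (weight_space_eigen hC gss _ vr).
  by have [-> _ _ _] := zP r (wsw r v vr v0).
exists (vsval H), e, f, m, pr; split.
- split=> //.
  + by move=> a x y w; exact: killing_linl.
  + exact: killingC.
  + exact: killing_inv.
  + by move=> x; exact: (killing_nondegenerate hC gss).
  + move=> n; apply: (weight_ind hC) => [|u v uE vE|r v vr].
    * by rewrite linear0 lie0r scaler0.
    * by rewrite linearD /= lieDr uE vE scalerDr.
    rewrite (prE n r v vr); case: eqP => [<-|_]; first exact: Hv.
    by rewrite lie0r scaler0.
  + move=> n; apply: (weight_ind hC) => [|u v uE vE|r v vr].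
    * by rewrite !(lie0r, linear0).
    * by rewrite !(lieDr, linearD) /= uE vE.
    rewrite (Hv r v vr) linearZ /= (prE n r v vr); case: eqP => [zn|_].
      by rewrite (Hv r v vr).
    by rewrite lie0r scaler0.
  + apply: (weight_ind hC) => [|u v uE vE|r v vr].
    * by rewrite big1 // => i _; rewrite linear0.
    * by rewrite -{2}uE -{2}vE -big_split; apply: eq_bigr => i _; rewrite linearD.
    have [->|v0] := eqVneq v 0; first by rewrite big1 // => i _; rewrite linear0.
    have zm : (`|z r| <= m)%N.
      by rewrite /m (big_rem _ (wsw r v vr v0)) /= leq_maxl.
    have im : (`|(z r + m%:Z)%R| < m.*2.+1)%N by lia.
    rewrite (bigD1 (Ordinal im)) //= (prE _ r v vr) ifT; last by apply/eqP; lia.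
    rewrite big1 ?addr0 // => i; rewrite (prE _ r v vr) -val_eqE /= => ii.
    by rewrite ifF //; apply/eqP; move/eqP: ii; lia.
  have pr0 v : pr 0 v \in h.
    rewrite sum_lfunE big_seq_cond; apply: memv_suml => r /andP[rw /eqP z0].
    have [_ /(_ z0) -> _ _] := zP r rw.
    by have := weight_proj_mem hC 0 v; rewrite (cartan_weight0 hC).
  by move=> u v; apply: (cartan_abelian hC gss); exact: pr0.
- move=> n v n0; rewrite sum_lfunE big_seq_cond; apply: memv_suml => r /andP[rw /eqP zn].
  have [_ _ _ rP] := zP r rw; rewrite zn n0 in rP.
  rewrite /nminus (big_rem _ (rP isT)) /= opprK; apply: (subvP (addvSl _ _)).
  by rewrite -(weight_spaceE hC gss) weight_proj_mem.
move=> n v n0; rewrite sum_lfunE big_seq_cond; apply: memv_suml => r /andP[rw /eqP zn].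
have [_ r0 rP _] := zP r rw; rewrite zn in r0 rP.
move: n0; rewrite le_eqVlt => /predU1P[n0|n0].
  rewrite (r0 (esym n0)); apply: (subvP (addvSl _ _)).
  by have := weight_proj_mem hC 0 v; rewrite (cartan_weight0 hC).
apply: (subvP (addvSr _ _)); rewrite /nplus (big_rem _ (rP n0)) /=.
by apply: (subvP (addvSl _ _)); rewrite -(weight_spaceE hC gss) weight_proj_mem.
Qed.

End PrincipalGrading.

(** * Ranks of bilinear forms and of pencils of matrices *)

Section BilinearRank.
Variables (F : fieldType) (V : vectType F).
Implicit Types (U W K : {vspace V}) (u v w x y : V) (phi : V -> V -> F).
Local Notation e := (vbasis {:V}).
Local Notation n := (\dim {:V}).

Definition form_mx phi : 'M[F]_n := \matrix_(i, j) phi e`_i e`_j.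

Lemma rank_rows_le m (A : 'M[F]_(m, n)) K :
  (forall i, vecof e (row i A) \in K) -> (\rank A <= \dim K)%N.
Proof.
move=> AK; have bV := vbasisP {:V}.
pose C := \matrix_(i, j) coord (vbasis K) j (vecof e (row i A)).
pose D := \matrix_(j < \dim K) rVof e (vbasis K)`_j.
have -> : A = C *m D.
  apply/row_matrixP => i; rewrite -[LHS](vecofK bV) (coord_vbasis (AK i)).
  rewrite row_mul mulmx_sum_row linear_sum; apply: eq_bigr => j _ /=.
  by rewrite linearZ /= rowK !mxE.
by apply: leq_trans (mxrankM_maxl _ _) (rank_leq_col _).
Qed.

Lemma rank_mxof_le (f : 'End(V)) : (\rank (mxof e e f) <= \dim (limg f))%N.
Proof.
have bV := vbasisP {:V}.
by apply: rank_rows_le => i; rewrite rowE mul_mxof rVofK // memv_img ?memvf.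
Qed.

Variable phi : V -> V -> F.
Hypothesis phil : forall y, linear (fun x => phi x y : F^o).
Hypothesis phir : forall x, linear (phi x : V -> F^o).

Lemma form_suml I (r : seq I) (P : pred I) (f : I -> V) y :
  phi (\sum_(i <- r | P i) f i) y = \sum_(i <- r | P i) phi (f i) y.
Proof.
pose L : {linear V -> F^o} := HB.pack (fun x => phi x y : F^o)
  (GRing.isLinear.Build F _ _ _ _ (phil y)).
exact: (linear_sum L).
Qed.

Lemma form_sumr I (r : seq I) (P : pred I) (f : I -> V) x :
  phi x (\sum_(i <- r | P i) f i) = \sum_(i <- r | P i) phi x (f i).
Proof.
pose L : {linear V -> F^o} := HB.pack (phi x : V -> F^o)
  (GRing.isLinear.Build F _ _ _ _ (phir x)).
exact: (linear_sum L).
Qed.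

Lemma form0l y : phi 0 y = 0.
Proof. by have := phil y (-1) 0 0; rewrite scaler0 addr0 scaleN1r addNr. Qed.

Lemma form0r x : phi x 0 = 0.
Proof. by have := phir x (-1) 0 0; rewrite scaler0 addr0 scaleN1r addNr. Qed.

Lemma formZl a x y : phi (a *: x) y = a * phi x y.
Proof. by have := phil y a x 0; rewrite !addr0 form0l addr0. Qed.

Lemma formZr a x y : phi x (a *: y) = a * phi x y.
Proof. by have := phir x a y 0; rewrite !addr0 form0r addr0. Qed.

Lemma formDl x x' y : phi (x + x') y = phi x y + phi x' y.
Proof. by have := phil y 1 x x'; rewrite !scale1r. Qed.

Lemma formDr x y y' : phi x (y + y') = phi x y + phi x y'.
Proof. by have := phir x 1 y y'; rewrite !scale1r. Qed.

Lemma form_basis0 x : (forall j : 'I_n, phi x e`_j = 0) -> forall y, phi x y = 0.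
Proof.
move=> x0 y; rewrite (coord_vbasis (memvf y)) form_sumr big1 // => i _.
by rewrite formZr x0 mulr0.
Qed.

Lemma pairing_dim U W :
  (forall u, u \in U -> (forall w, w \in W -> phi u w = 0) -> u = 0) ->
  (\dim U <= \dim W)%N.
Proof.
move=> UW; pose f x : 'rV[F]_(\dim W) := \row_j phi x (vbasis W)`_j.
have lf : linear f.
  by move=> a x y; apply/rowP => j; rewrite !mxE formDl formZl.
pose L : {linear V -> 'rV[F]_(\dim W)} := HB.pack f
  (GRing.isLinear.Build F _ _ _ _ lf).
have UK : (U :&: lker (linfun L) = 0)%VS.
  apply/eqP; rewrite -subv0; apply/subvP => u; rewrite memv_cap memv_ker lfunE /=.
  move=> /andP[uU /eqP/rowP u0]; rewrite memv0; apply/eqP; apply: UW => // w wW.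
  rewrite (coord_vbasis wW) form_sumr big1 // => j _.
  by have := u0 j; rewrite !mxE formZr => ->; rewrite mulr0.
rewrite -(limg_dim_eq UK); apply: leq_trans (dimvS (subvf _)) _.
by rewrite dimvf /dim /= mul1n.
Qed.

(** In the block decomposition [U + W] the form is antidiagonal, and its
   off-diagonal block has full rank [dim U]. *)
Lemma antidiagonal_rank U W :
  (forall x, phi x x = 0) ->
  (forall u u', u \in U -> u' \in U -> phi u u' = 0) ->
  (forall w w', w \in W -> w' \in W -> phi w w' = 0) ->
  (forall v, exists u w, [/\ u \in U, w \in W & v = u + w]) ->
  (\dim U + \dim W = n)%N ->
  (forall u, u \in U -> (forall w, w \in W -> phi u w = 0) -> u = 0) ->
  (\dim U + \dim U <= \rank (form_mx phi))%N.
Proof.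
move=> alt UU WW UW dUW inj.
have skew x y : phi x y = - phi y x.
  apply/eqP; rewrite -addr_eq0; have := alt (x + y).
  by rewrite formDl !formDr !alt add0r addr0 => ->.
have [|a u v u0 v0 y|K KP] := @vspace_of_pred _ V (fun x => forall y, phi x y = 0).
- exact: form0l.
- by rewrite formDl formZl u0 v0 mulr0 addr0.
have KW : (K <= W)%VS.
  apply/subvP => x /KP x0; have [u [w [uU wW xE]]] := UW x.
  suff u0 : u = 0 by rewrite xE u0 add0r.
  apply: inj => // w' w'W; have := x0 w'.
  by rewrite xE formDl (WW w w') // addr0.
have dK : (\dim U <= \dim (W :\: K))%N.
  apply: pairing_dim => u uU u0; apply: inj => // w wW.
  have : w \in (W :\: K + W :&: K)%VS by rewrite addv_diff_cap.
  move=> /memv_addP[w1 w1W [w2]]; rewrite memv_cap => /andP[_ /KP w20] ->.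
  by rewrite formDr u0 // (skew u w2) w20 oppr0 addr0.
have dWK := dimv_cap_compl W K; rewrite (capv_idPr KW) in dWK.
have : (\rank (kermx (form_mx phi)) <= \dim K)%N.
  apply: rank_rows_le => i; apply/KP; apply: form_basis0 => j.
  set r := row i _; have r0 : r *m form_mx phi = 0.
    by apply/sub_kermxP; exact: row_sub.
  have := congr1 (fun M : 'rV_n => M 0 j) r0; rewrite mxE [RHS]mxE => E.
  rewrite /vecof form_suml -[RHS]E; apply: eq_bigr => l _; rewrite formZl.
  by rewrite [form_mx _ _ _]mxE.
rewrite mxrank_ker; lia.
Qed.

Lemma form_mx_comp_rank (A : 'End(V)) :
  (\rank (form_mx (fun x y => phi (A x) (A y))) <= \rank (form_mx phi))%N.
Proof.
pose M := mxof e e A.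
have AE (i : 'I_n) : A e`_i = \sum_(l < n) M i l *: e`_l.
  rewrite [LHS](coord_vbasis (memvf _)); apply: eq_bigr => l _.
  by rewrite !mxE /= vecof_delta.
have -> : form_mx (fun x y => phi (A x) (A y)) = M *m form_mx phi *m M^T.
  apply/matrixP => i j; rewrite [LHS]mxE !AE form_sumr mxE; apply: eq_bigr => l _.
  rewrite formZr form_suml !mxE mulrC; congr (_ * _); apply: eq_bigr => l' _.
  by rewrite formZl [form_mx _ _ _]mxE.
by apply: leq_trans (mxrankM_maxl _ _) (mxrankM_maxr _ _).
Qed.

End BilinearRank.

Lemma poly_cofinite_eq0 (F : numFieldType) (p : {poly F}) (bad : seq F) :
  (forall s, s \notin bad -> p.[s] = 0) -> p = 0.
Proof.
move=> p0; pose q := p * \prod_(b <- bad) ('X - b%:P).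
have q0 s : q.[s] = 0.
  rewrite hornerM; have [sb|/p0->] := boolP (s \in bad); last by rewrite mul0r.
  by rewrite horner_prod (big_rem _ sb) /= hornerXsubC subrr mul0r mulr0.
have : q == 0.
  apply: contraT => qn0.
  have := @max_poly_roots _ q [seq i%:R | i <- iota 0 (size q)] qn0.
  rewrite size_map size_iota ltnn => -> //.
    by apply/allP => _ /mapP[i _ ->]; rewrite /root q0.
  by rewrite map_inj_uniq ?iota_uniq //; exact: mulrIn (oner_neq0 _).
rewrite mulf_eq0 => /orP[/eqP//|]; rewrite prodf_seq_eq0 => /hasP[b _].
by rewrite /= polyXsubC_eq0.
Qed.

Lemma horner_det_pencil (F : comNzRingType) k (A C : 'M[F]_k) (s : F) :
  (\det (map_mx polyC A + 'X *: map_mx polyC C)).[s] = \det (A + s *: C).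
Proof.
rewrite -horner_evalE -det_map_mx; congr (\det _); apply/matrixP => i j.
by rewrite !mxE /= /horner_eval !hornerE.
Qed.

Section Jets.
Variables (F : numFieldType) (V : vectType F) (k : nat).
Variables (A : 'M[F]_k) (L : {linear V -> 'M[F]_k}).

(** The homogeneous components of [w -> \det (A + L w)] vanish one after the
   other, by induction on the degree: when those of degree less than [d] are zero,
   the coefficient of [s ^ d] along a curve [s w + O(s ^ 2)] is the component of
   degree [d] at [w]. *)
Lemma det_jet :
  (forall w, exists m (q : nat -> V), q 0%N = w /\
    forall s, \det (A + s *: L (\sum_(i < m.+1) s ^+ i *: q i)) = 0) ->
  forall w, \det (A + L w) = 0.
Proof.
move=> curve.
pose p w : {poly F} := \det (map_mx polyC A + 'X *: map_mx polyC (L w)).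
have pE w s : (p w).[s] = \det (A + s *: L w).
  exact: horner_det_pencil.
suff p0 w : p w = 0 by move=> w; rewrite -[L w]scale1r -pE p0 horner0.
apply/polyP => d; rewrite coef0; elim/ltn_ind: d w => d IH w.
have [m [q [q0 qE]]] := curve w.
(* outer variable: the jet order; inner variable: the parameter of the curve *)
pose LY : 'M[{poly F}]_k := \sum_(i < m.+1) 'X^i *: map_mx polyC (L (q i)).
pose Q : {poly {poly F}} := \det (map_mx polyC (map_mx polyC A) + 'X *: map_mx polyC LY).
have LYE s : map_mx (horner_eval s) LY = L (\sum_(i < m.+1) s ^+ i *: q i).
  rewrite linear_sum /LY raddf_sum; apply: eq_bigr => i _; apply/matrixP => a b.
  rewrite linearZ !mxE /= /horner_eval hornerM hornerXn hornerC.
  by [].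
have QE s : map_poly (horner_eval s) Q = p (\sum_(i < m.+1) s ^+ i *: q i).
  rewrite -det_map_mx; congr (\det _); apply/matrixP => i j.
  rewrite !mxE rmorphD rmorphM /= !map_polyC /= map_polyX /horner_eval hornerC.
  by rewrite -LYE !mxE.
have Qlt j : (j < d)%N -> Q`_j = 0.
  move=> jd; apply: (poly_cofinite_eq0 (bad := [::])) => s _.
  by rewrite -[_.[s]](coef_map (horner_eval s)) QE IH.
have QX s : Q.['X].[s] = 0.
  have E : (map_poly (horner_eval s) Q).[s] = Q.['X].[s].
    by have := horner_map (horner_eval s) Q 'X; rewrite /= /horner_eval hornerX.
  by rewrite -E QE pE qE.
have QX0 : Q.['X] = 0 by apply: (poly_cofinite_eq0 (bad := [::])) => s _; exact: QX.
have Qd : Q = drop_poly d Q * 'X^d.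
  rewrite -[LHS](poly_take_drop d) [take_poly d Q](_ : _ = 0) ?add0r //.
  by apply/polyP => j; rewrite coef_take_poly coef0; case: ltnP => // /Qlt.
have T0 : (drop_poly d Q).['X] = 0.
  apply/eqP; move: QX0; rewrite {1}Qd hornerM hornerXn => /eqP.
  by rewrite mulf_eq0 expf_eq0 polyX_eq0 andbF orbF.
have : (map_poly (horner_eval 0) (drop_poly d Q)).[0] = 0.
  have := horner_map (horner_eval 0) (drop_poly d Q) 'X.
  by rewrite /= /horner_eval hornerX T0 horner0.
rewrite horner_coef0 coef_map coef_drop_poly add0n /= /horner_eval.
rewrite -[_.[0]](coef_map (horner_eval 0)) QE big_ord_recl expr0 scale1r q0.
by rewrite big1 ?addr0 // => i _; rewrite expr0n scale0r.
Qed.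

End Jets.

(** * Algebra of a principal grading *)

Section GradingAlgebra.
Variables (F : numFieldType) (g : lieAlgType F).
Variables (B : g -> g -> F) (H e f : g) (m : nat) (pr : int -> 'End(g)).
Hypothesis pg : principal_grading B H e f m pr.
Implicit Types (x y u v w z : g) (a b c : F) (i j k : int).

Let Bl y : linear (fun x => B x y : F^o).
Proof. by move=> a u v; exact: (grading_form_linear pg). Qed.

Let Br x : linear (B x : g -> F^o).
Proof.
move=> a u v; rewrite !(grading_form_sym pg x).
exact: (grading_form_linear pg).
Qed.

Lemma pr_eigen j k v : lie H v = (2 * k)%:~R *: v -> pr j v = if j == k then v else 0.
Proof.
move=> vk; have neq i : i != k -> pr i v = 0.
  move=> ik; have := grading_comm pg i v.
  rewrite vk linearZ /= (grading_eigen pg) => /eqP.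
  rewrite -subr_eq0 -scalerBl scaler_eq0 subr_eq0 eqr_int => /orP[|/eqP//].
  by move/eqP: ik => ik /eqP; lia.
case: eqP => [->|/eqP/neq//]; have [q|nq] := pselect (exists i : 'I_(m.*2.+1), i%:Z - m%:Z = k).
  have [i iE] := q; rewrite -[RHS](grading_sum pg) (bigD1 i) //= iE big1 ?addr0 // => l li.
  apply: neq; apply: contra li => /eqP lE; apply/eqP/val_inj => /=; lia.
suff -> : v = 0 by rewrite linear0.
rewrite -(grading_sum pg v) big1 // => i _; apply: neq.
by apply/eqP => iE; apply: nq; exists i.
Qed.

Lemma pr_pr j k v : pr j (pr k v) = if j == k then pr k v else 0.
Proof. exact/pr_eigen/(grading_eigen pg). Qed.

Lemma pr_lie i j k u v :
  pr k (lie (pr i u) (pr j v)) = if k == i + j then lie (pr i u) (pr j v) else 0.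
Proof.
apply: pr_eigen; rewrite lie_derivation !(grading_eigen pg) lieZl lieZr.
by rewrite -scalerDl -intrD -mulrDr.
Qed.

Lemma pr_out k v : (m < `|k|)%N -> pr k v = 0.
Proof.
move=> mk; rewrite -(grading_sum pg (pr k v)) big1 // => i _.
rewrite pr_pr ifF //; apply/eqP; have := ltn_ord i; lia.
Qed.

Lemma grading_ind (Q : g -> Prop) : Q 0 -> (forall u v, Q u -> Q v -> Q (u + v)) ->
  (forall k v, Q (pr k v)) -> forall v, Q v.
Proof.
by move=> Q0 QD Qpr v; rewrite -(grading_sum pg v); apply: big_ind.
Qed.

Lemma pr_ext u v : (forall k, pr k u = pr k v) -> u = v.
Proof.
by move=> uv; rewrite -(grading_sum pg u) -(grading_sum pg v); apply: eq_bigr.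
Qed.

Lemma lie_pr u v : lie u v =
  \sum_(i < m.*2.+1) \sum_(j < m.*2.+1) lie (pr (i%:Z - m%:Z) u) (pr (j%:Z - m%:Z) v).
Proof.
rewrite -{1}(grading_sum pg u) -{1}(grading_sum pg v) lie_suml.
by apply: eq_bigr => i _; exact: lie_sumr.
Qed.

Lemma pr_lie_eq0 k u v : (forall i j, k = i + j -> lie (pr i u) (pr j v) = 0) ->
  pr k (lie u v) = 0.
Proof.
move=> uv; rewrite lie_pr linear_sum big1 // => i _; rewrite linear_sum big1 // => j _ /=.
by rewrite pr_lie; case: eqP => // /uv.
Qed.

Lemma pr_lie_homl k i x v : lie H x = (2 * i)%:~R *: x ->
  pr k (lie x v) = lie x (pr (k - i) v).
Proof.
move=> xi; elim/grading_ind: v => [|u v uE vE|j v].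
- by rewrite !linear0.
- by rewrite !(lieDr, linearD) /= uE vE.
have {1}-> : x = pr i x by rewrite (pr_eigen i xi) eqxx.
rewrite pr_lie pr_pr; have -> : (k == i + j) = (k - i == j) by apply/eqP/eqP; lia.
by case: eqP => [<-|_]; [rewrite (pr_eigen i xi) eqxx | rewrite lie0r].
Qed.

Lemma graded_part_exists (S : int -> Prop) : exists U : {vspace g}, forall v,
  v \in U <-> forall k, ~ S k -> pr k v = 0.
Proof.
apply: vspace_of_pred => [k _|a u v u0 v0 k nS]; first exact: linear0.
by rewrite linearD linearZ /= u0 // v0 // scaler0 addr0.
Qed.

Definition graded_part S : {vspace g} := sval (cid (graded_part_exists S)).

Lemma graded_partP S v : v \in graded_part S <-> forall k, ~ S k -> pr k v = 0.
Proof. exact: (svalP (cid (graded_part_exists S))). Qed.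

Local Notation neg := (graded_part (fun k => k < 0)).
Local Notation nonneg := (graded_part (fun k => 0 <= k)).
Local Notation pos := (graded_part (fun k => 0 < k)).

Definition neg_part v := \sum_(i < m.*2.+1 | (i < m)%N) pr (i%:Z - m%:Z) v.
Definition nonneg_part v := \sum_(i < m.*2.+1 | ~~ (i < m)%N) pr (i%:Z - m%:Z) v.

Lemma part_sum v : neg_part v + nonneg_part v = v.
Proof. by rewrite -[RHS](grading_sum pg) (bigID (fun i : 'I__ => (i < m)%N)). Qed.

Lemma neg_part_mem v : neg_part v \in neg.
Proof.
apply/graded_partP => k nk; rewrite linear_sum big1 // => i im /=.
by rewrite pr_pr ifF //; apply/eqP => kE; apply: nk; lia.
Qed.

Lemma nonneg_part_mem v : nonneg_part v \in nonneg.
Proof.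
apply/graded_partP => k nk; rewrite linear_sum big1 // => i im /=.
by rewrite pr_pr ifF //; apply/eqP => kE; apply: nk; lia.
Qed.

Lemma neg_lie u v : u \in neg -> v \in neg -> lie u v \in neg.
Proof.
move=> /graded_partP u0 /graded_partP v0; apply/graded_partP => k nk.
apply: pr_lie_eq0 => i j kE; have [i0|i0] := boolP (0 <= i).
  by rewrite u0 ?lie0l //; apply/negP; rewrite -leNgt.
by rewrite (v0 j) ?lie0r //; lia.
Qed.

(** The degree-zero part of [b] is abelian, so brackets land in [n_+]. *)
Lemma nonneg_lie u v : u \in nonneg -> v \in nonneg -> lie u v \in pos.
Proof.
move=> /graded_partP u0 /graded_partP v0; apply/graded_partP => k nk.
apply: pr_lie_eq0 => i j kE; have [i0|i0] := boolP (0 <= i); last first.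
  by rewrite u0 ?lie0l //; exact/negP.
have [j0|j0] := boolP (0 <= j); last by rewrite (v0 j) ?lie0r //; exact/negP.
have [-> ->] : i = 0 /\ j = 0 by lia.
exact: (grading0_abelian pg).
Qed.

Lemma pos_nonneg v : v \in pos -> v \in nonneg.
Proof.
by move=> /graded_partP v0; apply/graded_partP => k nk; apply: v0; lia.
Qed.

(** By invariance, eigenspaces of [ad H] are orthogonal unless their degrees are opposite. *)
Lemma form_pr i u v : B (pr i u) v = B u (pr (- i) v).
Proof.
have orth j l x y : j + l != 0 -> B (pr j x) (pr l y) = 0.
  move=> jl; have := grading_form_inv pg (pr j x) H (pr l y).
  rewrite lie_anti !(grading_eigen pg) -scaleNr (formZl Bl) (formZr Br) => /eqP.
  rewrite -subr_eq0 -mulrBl mulf_eq0 -opprD oppr_eq0 -intrD intr_eq0.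
  by rewrite -mulrDr mulf_eq0 (negPf jl) => /eqP.
elim/grading_ind: v => [|v w vE wE|l v].
- by rewrite linear0 !(form0r Br).
- by rewrite linearD /= !(formDr Br) vE wE.
elim/grading_ind: u => [|u w uE wE|j u].
- by rewrite linear0 !(form0l Bl).
- by rewrite linearD /= !(formDl Bl) uE wE.
rewrite !pr_pr; case: eqP => [<-|/eqP ij]; case: eqP => [<-|/eqP il] //.
- by rewrite orth ?(form0r Br) //; lia.
- by rewrite (form0l Bl) orth //; lia.
by rewrite (form0l Bl) (form0r Br).
Qed.

Lemma form_pos_nonneg x y : x \in pos -> y \in nonneg -> B x y = 0.
Proof.
move=> /graded_partP x0 /graded_partP y0.
rewrite -(grading_sum pg x) (form_suml Bl) big1 // => i _; rewrite form_pr.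
have [i0|i0] := boolP (0 < i%:Z - m%:Z).
  by rewrite y0 ?(form0r Br) //; lia.
by rewrite -form_pr x0 ?(form0l Bl) //; exact/negP.
Qed.

Lemma form_nonneg_orth x : (forall y, y \in nonneg -> B x y = 0) -> x \in pos.
Proof.
move=> x0; apply/graded_partP => k nk; apply: (grading_form_nondegenerate pg) => y.
rewrite form_pr; apply: x0; apply/graded_partP => l nl.
by rewrite pr_pr ifF //; apply/eqP => lk; lia.
Qed.

Lemma dim_parts : (\dim neg + \dim nonneg)%N = \dim {:g}.
Proof.
rewrite -dimv_disjoint_sum.
  congr (\dim _); apply/eqP; rewrite eqEsubv subvf /=; apply/subvP => v _.
  by rewrite -(part_sum v) memv_add ?neg_part_mem ?nonneg_part_mem.
apply/eqP; rewrite -subv0; apply/subvP => v; rewrite memv_cap => /andP[/graded_partP v1 /graded_partP v2].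
rewrite memv0; apply/eqP/pr_ext => k; rewrite linear0.
by have [k0|k0] := boolP (0 <= k); [apply: v1; lia | apply: v2; exact/negP].
Qed.

(** The form pairs the two parts without kernel on either side. *)
Lemma dim_pos : \dim pos = \dim neg.
Proof.
apply/eqP; rewrite eqn_leq; apply/andP; split; apply: (pairing_dim Bl Br) => u /graded_partP u0 uw.
  apply/pr_ext => k; rewrite linear0; have [k0|k0] := boolP (0 < k); last by apply: u0; exact/negP.
  apply: (grading_form_nondegenerate pg) => y; rewrite form_pr; apply: uw.
  apply/graded_partP => l nl; rewrite pr_pr ifF //; apply/eqP; lia.
apply/pr_ext => k; rewrite linear0; have [k0|k0] := boolP (k < 0); last by apply: u0; exact/negP.
apply: (grading_form_nondegenerate pg) => y; rewrite form_pr; apply: uw.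
apply/graded_partP => l nl; rewrite pr_pr ifF //; apply/eqP; lia.
Qed.

(** Each application of [ad y] lowers the degree, which lies between [- m] and [m]. *)
Lemma neg_nilpotent y v : y \in neg -> iter m.*2.+1 (lie y) v = 0.
Proof.
move=> /graded_partP y0.
have low n : forall k, m%:Z - n%:Z < k -> pr k (iter n (lie y) v) = 0.
  elim: n => [k mk|n IH k nk]; first by rewrite pr_out //; lia.
  rewrite iterS; apply: pr_lie_eq0 => i j kE; have [i0|i0] := boolP (i < 0).
    by rewrite IH ?lie0r //; lia.
  by rewrite y0 ?lie0l //; exact/negP.
apply/pr_ext => k; rewrite linear0; have [km|km] := boolP (m < `|k|)%N; first exact: pr_out.
by apply: low; lia.
Qed.

(** Lowering a highest-weight-like vector of negative weight by [f] never
   produces zero, against the finiteness of the grading. *)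
Lemma negative_eigen_ker_e y k : k < 0 -> lie H y = (2 * k)%:~R *: y ->
  lie e y = 0 -> y = 0.
Proof.
move=> k0 Hy ey; pose yn n := iter n (lie f) y.
have Hyn n : lie H (yn n) = (2 * (k - n%:Z))%:~R *: yn n.
  elim: n => [|n IH]; first by rewrite subr0.
  rewrite /yn iterS -/(yn n) lie_derivation (grading_Hf pg) lieZl IH lieZr -scalerDl.
  by congr (_ *: _); rewrite -[-2%:R]/((-2)%:~R) -intrD; congr (_%:~R); lia.
have eyn n : lie e (yn n.+1) = (n.+1%:Z * (2 * k - n%:Z))%:~R *: yn n.
  elim: n => [|n IH].
    rewrite /yn /= lie_derivation (grading_ef pg) Hy ey lie0r addr0.
    by rewrite mul1r subr0.
  rewrite {1}/yn iterS -/(yn n.+1) lie_derivation (grading_ef pg) Hyn IH lieZr -[lie f _]/(yn n.+1).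
  by rewrite -scalerDl -intrD; congr (_%:~R *: _); lia.
have yout : yn m.+1 = 0.
  have := pr_eigen (k - m.+1%:Z) (Hyn m.+1); rewrite eqxx => <-.
  by apply: pr_out; lia.
have : forall n, yn n = 0 -> y = 0; last by move/(_ _ yout).
elim=> [//|n IH] yn0; apply: IH; have := eyn n; rewrite yn0 lie0r => /esym/eqP.
rewrite scaler_eq0 intr_eq0 mulf_eq0 => /orP[/orP[|]|/eqP//]; first by [].
by move=> /eqP; lia.
Qed.

(** In the lowest degree [k] of [x] the bracket with [x] is [mu1 * 2 k] times the
   component of [x]; when [mu1 = 0], [ad e] is injective on negative degrees. *)
Lemma principal_injective mu1 mu2 x : (mu1 != 0) || (mu2 != 0) -> x \in neg ->
  lie (mu1 *: H + mu2 *: e) x \in pos -> x = 0.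
Proof.
move=> mu0 /graded_partP x0 /graded_partP wx0.
have H0 : lie H H = (2 * 0)%:~R *: H by rewrite liexx mulr0 scale0r.
have e1 : lie H e = (2 * 1)%:~R *: e by rewrite (grading_He pg).
have E k : k <= 0 -> mu1 * (2 * k)%:~R *: pr k x + mu2 *: lie e (pr (k - 1) x) = 0.
  move=> k0; rewrite -[RHS](wx0 k); last by lia.
  rewrite lieDl !lieZl linearD !linearZ /= (pr_lie_homl k x H0) (pr_lie_homl k x e1).
  by rewrite subr0 (grading_eigen pg) scalerA.
have nn k : ~ (k < 0) -> pr k x = 0 by exact: x0.
have [m10|m10] := eqVneq mu1 0.
  have m20 : mu2 != 0 by move: mu0; rewrite m10 eqxx.
  apply/pr_ext => k; rewrite linear0; have [k0|/negP] := boolP (k < 0); last exact: nn.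
  apply: (negative_eigen_ker_e k0 (grading_eigen pg k x)).
  have := E (k + 1); rewrite m10 mul0r scale0r add0r addrK => /(_ _)/eqP.
  by rewrite scaler_eq0 (negPf m20) => /(_ _)/eqP; apply; lia.
have low n : forall k, k < n%:Z - m%:Z -> pr k x = 0.
  elim: n => [k km|n IH k kn]; first by rewrite pr_out //; lia.
  have [k0|/negP] := boolP (k < 0); last exact: nn.
  have := E k (ltW k0); rewrite (IH (k - 1)) ?lie0r ?scaler0 ?addr0; last by lia.
  move=> /eqP; rewrite scaler_eq0 mulf_eq0 (negPf m10) intr_eq0 mulf_eq0 /= => /orP[|/eqP//].
  by rewrite lt_eqF.
apply/pr_ext => k; rewrite linear0; have [k0|/negP] := boolP (k < 0); last exact: nn.
by apply: (low m); lia.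
Qed.

End GradingAlgebra.

(** * Minors and exponentials *)

Section Minors.
Variable F : fieldType.

Lemma minor_of_rank m n r (M : 'M[F]_(m, n)) : (r <= \rank M)%N ->
  exists L R, L *m M *m R = 1%:M :> 'M_r.
Proof.
move=> rM; exists (pid_mx r *m invmx (col_ebase M)), (invmx (row_ebase M) *m pid_mx r).
have ME := mulmx_ebase M; set C := col_ebase M in ME *; set D := row_ebase M in ME *.
transitivity (pid_mx r *m invmx C *m (C *m pid_mx (\rank M) *m D) *m (invmx D *m pid_mx r) : 'M[F]_r).
  by rewrite ME.
rewrite !mulmxA mulmxKV ?col_ebase_unit // mulmxK ?row_ebase_unit // !mul_pid_mx.
have rm := leq_trans rM (rank_leq_row M); have rn := leq_trans rM (rank_leq_col M).
by rewrite -pid_mx_1; congr pid_mx; lia.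
Qed.

Lemma rank_of_minor m n r (M : 'M[F]_(m, n)) (L : 'M_(r, m)) (R : 'M_(n, r)) :
  \det (L *m M *m R) != 0 -> (r <= \rank M)%N.
Proof.
rewrite -unitfE -unitmxE => u; rewrite -(mxrank_unit u).
by apply: leq_trans (mxrankM_maxl _ _) (mxrankM_maxr _ _).
Qed.

Lemma rank_le_minors m n r (M : 'M[F]_(m, n)) :
  (forall (L : 'M_(r.+1, m)) (R : 'M_(n, r.+1)), \det (L *m M *m R) = 0) ->
  (\rank M <= r)%N.
Proof.
move=> M0; rewrite leqNgt; apply/negP => /minor_of_rank[L [R LR]].
by have := M0 L R; rewrite LR det1 => /eqP; rewrite oner_eq0.
Qed.

End Minors.

Section Exponential.
Variables (F : numFieldType) (g : lieAlgType F) (y : g) (M : nat).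
Hypothesis ynil : forall v, iter M (lie y) v = 0.
Implicit Types (u v a b : g).

Let T n v : g := (n`!%:R)^-1 *: iter n (lie y) v.

Lemma divided_power_succ n v : lie y (T n v) = n.+1%:R *: T n.+1 v.
Proof.
rewrite /T lieZr -iterS scalerA factS natrM invfM mulrA divff ?mul1r //.
by rewrite pnatr_eq0.
Qed.

(** Leibniz' rule, free of binomial coefficients in terms of divided powers. *)
Lemma divided_power_leibniz n a b :
  T n (lie a b) = \sum_(i < n.+1) lie (T i a) (T (n - i) b).
Proof.
elim: n => [|n IH]; first by rewrite big_ord1 /T /= invr1 !scale1r.
have n0 : n.+1%:R != 0 :> F by rewrite pnatr_eq0.
apply: (scalerI n0); rewrite -divided_power_succ IH lie_sumr.
rewrite (eq_bigr (fun i : 'I_n.+1 => i.+1%:R *: lie (T i.+1 a) (T (n - i) b)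
   + (n - i).+1%:R *: lie (T i a) (T (n.+1 - i) b))); last first.
  move=> i _; rewrite lie_derivation !divided_power_succ lieZl [lie _ ((n - i).+1%:R *: _)]lieZr.
  by rewrite subSn // -ltnS.
rewrite big_split /=.
have -> : \sum_(i < n.+1) i.+1%:R *: lie (T i.+1 a) (T (n - i) b)
   = \sum_(i < n.+2) i%:R *: lie (T i a) (T (n.+1 - i) b).
  rewrite [RHS]big_ord_recl scale0r add0r; apply: eq_bigr => i _.
  by rewrite lift0 subSS.
have -> : \sum_(i < n.+1) (n - i).+1%:R *: lie (T i a) (T (n.+1 - i) b)
   = \sum_(i < n.+2) (n.+1 - i)%:R *: lie (T i a) (T (n.+1 - i) b).
  rewrite [RHS]big_ord_recr /= subnn scale0r addr0; apply: eq_bigr => i _.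
  by rewrite subSn // -ltnS.
rewrite -big_split scaler_sumr; apply: eq_bigr => i _ /=.
by rewrite -scalerDl -natrD subnKC // -ltnS.
Qed.

Definition lie_exp : 'End(g) :=
  \sum_(n < M) (n`!%:R)^-1 *: iter n (fun f : 'End(g) => (ad y \o f)%VF) \1%VF.

Lemma lie_expE v : lie_exp v = \sum_(n < M) T n v.
Proof.
rewrite sum_lfunE; apply: eq_bigr => n _; rewrite scale_lfunE; congr (_ *: _).
by elim: (n : nat) => [|j IH] /=; rewrite ?id_lfunE // comp_lfunE adE IH.
Qed.

Lemma divided_power_out n v : (M <= n)%N -> T n v = 0.
Proof.
by rewrite /T => Mn; rewrite (iter_lie_leq Mn (ynil v)) scaler0.
Qed.

(** Both sides are sums of the terms [lie (T i a) (T j b)]; those with [i] or [j]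
   at least [M] are zero. *)
Lemma lie_exp_morph a b : lie_exp (lie a b) = lie (lie_exp a) (lie_exp b).
Proof.
rewrite !lie_expE; transitivity (\sum_(n < M + M) T n (lie a b)).
  rewrite big_split_ord /= [X in _ + X]big1 ?addr0 // => i _.
  by rewrite divided_power_out // leq_addr.
rewrite (eq_bigr (fun n : 'I_(M + M) =>
   \sum_(i < M + M | (i < n.+1)%N) lie (T i a) (T (n - i) b))); last first.
  move=> n _; rewrite divided_power_leibniz.
  by rewrite (big_ord_widen (M + M) (fun i => lie (T i a) (T (n - i) b))).
rewrite (exchange_big_dep xpredT) //= big_split_ord /= [X in _ + X]big1 ?addr0; last first.
  by move=> i _; rewrite big1 // => n _; rewrite divided_power_out ?leq_addr // lie0l.
rewrite lie_suml; apply: eq_bigr => i _; rewrite lie_sumr.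
rewrite -(big_mkord (fun n => (i < n.+1)%N) (fun n => lie (T i a) (T (n - i) b))).
rewrite -(big_mkord xpredT (fun n => lie (T i a) (T n b))).
transitivity (\sum_(0 + i <= n < M + M) lie (T i a) (T (n - i) b)).
  by rewrite add0n [RHS](big_nat_widenl i 0).
rewrite big_addn (@big_cat_nat _ _ _ M) //=; last by have := ltn_ord i; lia.
rewrite [X in _ + X]big_nat_cond [X in _ + X]big1 ?addr0.
  by apply: eq_bigr => n _; rewrite addnK.
by move=> n /andP[/andP[Mn _] _]; rewrite addnK (divided_power_out _ Mn) lie0r.
Qed.

(** On the last nonzero iterate of [lie y] the exponential acts as the identity. *)
Lemma lie_exp_ker0 : lker lie_exp == 0%VS.
Proof.
rewrite -subv0; apply/subvP => v; rewrite memv_ker memv0 => /eqP v0.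
have ex : exists n, iter n (lie y) v == 0 by exists M; rewrite ynil.
case: (ex_minnP ex) => -[|n] /eqP nv min; first by rewrite -nv.
have [|] := leqP M n; first by move=> /iter_lie_leq/(_ (ynil v))/eqP/min; rewrite ltnn.
move=> nM; have : iter n (lie y) (lie_exp v) = 0 by rewrite v0 iter_lie0.
rewrite lie_expE -(subnKC (leq_ltn_trans (leq0n n) nM)) add1n big_ord_recl.
rewrite {1}/T /= invr1 scale1r -(scale1r v) iter_lie_lin scale1r.
set S := \sum_(i < _) _; suff -> : iter n (lie y) S = 0.
  by rewrite addr0 scale1r => /eqP/min; rewrite ltnn.
rewrite /S; elim/big_ind: _ => [|u w u0 w0|i _]; first exact: iter_lie0.
  by rewrite -(scale1r u) iter_lie_lin u0 w0 scaler0 addr0.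
rewrite /T -(addr0 (_ *: _)) iter_lie_lin iter_lie0 addr0 -iterD.
by rewrite (iter_lie_leq _ nv) ?scaler0 // /bump /= add1n addnS ltnS leq_addr.
Qed.

Lemma dim_limg_ad_exp z : \dim (limg (ad (lie_exp z))) = \dim (limg (ad z)).
Proof.
have E : (ad (lie_exp z) \o lie_exp = lie_exp \o ad z)%VF.
  by apply/lfunP => v; rewrite !comp_lfunE !adE lie_exp_morph.
rewrite -{1}(lker0_limgf lie_exp_ker0) -limg_comp E limg_comp limg_dim_eq //.
by rewrite (eqP lie_exp_ker0) capv0.
Qed.

End Exponential.

Section ModuleEquations.
Import VectorInternalTheory.
Variables (F : fieldType) (V : vectType F).
Implicit Types (u v : V).

Definition vcoord j v : F := v2r v 0 j.

Lemma vcoord_inj u v : (forall j, vcoord j u = vcoord j v) -> u = v.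
Proof. by move=> uv; apply: (can_inj v2rK); apply/rowP; exact: uv. Qed.

Lemma vcoordD j u v : vcoord j (u + v) = vcoord j u + vcoord j v.
Proof. by rewrite /vcoord linearD mxE. Qed.

Lemma vcoordN j u : vcoord j (- u) = - vcoord j u.
Proof. by rewrite /vcoord linearN mxE. Qed.

Lemma vcoordZ j a u : vcoord j (a *: u) = a * vcoord j u.
Proof. by rewrite /vcoord linearZ mxE. Qed.

Lemma vcoord0 j : vcoord j 0 = 0.
Proof. by rewrite /vcoord linear0 mxE. Qed.

End ModuleEquations.

(** Solves identities between linear combinations coordinatewise. *)
Ltac module_eq :=
  apply: vcoord_inj => ?; rewrite ?(vcoordD, vcoordN, vcoordZ, vcoord0); ring.

Lemma add3ACA (V : zmodType) (a a' b b' c c' : V) :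
  (a + a') - (b + b') + (c + c') = (a - b + c) + (a' - b' + c').
Proof. by rewrite opprD [a + a' + _]addrACA [LHS]addrACA. Qed.

(** * Rank of the pencil of a principal grading *)

Section PencilRank.
Variables (F : numFieldType) (g : lieAlgType F).
Variables (B : g -> g -> F) (H e f : g) (m : nat) (pr : int -> 'End(g)).
Hypothesis pg : principal_grading B H e f m pr.
Implicit Types (x y u v w z : g) (a b c : F) (i j k : int).
Local Notation neg := (graded_part pr (fun k => (k < 0)%R)).
Local Notation nonneg := (graded_part pr (fun k => (0 <= k)%R)).
Local Notation pos := (graded_part pr (fun k => (0 < k)%R)).
Local Notation bas := (vbasis {:g}).
Local Notation d := (\dim neg).

Let Bl y : linear (fun x => B x y : F^o).
Proof. by move=> a u v; exact: (grading_form_linear pg). Qed.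

Let Br x : linear (B x : g -> F^o).
Proof.
move=> a u v; rewrite !(grading_form_sym pg x).
exact: (grading_form_linear pg).
Qed.

(** [ad z] maps [b] into [n_+], which has dimension [d], and so does [n_-]. *)
Lemma dim_limg_ad_nonneg z : z \in nonneg -> (\dim (limg (ad z)) <= d + d)%N.
Proof.
move=> zb; have -> : fullv = (neg + nonneg)%VS.
  apply/eqP; rewrite eqEsubv subvf andbT; apply/subvP => v _.
  by rewrite -(part_sum pg v) memv_add ?(neg_part_mem pg) ?(nonneg_part_mem pg).
rewrite limgD; apply: leq_trans (dimv_add_leqif _ _) _; apply: leq_add.
  by rewrite -[X in (_ <= X)%N](limg_ker_dim (ad z)) leq_addl.
rewrite -(dim_pos pg); apply: dimvS; apply/subvP => _ /memv_imgP[v vb ->].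
by rewrite adE; apply: (nonneg_lie pg).
Qed.

Lemma H_nonneg : H \in nonneg.
Proof.
apply/graded_partP => k k0; rewrite (@pr_eigen _ _ _ _ _ _ _ _ pg k 0).
  by rewrite ifF //; apply/eqP => kE; apply: k0; rewrite kE.
by rewrite liexx mulr0 scale0r.
Qed.

Lemma neg_part_bracket w : exists2 y, y \in neg & lie y H = neg_part m pr w.
Proof.
exists (- \sum_(i < m.*2.+1 | (i < m)%N) (2 * (i%:Z - m%:Z))%:~R^-1 *: pr (i%:Z - m%:Z) w).
  rewrite memvN; apply: memv_suml => i im; rewrite memvZ //; apply/graded_partP => k nk.
  by rewrite (pr_pr pg) ifF //; apply/eqP => kE; apply: nk; lia.
rewrite lie_anti lieNr opprK lie_sumr; apply: eq_bigr => i im.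
rewrite lieZr (grading_eigen pg) scalerA mulVf ?scale1r // intr_eq0; lia.
Qed.

Lemma iter_lie_scale c y (j : nat) v : iter j (lie (c *: y)) v = c ^+ j *: iter j (lie y) v.
Proof.
elim: j => [|j IH]; first by rewrite scale1r.
by rewrite !iterS IH lieZl lieZr scalerA exprS.
Qed.

Lemma mxof_ad_lin : linear (fun u : g => mxof bas bas (ad u)).
Proof. by move=> a u v; rewrite ad_lin linearD linearZ. Qed.

(** Elements of [b] satisfy the bound by [dim_limg_ad_nonneg]. Given [w], let
   [y] in [n_-] be such that [lie y H] is the negative part of [w], and [z] the
   nonnegative part: the curve [exp (s ad y) (H + s z)] is tangent to [w] at [H] and
   consists of conjugates of elements of [b]. So the minors of size [d + d + 1]
   vanish identically by [det_jet]. *)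
Lemma rank_ad u : (\rank (mxof bas bas (ad u)) <= d + d)%N.
Proof.
apply: rank_le_minors => L R.
pose M x := mxof bas bas (ad x).
have Ml : linear (fun w : g => L *m M w *m R).
  move=> a x y; rewrite /M mxof_ad_lin mulmxDr mulmxDl.
  by rewrite -scalemxAr -scalemxAl.
pose LM : {linear g -> 'M[F]_((d + d).+1)} := HB.pack (fun w : g => L *m M w *m R)
  (GRing.isLinear.Build F _ _ _ _ Ml).
have small z : (\dim (limg (ad z)) <= d + d)%N -> \det (LM z) = 0.
  move=> zd; apply/eqP; apply: contraT => /rank_of_minor rk.
  have := leq_trans rk (leq_trans (rank_mxof_le (ad z)) zd).
  by rewrite ltnn.
rewrite -[u](subrK H) addrC -[_ *m _ *m _]/(LM (H + (u - H))) linearD.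
apply: det_jet => w; have [y yn yH] := neg_part_bracket w.
pose z := nonneg_part m pr w.
pose q (i : nat) := (i.+1`!%:R)^-1 *: iter i.+1 (lie y) H + (i`!%:R)^-1 *: iter i (lie y) z.
exists m.*2, q; split.
  by rewrite /q /= !invr1 !scale1r yH (part_sum pg).
move=> s; rewrite -linearZ -linearD; apply: small.
have yn' : s *: y \in neg by rewrite memvZ.
have nil v : iter m.*2.+1 (lie (s *: y)) v = 0 by apply: (neg_nilpotent pg).
suff -> : H + s *: \sum_(i < m.*2.+1) s ^+ i *: q i = lie_exp (s *: y) m.*2.+1 (H + s *: z).
  rewrite dim_limg_ad_exp //; apply: dim_limg_ad_nonneg.
  by rewrite memvD ?H_nonneg // memvZ // (nonneg_part_mem pg).
rewrite linearD linearZ /= !lie_expE scaler_sumr.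
rewrite (eq_bigr (fun i : 'I_m.*2.+1 => ((i.+1)`!%:R)^-1 *: iter i.+1 (lie (s *: y)) H
  + s *: ((i`!%:R)^-1 *: iter i (lie (s *: y)) z))); last first.
  move=> i _; rewrite /q !iter_lie_scale !scalerDr !scalerA exprS.
  by congr (_ *: _ + _ *: _); ring.
rewrite big_split /= -scaler_sumr addrA; congr (_ + _).
rewrite [X in H + X]big_ord_recr /=.
have -> : lie (s *: y) (iter m.*2 (lie (s *: y)) H) = 0 := nil H.
by rewrite scaler0 addr0 [RHS]big_ord_recl /= invr1 scale1r.
Qed.

(** By invariance this is the matrix of [ad u] times the matrix of the form. *)
Lemma rank_form_bracket u : (\rank (form_mx (fun x y => B u (lie x y))) <= d + d)%N.
Proof.
suff -> : form_mx (fun x y => B u (lie x y)) = mxof bas bas (ad u) *m form_mx B.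
  exact: leq_trans (mxrankM_maxl _ _) (rank_ad u).
apply/matrixP => i j; rewrite !mxE -(grading_form_inv pg).
rewrite -(adE u) [in LHS](coord_vbasis (memvf (ad u bas`_i))) (form_suml Bl).
apply: eq_bigr => l _; rewrite (formZl Bl) !mxE /=; congr (_ * _).
by rewrite vecof_delta.
Qed.

Variables (N : 'End(g)) (lam1 lam2 : F).
Hypothesis lam12 : lam1 != lam2.
Hypothesis Nneg : forall k v, k < 0 -> N (pr k v) = lam1 *: pr k v.
Hypothesis Nnonneg : forall k v, 0 <= k -> N (pr k v) = lam2 *: pr k v.

Lemma N_neg u : u \in neg -> N u = lam1 *: u.
Proof.
move=> /graded_partP u0; rewrite -(grading_sum pg u) linear_sum scaler_sumr.
apply: eq_bigr => i _ /=; have [i0|i0] := boolP (i%:Z - m%:Z < 0); first exact: Nneg.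
by rewrite u0 ?linear0 ?scaler0 //; exact/negP.
Qed.

Lemma N_nonneg u : u \in nonneg -> N u = lam2 *: u.
Proof.
move=> /graded_partP u0; rewrite -(grading_sum pg u) linear_sum scaler_sumr.
apply: eq_bigr => i _ /=; have [i0|i0] := boolP (0 <= i%:Z - m%:Z); first exact: Nnonneg.
by rewrite u0 ?linear0 ?scaler0 //; exact/negP.
Qed.

Lemma N_part v : N v = lam1 *: neg_part m pr v + lam2 *: nonneg_part m pr v.
Proof.
rewrite -{1}(part_sum pg v) linearD /= (N_neg (neg_part_mem pg v)).
by rewrite (N_nonneg (nonneg_part_mem pg v)).
Qed.

(** [N] is diagonalizable with eigenvalues [lam1] and [lam2]. *)
Lemma N_quadratic v : N (N v) - (lam1 + lam2) *: N v + (lam1 * lam2) *: v = 0.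
Proof.
pose T u := N (N u) - (lam1 + lam2) *: N u + (lam1 * lam2) *: u.
have TD u w : T (u + w) = T u + T w.
  by rewrite /T !(linearD N) /= !scalerDr add3ACA.
have T0 a u : (a - lam1) * (a - lam2) = 0 -> N u = a *: u -> T u = 0.
  move=> a0 Nu; rewrite /T Nu linearZ /= Nu !scalerA -scalerBl -scalerDl.
  by rewrite -[RHS](scale0r u) -a0; congr (_ *: _); ring.
rewrite -/(T v) -(part_sum pg v) TD (T0 lam1) ?(T0 lam2) ?addr0 //.
- by rewrite subrr mulr0.
- by rewrite N_nonneg // (nonneg_part_mem pg).
- by rewrite subrr mul0r.
by rewrite N_neg // (neg_part_mem pg).
Qed.

(** For eigenvectors with the same eigenvalue the bracket is an eigenvector too,
   since [n_-] and [b] are subalgebras; for different eigenvalues the identity is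
   the quadratic equation of [N]. *)
Lemma grading_nijenhuis : nijenhuis N.
Proof.
pose T x y := lie (N x) (N y) - N (lie (N x) y + lie x (N y)) + N (N (lie x y)).
have TDl x x' y : T (x + x') y = T x y + T x' y.
  by rewrite /T !(linearD N) !lieDl !(linearD N) /=; module_eq.
have TDr x y y' : T x (y + y') = T x y + T x y'.
  by rewrite /T !(linearD N) !lieDr !(linearD N) /=; module_eq.
have TE a b x y : N x = a *: x -> N y = b *: y ->
    T x y = (a * b) *: lie x y - (a + b) *: N (lie x y) + N (N (lie x y)).
  move=> Nx Ny; rewrite /T Nx Ny !lieZl !lieZr scalerA -scalerDl linearZ.
  by [].
have mixed a b x y : a + b = lam1 + lam2 -> a * b = lam1 * lam2 ->
    N x = a *: x -> N y = b *: y -> T x y = 0.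
  move=> ab ab' Nx Ny; rewrite (TE a b) // ab ab' -[RHS](N_quadratic (lie x y)).
  by rewrite addrC addrA addrAC.
have same a x y : N x = a *: x -> N y = a *: y -> N (lie x y) = a *: lie x y -> T x y = 0.
  move=> Nx Ny Nxy; rewrite (TE a a) // !Nxy.
  have -> : N (a *: lie x y) = (a * a) *: lie x y by rewrite linearZ /= Nxy scalerA.
  by module_eq.
move=> x y; rewrite -/(T x y) -(part_sum pg x) -(part_sum pg y) TDl !TDr.
have nx := neg_part_mem pg x; have bx := nonneg_part_mem pg x.
have ny := neg_part_mem pg y; have by_ := nonneg_part_mem pg y.
rewrite (same lam1 _ _ (N_neg nx) (N_neg ny) (N_neg (neg_lie pg nx ny))) add0r.
rewrite (mixed lam1 lam2 _ _ erefl erefl (N_neg nx) (N_nonneg by_)) add0r.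
rewrite (mixed lam2 lam1 _ _ (addrC _ _) (mulrC _ _) (N_nonneg bx) (N_neg ny)) add0r.
exact: (same lam2 _ _ (N_nonneg bx) (N_nonneg by_)
  (N_nonneg (pos_nonneg (nonneg_lie pg bx by_)))).
Qed.

Local Notation theta := (nijenhuis_pencil N).

Lemma pencilE s xi x y :
  theta s xi x y = xi (s.1 *: lie x y + s.2 *: lie_deformed N x y).
Proof. by rewrite linearD !linearZ. Qed.

(** A member of the pencil of brackets is mapped to the original bracket by [A],
   since [N] maps [lie_deformed N x y] to [lie (N x) (N y)]. *)
Lemma pencil_conjugation s x y :
  let A := (s.1 *: \1 + s.2 *: N)%VF in
  A (s.1 *: lie x y + s.2 *: lie_deformed N x y) = lie (A x) (A y).
Proof.
move=> A; have AE v : A v = s.1 *: v + s.2 *: N v.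
  by rewrite add_lfunE !scale_lfunE id_lfunE.
have Nd : N (lie_deformed N x y) = lie (N x) (N y).
  have /eqP := grading_nijenhuis x y; rewrite /lie_deformed linearB /=.
  by rewrite -addrA addr_eq0 => /eqP->; rewrite opprD opprK addrC.
rewrite !AE (linearD N) !linearZ /= Nd /lie_deformed.
rewrite !lieDl !lieDr !lieZl !lieZr.
module_eq.
Qed.

Lemma pencil_linl t (eta : dual_space g) y :
  linear (fun x => theta t eta x y : F^o).
Proof.
move=> a u v; rewrite !pencilE /lie_deformed -linearP.
congr (eta _); rewrite !(linearD N) !lieDl !lieZl (linearD N) !linearZ /= !lieZl.
by module_eq.
Qed.

Lemma pencil_linr t (eta : dual_space g) x : linear (theta t eta x : g -> F^o).
Proof.
move=> a u v; rewrite !pencilE /lie_deformed -linearP.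
congr (eta _); rewrite !(linearD N) !lieDr !lieZr (linearD N) !linearZ /= ?lieZr.
by module_eq.
Qed.

(** For all but finitely many parameters the operator [A] of
   [pencil_conjugation] is invertible, the bracket is conjugate to the original one,
   and [rank_form_bracket] applies; the minors of the other members vanish because
   they are polynomial in the parameter. *)
Lemma rank_pencil_le s (xi : dual_space g) :
  (bivector_rank (theta s) xi <= d + d)%N.
Proof.
(* invertible members *)
have inv t (eta : dual_space g) : t.1 + t.2 * lam1 != 0 -> t.1 + t.2 * lam2 != 0 ->
    (\rank (form_mx (theta t eta)) <= d + d)%N.
  set mu1 := t.1 + _; set mu2 := t.1 + _ => m1 m2.
  pose A : 'End(g) := (t.1 *: \1 + t.2 *: N)%VF.
  have AE v : A v = mu1 *: neg_part m pr v + mu2 *: nonneg_part m pr v.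
    rewrite add_lfunE !scale_lfunE id_lfunE N_part -{1}(part_sum pg v).
    by rewrite /mu1 /mu2; module_eq.
  have Ainj : lker A == 0%VS.
    rewrite -subv0; apply/subvP => v; rewrite memv_ker memv0 AE => /eqP v0.
    have nn k : mu1 *: pr k (neg_part m pr v) + mu2 *: pr k (nonneg_part m pr v) = 0.
      by rewrite -!linearZ -linearD v0 linear0.
    have /graded_partP n0 := neg_part_mem pg v.
    have /graded_partP b0 := nonneg_part_mem pg v.
    apply/eqP; rewrite -(part_sum pg v); apply: (pr_ext pg) => k; rewrite linear0 linearD /=.
    have := nn k; have [k0|k0] := boolP (k < 0).
      rewrite (b0 k) ?scaler0 ?addr0; last by lia.
      by move/eqP; rewrite scaler_eq0 (negPf m1) => /eqP.
    rewrite (n0 k) ?scaler0 ?add0r; last exact/negP.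
    by move/eqP; rewrite scaler_eq0 (negPf m2) => /eqP.
  have [u uE] := bilinear_repr Bl Br (grading_form_nondegenerate pg) (eta \o A^-1)%VF.
  apply: leq_trans (rank_form_bracket u).
  have -> : form_mx (theta t eta) = form_mx (fun x y => B u (lie (A x) (A y))).
    apply/matrixP => i j; rewrite !mxE pencilE -uE -pencil_conjugation comp_lfunE.
    by rewrite lker0_lfunK.
  apply: (form_mx_comp_rank (phi := fun x y => B u (lie x y))).
  - by move=> y a x z; rewrite lieDl lieZl; exact: Br.
  - by move=> x a y z; rewrite lieDr lieZr; exact: Br.
rewrite /bivector_rank -/(form_mx (theta s xi)); apply: rank_le_minors => L R.
pose X := L *m form_mx (theta s xi) *m R.
pose Y := L *m form_mx (theta (1, 0) xi) *m R.
have E a : X + a *: Y = L *m form_mx (theta (s.1 + a, s.2) xi) *m R.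
  rewrite /X /Y scalemxAl -mulmxDl scalemxAr -mulmxDr; congr (_ *m _ *m _).
  by apply/matrixP => i j; rewrite !mxE /= /nijenhuis_pencil /pencil /=; ring.
have p0 := @poly_cofinite_eq0 _ (\det (map_mx polyC X + 'X *: map_mx polyC Y))
  [:: - (s.1 + s.2 * lam1); - (s.1 + s.2 * lam2)].
have := horner_det_pencil X Y 0; rewrite scale0r addr0 -/X => <-.
rewrite p0 ?horner0 // => a; rewrite !inE negb_or !(eq_sym a) => /andP[a1 a2].
rewrite horner_det_pencil E; apply/eqP; apply: contraT => /rank_of_minor rk.
have := leq_trans rk (inv (s.1 + a, s.2) xi _ _); rewrite ltnn => -> //=.
  by rewrite addrAC addr_eq0 eq_sym eqr_oppLR eq_sym.
by rewrite addrAC addr_eq0 eq_sym eqr_oppLR eq_sym.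
Qed.

(** At [B (e + H)] every member of the pencil is antidiagonal with respect to
   [g = n_- + b], and pairs [x] in [n_-] and [y] in [b] to
   [B (lie (mu1 *: H + mu2 *: e) x) y], where [mu1] and [mu2] are the
   eigenvalues of the operator of the member. *)
Lemma principal_point (xi : dual_space g) : (forall y, xi y = B (e + H) y) ->
  forall s : F * F, s != 0 -> (d + d <= bivector_rank (theta s) xi)%N.
Proof.
move=> xiE s s0; rewrite /bivector_rank -/(form_mx (theta s xi)).
have xiD v : xi v = B e v + B H v by rewrite xiE (formDl Bl).
have e1 : lie H e = (2 * 1)%:~R *: e by rewrite (grading_He pg).
have ee k : pr k e = if k == 1 then e else 0 := pr_eigen pg k e1.
have e_pos : e \in pos.
  by apply/graded_partP => k nk; rewrite ee ifF //; apply/eqP => k1; apply: nk; rewrite k1.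
have H0 : lie H H = (2 * 0)%:~R *: H by rewrite liexx mulr0 scale0r.
have HH k : pr k H = if k == 0 then H else 0 := pr_eigen pg k H0.
have Be v : B e v = B e (pr (-1) v) by have := form_pr pg 1 e v; rewrite ee eqxx.
have BH v : B H v = B H (pr 0 v) by have := form_pr pg 0 H v; rewrite HH eqxx oppr0.
have xi_pos z : z \in pos -> xi z = 0.
  move=> zp; rewrite xiD !(grading_form_sym pg _ z).
  rewrite (form_pos_nonneg pg zp (pos_nonneg e_pos)).
  by rewrite (form_pos_nonneg pg zp H_nonneg) addr0.
have xiN z : xi (N z) = lam1 * B e z + lam2 * B H z.
  have Ee : B e z = B e (neg_part m pr z).
    rewrite -{1}(part_sum pg z) (formDr Br) [X in _ + X](form_pos_nonneg pg e_pos) ?addr0 //.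
    exact: (nonneg_part_mem pg).
  have BH0 : B H (neg_part m pr z) = 0.
    rewrite BH; have /graded_partP -> // := neg_part_mem pg z.
    exact: (form0r Br).
  have EH : B H z = B H (nonneg_part m pr z).
    by rewrite -{1}(part_sum pg z) (formDr Br) BH0 add0r.
  have Be0 : B e (nonneg_part m pr z) = 0.
    by apply: (form_pos_nonneg pg e_pos); exact: (nonneg_part_mem pg).
  rewrite N_part xiD !(formDr Br) !(formZr Br) Be0 BH0 -Ee -EH.
  by rewrite !mulr0 addr0 add0r.
have thE a b x y : N x = a *: x -> N y = b *: y -> theta s xi x y =
    s.1 * xi (lie x y) + s.2 * ((a + b) * xi (lie x y) - xi (N (lie x y))).
  move=> Nx Ny; rewrite pencilE /lie_deformed Nx Ny lieZl lieZr -scalerDl.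
  by rewrite linearD !linearZ linearB linearZ.
set mu1 := s.1 + s.2 * lam1; set mu2 := s.1 + s.2 * lam2.
have mu0 : (mu1 != 0) || (mu2 != 0).
  apply: contraNT s0; rewrite negb_or !negbK => /andP[/eqP m1 /eqP m2].
  have /eqP : s.2 * (lam1 - lam2) = 0.
    by rewrite -[RHS](subrr 0) -{1}m1 -m2 /mu1 /mu2; ring.
  rewrite mulf_eq0 subr_eq0 (negPf lam12) orbF => /eqP s2.
  move: m1; rewrite /mu1 s2 mul0r addr0 => s1.
  by rewrite [s]surjective_pairing s1 s2.
apply: (@antidiagonal_rank _ _ _ _ _ neg nonneg).
- exact: pencil_linl.
- exact: pencil_linr.
- move=> x; rewrite pencilE /lie_deformed (lie_anti (N x)) addNr liexx (linear0 N).
  by rewrite subr0 !scaler0 addr0 (linear0 xi).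
- move=> x y xn yn; have zn := neg_lie pg xn yn.
  have deg k : -1 <= k -> pr k (lie x y) = 0.
    move: xn yn => /graded_partP xn /graded_partP yn k1; apply: (pr_lie_eq0 pg) => i j kE.
    have [i0|i0] := boolP (i < 0); last by rewrite xn ?lie0l //; exact/negP.
    by rewrite (yn j) ?lie0r //; lia.
  rewrite (thE _ _ _ _ (N_neg xn) (N_neg yn)) (N_neg zn) [xi (lam1 *: _)]linearZ /=.
  have -> : xi (lie x y) = 0 by rewrite xiD Be BH !deg // !(form0r Br) addr0.
  by rewrite scaler0 !mulr0 subr0 mulr0 addr0.
- move=> x y xn yn; have zn := nonneg_lie pg xn yn.
  rewrite (thE _ _ _ _ (N_nonneg xn) (N_nonneg yn)) (N_nonneg (pos_nonneg zn)).
  by rewrite [xi (lam2 *: _)]linearZ /= xi_pos // scaler0 !mulr0 subr0 mulr0 addr0.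
- move=> v; exists (neg_part m pr v), (nonneg_part m pr v).
  by rewrite (part_sum pg) (neg_part_mem pg) (nonneg_part_mem pg).
- exact: (dim_parts pg).
move=> x xn x0; apply: (principal_injective pg mu0 xn); apply: (form_nonneg_orth pg) => y yb.
rewrite -[RHS](x0 y yb) (thE _ _ _ _ (N_neg xn) (N_nonneg yb)) xiN xiD.
rewrite (grading_form_inv pg) (formDl Bl) !(formZl Bl) /mu1 /mu2; ring.
Qed.

Lemma principal_rank : exists r : nat,
  (forall s (xi : dual_space g), bivector_rank (theta s) xi <= r)%N /\
  exists xi : dual_space g, forall s : F * F, s != 0 -> (r <= bivector_rank (theta s) xi)%N.
Proof.
exists (d + d)%N; split; first exact: rank_pencil_le.
pose L : {linear g -> F^o} := HB.pack (B (e + H) : g -> F^o)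
  (GRing.isLinear.Build F _ _ _ _ (Br (e + H))).
by exists (linfun L) => s s0; apply: principal_point => // y; rewrite lfunE.
Qed.

End PencilRank.

(** * Polynomial functions *)

(** Classes of functions into a commutative ring that contain the constants and
   are closed under sums and products; they serve for functions with values in
   scalars and in polynomials. *)
Section DetClosed.
Variables (T : Type) (A : comNzRingType) (S : (T -> A) -> Prop).
Hypothesis Sconst : forall a, S (fun=> a).
Hypothesis SD : forall f g, S f -> S g -> S (fun t => f t + g t).
Hypothesis SM : forall f g, S f -> S g -> S (fun t => f t * g t).

Lemma closed_sum I (r : seq I) (P : pred I) (f : I -> T -> A) :
  (forall i, S (f i)) -> S (fun t => \sum_(i <- r | P i) f i t).
Proof.
move=> fS; elim: r => [|i r IH].
  by rewrite (_ : (fun _ => _) = (fun=> 0)) //; apply: funext => t; rewrite big_nil.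
rewrite (_ : (fun _ => _) = (fun t => (if P i then f i t else 0)
   + \sum_(j <- r | P j) f j t)); last first.
  by apply: funext => t; rewrite big_cons; case: ifP; rewrite ?add0r.
by apply: SD => //; case: (P i).
Qed.

Lemma closed_prod I (r : seq I) (f : I -> T -> A) :
  (forall i, S (f i)) -> S (fun t => \prod_(i <- r) f i t).
Proof.
move=> fS; elim: r => [|i r IH].
  by rewrite (_ : (fun _ => _) = (fun=> 1)) //; apply: funext => t; rewrite big_nil.
rewrite (_ : (fun _ => _) = (fun t => f i t * \prod_(j <- r) f j t)).
  exact: SM.
by apply: funext => t; rewrite big_cons.
Qed.

Lemma closed_det k (M : T -> 'M[A]_k) :
  (forall i j, S (fun t => M t i j)) -> S (fun t => \det (M t)).
Proof.
by move=> MS; apply: closed_sum => s; apply: SM => //; apply: closed_prod.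
Qed.

Lemma closed_mulmx l k (L : 'M[A]_(l, k)) (M : T -> 'M[A]_k) (R : 'M[A]_(k, l)) :
  (forall i j, S (fun t => M t i j)) -> forall i j, S (fun t => (L *m M t *m R) i j).
Proof.
move=> MS i j.
rewrite (_ : (fun _ => _) = (fun t => \sum_(a < k) (\sum_(b < k) L i b * M t b a) * R a j)).
  by apply: closed_sum => a; apply: SM => //; apply: closed_sum => b; apply: SM.
by apply: funext => t; rewrite mxE; apply: eq_bigr => a _; rewrite mxE.
Qed.

End DetClosed.

Section PolynomialFunctions.
Variables (C : numFieldType) (n : nat).
Local Notation vec := ('rV[C]_n).
Implicit Types (u v w : vec) (f : vec -> C).

(** The two properties of polynomial functions that make the complement of a
   hypersurface open and dense. *)
Definition polyfun f : Prop := continuous f /\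
  forall u v, exists p : {poly C}, forall t, f (u + t *: v) = p.[t].

Lemma polyfun_const a : polyfun (fun=> a).
Proof.
split=> [x|u v]; first exact: cst_continuous.
by exists a%:P => t; rewrite hornerC.
Qed.

Lemma polyfunD f1 f2 : polyfun f1 -> polyfun f2 -> polyfun (fun v => f1 v + f2 v).
Proof.
move=> [c1 p1] [c2 p2]; split=> [x|u v].
  exact: (continuousD (c1 x) (c2 x)).
have [p pE] := p1 u v; have [q qE] := p2 u v.
by exists (p + q) => t; rewrite pE qE hornerD.
Qed.

Lemma polyfunM f1 f2 : polyfun f1 -> polyfun f2 -> polyfun (fun v => f1 v * f2 v).
Proof.
move=> [c1 p1] [c2 p2]; split=> [x|u v].
  exact: (continuousM (c1 x) (c2 x)).
have [p pE] := p1 u v; have [q qE] := p2 u v.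
by exists (p * q) => t; rewrite pE qE hornerM.
Qed.

Lemma polyfun_coord j : polyfun (fun v => v 0 j).
Proof.
split=> [x|u v]; first exact: coord_continuous.
by exists ((u 0 j)%:P + (v 0 j) *: 'X) => t; rewrite !hornerE !mxE mulrC.
Qed.

Lemma polyfun_open f : polyfun f -> open [set v | f v != 0]%classic.
Proof.
move=> [cf _]; apply: (open_comp (f := f) (D := [set x | x != 0]%classic)) => [x _|].
  exact: cf.
rewrite openE => x /= x0; apply/nbhs_ballP; exists `|x|; first by rewrite /= normr_gt0.
by move=> y; rewrite /ball /=; apply: contraTneq => ->; rewrite subr0 ltxx.
Qed.

(** Along the line from a point [w] to [v0] the function is a nonzero polynomial;
   it cannot vanish at all the points [eps / k.+2] of the line, which are close to
   [w]. *)
Lemma polyfun_dense f v0 : polyfun f -> f v0 != 0 -> dense [set v | f v != 0]%classic.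
Proof.
move=> [_ fp] f0 O [w Ow] Oo; have [p pE] := fp w (v0 - w).
have p0 : p != 0.
  apply: contraNneq f0 => p0; have := pE 1.
  by rewrite p0 horner0 scale1r subrKC => ->.
have /nbhs_ballP[eps /= eps0 epsO] : nbhs (0 : C) [set t : C | O (w + t *: (v0 - w))]%classic.
  have ct : {for (0 : C), continuous (fun t : C => w + t *: (v0 - w))}.
    apply: continuousD; first exact: cst_continuous.
    by apply: continuousZr_tmp => U.
  by apply: ct; rewrite scale0r addr0; exact: open_nbhs_nbhs.
pose rs := [seq eps / k.+2%:R | k <- iota 0 (size p)].
have k0 k : k.+2%:R != 0 :> C by rewrite pnatr_eq0.
have urs : uniq rs.
  rewrite map_inj_uniq ?iota_uniq // => k l /(mulfI (lt0r_neq0 eps0))/invr_inj/eqP.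
  by rewrite eqr_nat !eqSS => /eqP.
have : ~~ all (root p) rs.
  apply/negP => ars; have := max_poly_roots p0 ars urs.
  by rewrite size_map size_iota ltnn.
case/allPn => _ /mapP[k _ ->] pk; exists (w + (eps / k.+2%:R) *: (v0 - w)); split; last by rewrite /= pE.
apply: epsO; rewrite /ball /= sub0r normrN gtr0_norm ?divr_gt0 ?ltr0n //.
by rewrite ltr_pdivrMr ?ltr0n // ltr_pMr // ltr1n.
Qed.

End PolynomialFunctions.

(** * Common roots of minors *)

Section PencilDeterminant.
Variables (C : fieldType).

Lemma linear_factors_size I (s : seq I) (a b : I -> C) :
  (size (\prod_(i <- s) ((a i)%:P + 'X * (b i)%:P))%R <= (size s).+1)%N /\
  (\prod_(i <- s) ((a i)%:P + 'X * (b i)%:P))`_(size s) = \prod_(i <- s) b i.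
Proof.
elim: s => [|i s [sz co]]; first by rewrite !big_nil size_poly1 coef1.
rewrite !big_cons /= mulrDl mul_polyC (mulrC 'X) -mulrA mul_polyC; split.
  apply: leq_trans (size_polyD _ _) _; rewrite geq_max; apply/andP; split.
    by apply: leq_trans (size_scale_leq _ _) _; apply: leq_trans sz _.
  apply: leq_trans (size_scale_leq _ _) _; apply: leq_trans (size_polyMleq _ _) _.
  by rewrite size_polyX.
rewrite coefD !coefZ coefXM /= co (nth_default 0 sz) mulr0 add0r.
by [].
Qed.

Variables (r : nat) (X Y : 'M[C]_r).

Lemma det_pencil_size :
  (size (\det (map_mx polyC X + 'X *: map_mx polyC Y))%R <= r.+1)%N /\
  (\det (map_mx polyC X + 'X *: map_mx polyC Y))`_r = \det Y.
Proof.
have E (s : {perm 'I_r}) : (-1) ^+ s * \prod_i (map_mx polyC X + 'X *: map_mx polyC Y) i (s i)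
    = (-1) ^+ s *: \prod_i ((X i (s i))%:P + 'X * (Y i (s i))%:P).
  rewrite -mul_polyC rmorphXn rmorphN rmorph1; congr (_ * _).
  by apply: eq_bigr => i _; rewrite !mxE.
have sz (s : {perm 'I_r}) : _ /\ _ :=
  linear_factors_size (index_enum 'I_r) (fun i => X i (s i)) (fun i => Y i (s i)).
have rE : size (index_enum 'I_r) = r by rewrite -[RHS]card_ord cardT enumT.
rewrite rE in sz.
rewrite /determinant (eq_bigr _ (fun s _ => E s)); split.
  apply: leq_trans (size_sum _ _ _) _; apply/bigmax_leqP => s _.
  by apply: leq_trans (size_scale_leq _ _) _; have [] := sz s.
by rewrite coef_sum; apply: eq_bigr => s _; rewrite coefZ; have [_ ->] := sz s.
Qed.

End PencilDeterminant.

Section Sylvester.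
Variables (C : fieldType) (r : nat).
Implicit Types p q : {poly C}.

(** The Sylvester matrix of two polynomials regarded as being of degree [r],
   whatever their actual degrees: its entries are then polynomial in the
   coefficients. *)
Definition sylvester_mx p q : 'M[C]_(r + r) :=
  \matrix_(i, j) match fintype.split i with
    | inl i' => ('X^i' * p)`_j | inr i' => ('X^i' * q)`_j end.

(** The powers of [c] form a vector in the kernel. *)
Lemma sylvester_common_root p q c : (0 < r)%N -> (size p <= r.+1)%N ->
  (size q <= r.+1)%N -> root p c -> root q c -> \det (sylvester_mx p q) = 0.
Proof.
move=> r0 sp sq /rootP pc /rootP qc; apply/eqP; rewrite -det_tr; apply/det0P.
exists (\row_j c ^+ j).
  have i0 : (0 < r + r)%N by rewrite addn_gt0 r0.
  apply/eqP => /rowP/(_ (Ordinal i0)); rewrite !mxE expr0 => /eqP.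
  by rewrite oner_eq0.
apply/rowP => i; rewrite !mxE.
have key (s : {poly C}) (l : 'I_r) : (size s <= r.+1)%N -> s.[c] = 0 ->
    \sum_(j < r + r) ('X^l * s)`_j * c ^+ j = 0.
  move=> ss s0; rewrite -horner_coef_wide ?hornerM ?s0 ?mulr0 //.
  apply: leq_trans (size_polyMleq _ _) _; rewrite size_polyXn.
  by have := ltn_ord l; lia.
case E: (fintype.split i) => [l|l].
  rewrite -[RHS](key p l sp pc).
  by apply: eq_bigr => j _; rewrite !mxE E mulrC.
rewrite -[RHS](key q l sq qc).
by apply: eq_bigr => j _; rewrite !mxE E mulrC.
Qed.

(** A vector in the kernel is a relation [a * p + b * q = 0] with [a] and [b] of
   degree less than [r], the degree of [p]. *)
Lemma sylvester_coprime p q : size p = r.+1 -> (size q <= r.+1)%N -> coprimep p q ->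
  \det (sylvester_mx p q) != 0.
Proof.
move=> sp sq pq; apply/negP => /det0P[w w0 wS].
pose a := \poly_(i < r) (if insub i is Some i' then w 0 (lshift r i') else 0).
pose b := \poly_(i < r) (if insub i is Some i' then w 0 (rshift r i') else 0).
have aE : a = \sum_(i < r) w 0 (lshift r i) *: 'X^i.
  by rewrite /a poly_def; apply: eq_bigr => i _; rewrite valK.
have bE : b = \sum_(i < r) w 0 (rshift r i) *: 'X^i.
  by rewrite /b poly_def; apply: eq_bigr => i _; rewrite valK.
have sa : (size a <= r)%N := size_poly _ _.
have sb : (size b <= r)%N := size_poly _ _.
have p0 : p != 0 by rewrite -size_poly_gt0 sp.
have ab : a * p + b * q = 0.
  apply/polyP => j; rewrite coef0; have [j2|j2] := ltnP j (r + r)%N; last first.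
    rewrite nth_default //; apply: leq_trans (size_polyD _ _) _; apply: leq_trans j2.
    rewrite geq_max; apply/andP; split; apply: leq_trans (size_polyMleq _ _) _.
      by rewrite sp addnS leq_add2r.
    have := leq_add sb sq; rewrite addnS; by case: (_ + _)%N.
  have := congr1 (fun M : 'rV_(r + r) => M 0 (Ordinal j2)) wS; rewrite !mxE => E.
  rewrite -[RHS]E.
  rewrite big_split_ord /= coefD aE bE !mulr_suml !coef_sum; congr (_ + _).
    apply: eq_bigr => i _; rewrite mxE (unsplitK (inl i)).
    by rewrite -scalerAl coefZ.
  apply: eq_bigr => i _; rewrite mxE (unsplitK (inr i)).
  by rewrite -scalerAl coefZ.
have b0 : b = 0.
  apply: contraTeq sb => b0; rewrite -ltnNge -sp; apply: dvdp_leq => //.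
  rewrite -(Gauss_dvdpl b pq) -(addKr (a * p) (b * q)) ab addr0 dvdpNr.
  exact: dvdp_mull.
have a0 : a = 0.
  by move/eqP: ab; rewrite b0 mul0r addr0 mulf_eq0 (negPf p0) orbF => /eqP.
case/eqP: w0; apply/rowP => i; rewrite mxE -(splitK i).
case: (fintype.split i) => l /=.
  have := congr1 (fun s : {poly C} => s`_l) a0.
  by rewrite coef0 coef_poly ltn_ord valK.
have := congr1 (fun s : {poly C} => s`_l) b0.
by rewrite coef0 coef_poly ltn_ord valK.
Qed.

End Sylvester.

Section Spread.
Variables (C : numClosedFieldType) (n k r : nat) (A B : 'rV[C]_n -> 'M[C]_k).
Local Notation vec := ('rV[C]_n).
Hypothesis Apoly : forall i j, polyfun (fun v => A v i j).
Hypothesis Bpoly : forall i j, polyfun (fun v => B v i j).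
Implicit Types (v : vec) (q : vec -> {poly C}) (c : C).

Definition polyfun_coefs q := forall i, polyfun (fun v => (q v)`_i).

Lemma polyfun_coefs_const p : polyfun_coefs (fun=> p).
Proof. by move=> i; exact: polyfun_const. Qed.

Lemma polyfun_coefsD q1 q2 : polyfun_coefs q1 -> polyfun_coefs q2 ->
  polyfun_coefs (fun v => q1 v + q2 v).
Proof.
move=> q1p q2p i; rewrite (_ : (fun _ => _) = fun v => (q1 v)`_i + (q2 v)`_i).
  exact: polyfunD.
by apply: funext => v; rewrite coefD.
Qed.

Lemma polyfun_coefsM q1 q2 : polyfun_coefs q1 -> polyfun_coefs q2 ->
  polyfun_coefs (fun v => q1 v * q2 v).
Proof.
move=> q1p q2p i.
rewrite (_ : (fun _ => _) = fun v => \sum_(j < i.+1) (q1 v)`_j * (q2 v)`_(i - j)).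
  apply: closed_sum => [a|f g|j]; [exact: polyfun_const|exact: polyfunD|exact: polyfunM].
by apply: funext => v; rewrite coefM.
Qed.

Definition pencil_minor (L : 'M[C]_(r, k)) (R : 'M[C]_(k, r)) v : {poly C} :=
  \det (map_mx polyC (L *m B v *m R) + 'X *: map_mx polyC (L *m A v *m R)).

Lemma pencil_minor_poly L R : polyfun_coefs (pencil_minor L R).
Proof.
have mulP (M : vec -> 'M[C]_k) : (forall i j, polyfun (fun v => M v i j)) ->
    forall i j, polyfun (fun v => (L *m M v *m R) i j).
  by apply: closed_mulmx; [exact: polyfun_const|exact: polyfunD|exact: polyfunM].
have lift f : polyfun f -> polyfun_coefs (fun v => (f v)%:P).
  move=> fp i; case: (posnP i) => [->|i0].
    by rewrite (_ : (fun _ => _) = f) //; apply: funext => v; rewrite coefC.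
  rewrite (_ : (fun _ => _) = fun=> 0); first exact: polyfun_const.
  by apply: funext => v; rewrite coefC eqn0Ngt i0.
apply: closed_det => [p|||i j].
- exact: polyfun_coefs_const.
- exact: polyfun_coefsD.
- exact: polyfun_coefsM.
rewrite (_ : (fun _ => _) =
  fun v => ((L *m B v *m R) i j)%:P + 'X * ((L *m A v *m R) i j)%:P).
  apply: polyfun_coefsD; first exact/lift/mulP.
  apply: polyfun_coefsM; first exact: polyfun_coefs_const.
  exact/lift/mulP.
by apply: funext => v; rewrite !mxE.
Qed.

Lemma horner_pencil_minor L R v c :
  (pencil_minor L R v).[c] = \det (L *m (B v + c *: A v) *m R).
Proof.
by rewrite horner_det_pencil scalemxAl -mulmxDl scalemxAr -mulmxDr.
Qed.

(** The polynomials that witness, by not vanishing at [c], that the member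
   [B v + c *: A v] has rank at least [r]. *)
Definition rank_witness q := [/\ polyfun_coefs q, forall v, (size (q v) <= r.+1)%N &
  forall v c, (q v).[c] != 0 -> (r <= \rank (B v + c *: A v)%R)%N].

Lemma pencil_minor_witness L R : rank_witness (pencil_minor L R).
Proof.
split; first exact: pencil_minor_poly.
  by move=> v; have [] := det_pencil_size (L *m B v *m R) (L *m A v *m R).
by move=> v c; rewrite horner_pencil_minor => /rank_of_minor.
Qed.

Lemma rank_witness_comb q1 q2 c : rank_witness q1 -> rank_witness q2 ->
  rank_witness (fun v => q1 v + c%:P * q2 v).
Proof.
move=> [p1 s1 r1] [p2 s2 r2]; split.
- exact/polyfun_coefsD/polyfun_coefsM/p2/polyfun_coefs_const.
- move=> v; apply: leq_trans (size_polyD _ _) _; rewrite geq_max s1 /= mul_polyC.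
  by apply: leq_trans (size_scale_leq _ _) (s2 v).
move=> v a; rewrite !hornerE; have [q10|q10 _] := eqVneq (q1 v).[a] 0; last exact: r1 q10.
by rewrite q10 add0r mulf_eq0 negb_or => /andP[_]; exact: r2.
Qed.

(** A witness that does not vanish on [cs] plus a generic multiple of a minor that
   does not vanish at one more point. *)
Lemma rank_witness_avoiding v0 (cs : seq C) :
  (forall c, (r <= \rank (B v0 + c *: A v0)%R)%N) ->
  exists2 q, rank_witness q & forall c, c \in cs -> (q v0).[c] != 0.
Proof.
move=> rk; elim: cs => [|c cs [q qw qcs]].
  by exists (pencil_minor 0 0); first exact: pencil_minor_witness.
have [L [R LR]] := minor_of_rank (rk c).
set p := pencil_minor L R; have pc : (p v0).[c] != 0.
  by rewrite horner_pencil_minor LR det1 oner_neq0.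
pose l := \prod_(a <- c :: cs) ((q v0).[a]%:P + (p v0).[a] *: 'X).
have l0 : l != 0.
  rewrite prodf_seq_neq0; apply/allP => a; rewrite inE /= => ac.
  apply/eqP => /polyP E; have := E 0%N; have := E 1%N.
  rewrite !coefD !coefZ !coefX !coefC /= mulr0 mulr1 add0r addr0 => p0 q0.
  by case/predU1P: ac => [aE|/qcs/eqP//]; case/eqP: pc; rewrite -aE.
have [t lt] : exists t, l.[t] != 0.
  apply: contrapT => nt; case/eqP: l0; apply: (@poly_cofinite_eq0 _ _ [::]) => t _.
  by apply/eqP; apply: contrapT => lt; apply: nt; exists t; exact/negP.
exists (fun v => q v + t%:P * p v).
  by apply: rank_witness_comb => //; exact: pencil_minor_witness.
move=> a ac; apply: contraNneq lt; rewrite !hornerE => E.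
by rewrite /l horner_prod (big_rem a ac) /= !hornerE [_ * t]mulrC E mul0r.
Qed.

(** Full rank of all members of the pencil at [v0] propagates to the
   complement of a hypersurface: two witnesses [q0] and [q1] without common root at
   [v0] have no common root as long as their resultant does not vanish. *)
Lemma rank_spread v0 :
  (forall s : C * C, s != 0 -> (r <= \rank (s.1 *: A v0 + s.2 *: B v0)%R)%N) ->
  exists f, [/\ polyfun f, f v0 != 0 & forall v, f v != 0 ->
    forall s : C * C, s != 0 -> (r <= \rank (s.1 *: A v + s.2 *: B v)%R)%N].
Proof.
have [->|r0] := posnP r.
  by exists (fun=> 1); split => //; [exact: polyfun_const|exact: oner_neq0].
move=> rk; have rkA : (r <= \rank (A v0))%N.
  have := rk (1, 0); rewrite scale1r scale0r addr0; apply.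
  by apply/eqP => -[/eqP]; rewrite oner_eq0.
have rkB c : (r <= \rank (B v0 + c *: A v0)%R)%N.
  have := rk (c, 1); rewrite scale1r addrC; apply.
  by apply/eqP => -[_ /eqP]; rewrite oner_eq0.
have [L [R LR]] := minor_of_rank rkA.
set q0 := pencil_minor L R; have [q0p q0s q0r] := pencil_minor_witness L R.
have q0c v : (q0 v)`_r = \det (L *m A v *m R).
  by have [] := det_pencil_size (L *m B v *m R) (L *m A v *m R).
have sq0 : size (q0 v0) = r.+1.
  apply/eqP; rewrite eqn_leq q0s ltnNge; apply/negP => /leq_sizeP/(_ r (leqnn r)).
  by rewrite q0c LR det1 => /eqP; rewrite oner_eq0.
have q00 : q0 v0 != 0 by rewrite -size_poly_gt0 sq0.
have [cs csE] := closed_field_poly_normal (q0 v0).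
have [q1 [q1p q1s q1r] q1cs] := rank_witness_avoiding cs rkB.
exists (fun v => \det (sylvester_mx r (q0 v) (q1 v)) * (q0 v)`_r); split.
- apply: polyfunM; last exact: q0p.
  apply: closed_det => [a|||i j]; [exact: polyfun_const|exact: polyfunD|exact: polyfunM|].
  rewrite (_ : (fun _ => _) = fun v => (match fintype.split i with
    | inl i' => 'X^i' * q0 v | inr i' => 'X^i' * q1 v end)`_j).
    by case: fintype.split => l; apply: (polyfun_coefsM (polyfun_coefs_const _)).
  by apply: funext => v; rewrite mxE; case: fintype.split.
- rewrite mulf_neq0 ?q0c ?LR ?det1 ?oner_neq0 // sylvester_coprime //.
  apply: Pdiv.ClosedField.root_coprimep => c; rewrite csE rootZ ?lead_coef_eq0 //.
  by rewrite root_prod_XsubC => /q1cs.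
move=> v; rewrite mulf_eq0 negb_or q0c => /andP[res /rank_of_minor rA] s s0.
have [s2|s2] := eqVneq s.2 0.
  have s1 : s.1 != 0 by apply: contra s0 => /eqP s1; rewrite [s]surjective_pairing s1 s2.
  by rewrite s2 scale0r addr0 (eqmx_scale _ s1).
have -> : s.1 *: A v + s.2 *: B v = s.2 *: (B v + (s.1 / s.2) *: A v).
  by rewrite scalerDr scalerA mulrCA divff // mulr1 addrC.
rewrite (eqmx_scale _ s2); set c := s.1 / s.2.
have [z0|] := eqVneq (q0 v).[c] 0; last exact: q0r.
have [z1|] := eqVneq (q1 v).[c] 0; last exact: q1r.
by case/eqP: res; apply: (@sylvester_common_root _ _ _ _ c) => //; exact/rootP.
Qed.

End Spread.

(** * Kronecker pencils *)

Section Kronecker.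
Variables (C : numClosedFieldType) (V : vectType C) (th1 th2 : bivector_field V).
Hypothesis th1_lin : forall x y, linear (fun xi => th1 xi x y : C^o).
Hypothesis th2_lin : forall x y, linear (fun xi => th2 xi x y : C^o).
Local Notation bas := (vbasis (fullv : {vspace dual_space V})).

(** The rank is at most [r] everywhere, and [rank_spread] makes it at least [r] on
   an open dense set. *)
Lemma kronecker_spread r :
  (forall s xi, bivector_rank (pencil th1 th2 s) xi <= r)%N ->
  (exists xi, forall s : C * C, s != 0 -> (r <= bivector_rank (pencil th1 th2 s) xi)%N) ->
  kronecker (pencil th1 th2).
Proof.
move=> le_r [xi0 ge_r]; have bE := vbasisP (fullv : {vspace dual_space V}).
have linpoly (th : bivector_field V) i j : (forall x y, linear (fun xi => th xi x y : C^o)) ->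
    polyfun (fun v => form_mx (th (vecof bas v)) i j).
  move=> thl; set x := (vbasis {:V})`_i; set y := (vbasis {:V})`_j.
  pose l : {linear dual_space V -> C^o} := HB.pack (fun xi => th xi x y : C^o)
    (GRing.isLinear.Build C _ _ _ _ (thl x y)).
  rewrite (_ : (fun _ => _) =
      fun v : 'rV[C]_(\dim (fullv : {vspace dual_space V})) =>
        \sum_(a < \dim (fullv : {vspace dual_space V})) v 0 a * (l bas`_a : C)).
    apply: closed_sum => [b|f g|a]; [exact: polyfun_const|exact: polyfunD|].
    by apply: polyfunM; [exact: polyfun_coord|exact: polyfun_const].
  apply: funext => v; rewrite mxE -[LHS]/(l (vecof bas v)) /vecof linear_sum.
  by apply: eq_bigr => a _; rewrite linearZ.
have rankE s xi : bivector_rank (pencil th1 th2 s) xi =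
    \rank (s.1 *: form_mx (th1 xi) + s.2 *: form_mx (th2 xi))%R.
  by congr mxrank; apply/matrixP => i j; rewrite !mxE.
have [|f [fp f0 fr]] := @rank_spread C _ _ r
  (fun v => form_mx (th1 (vecof bas v))) (fun v => form_mx (th2 (vecof bas v)))
  (fun i j => linpoly th1 i j th1_lin) (fun i j => linpoly th2 i j th2_lin) (rVof bas xi0).
  by move=> s s0; rewrite rVofK // -rankE ge_r.
exists [set xi | f (rVof bas xi) != 0]%classic.
have -> : dual_coord [set xi | f (rVof bas xi) != 0]%classic = [set v | f v != 0]%classic.
  by apply: funext => v; rewrite /dual_coord /= vecofK.
split; [exact: polyfun_open|exact: polyfun_dense f0|].
move=> xi fxi s t s0 t0; have full u : u != 0 -> bivector_rank (pencil th1 th2 u) xi = r.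
  move=> u0; apply/eqP; rewrite eqn_leq le_r rankE.
  by have := fr _ fxi _ u0; rewrite rVofK.
by rewrite !full.
Qed.

End Kronecker.

(** * Complexification *)

Section ComplexGrading.
Variables (R : rcfType) (g : lieAlgType R) (B : g -> g -> R) (H e f : g).
Variables (m : nat) (pr : int -> 'End(g)).
Hypothesis pg : principal_grading B H e f m pr.
Local Notation gC := (complexification R g).

Definition complexify_form (u v : gC) : R[i] :=
  ((B u.1 v.1 - B u.2 v.2) +i* (B u.1 v.2 + B u.2 v.1))%C.

Let Bl y : linear (fun x => B x y : R^o).
Proof. by move=> a u v; exact: (grading_form_linear pg). Qed.

Let Br x : linear (B x : g -> R^o).
Proof.
move=> a u v; rewrite !(grading_form_sym pg x).
exact: (grading_form_linear pg).
Qed.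

Let BDl := formDl Bl.
Let BZl := formZl Bl.
Let BDr := formDr Br.
Let BZr := formZr Br.
Let B0r := form0r Br.

Let BNl u v : B (- u) v = - B u v.
Proof. by rewrite -scaleN1r BZl mulN1r. Qed.

Let BNr u v : B u (- v) = - B u v.
Proof. by rewrite -scaleN1r BZr mulN1r. Qed.

Lemma lie_real (x : g) (z : gC) : lie ((x, 0) : gC) z = (lie x z.1, lie x z.2).
Proof. by rewrite complexification_lieE /= !lie0l subr0 addr0. Qed.

Lemma complexify_grading : principal_grading complexify_form
  ((H, 0) : gC) (e, 0) (f, 0) m (fun k => complexify_end (pr k)).
Proof.
have real_scale (a : R) (z : gC) : a%:C%C *: z = (a *: z.1, a *: z.2).
  by rewrite complexificationZ /= !scale0r subr0 addr0.
have natE (k : nat) : k%:R = (k%:R : R)%:C%C :> R[i] by rewrite rmorph_nat.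
have intE (k : int) : k%:~R = (k%:~R : R)%:C%C :> R[i] by rewrite rmorph_int.
split.
- move=> [a1 a2] [x1 x2] [y1 y2] [z1 z2]; rewrite /complexify_form complexificationZ /=.
  apply/eqP; rewrite eq_complex /= !(BDl, BZl, BNl).
  by apply/andP; split; apply/eqP; ring.
- move=> x y; rewrite /complexify_form !(grading_form_sym pg _ y.1) !(grading_form_sym pg _ y.2).
  by congr (_ +i* _)%C; rewrite addrC.
- move=> x y z; rewrite /complexify_form !complexification_lieE /=.
  rewrite !(BDl, BDr, BNl, BNr) !(grading_form_inv pg).
  by congr (_ +i* _)%C; ring.
- move=> [x1 x2] x0; congr pair; apply: (grading_form_nondegenerate pg) => y.
    by have := x0 (y, 0); rewrite /complexify_form /= !B0r subr0 => -[].
  by have := x0 (y, 0); rewrite /complexify_form /= !B0r add0r => -[].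
- by rewrite lie_real /= lie0r (grading_He pg) natE real_scale scaler0.
- by rewrite lie_real /= lie0r (grading_Hf pg) natE -rmorphN real_scale scaler0.
- by rewrite lie_real /= lie0r (grading_ef pg).
- by move=> k v; rewrite complexify_endE lie_real /= !(grading_eigen pg) intE real_scale.
- by move=> k v; rewrite !complexify_endE !lie_real /= !(grading_comm pg).
- move=> [v1 v2]; transitivity ((\sum_(i < m.*2.+1) pr (i%:Z - m%:Z) v1,
    \sum_(i < m.*2.+1) pr (i%:Z - m%:Z) v2) : gC); last by rewrite !(grading_sum pg).
  elim/big_ind3: _ => [//|x1 x2 x3 y1 y2 y3 -> ->//|i _].
  by rewrite complexify_endE.
move=> u v; rewrite !complexify_endE complexification_lieE /= !(grading0_abelian pg).
by rewrite subr0 addr0.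
Qed.

End ComplexGrading.

(** * The Kronecker property *)

Lemma lie_poisson_linear (C : numFieldType) (V : vectType C) (br : V -> V -> V) x y :
  linear (fun xi => lie_poisson br xi x y : C^o).
Proof. by move=> a u v; rewrite /lie_poisson add_lfunE scale_lfunE. Qed.

Lemma grading_kronecker (C : numClosedFieldType) (g : lieAlgType C)
    (B : g -> g -> C) (H e f : g) (m : nat) (pr : int -> 'End(g)) (N : 'End(g)) (lam1 lam2 : C) :
  principal_grading B H e f m pr -> lam1 != lam2 ->
  (forall (k : int) v, k < 0 -> N (pr k v) = lam1 *: pr k v) ->
  (forall (k : int) v, 0 <= k -> N (pr k v) = lam2 *: pr k v) ->
  kronecker (nijenhuis_pencil N).
Proof.
move=> pg lam12 Nneg Nnonneg.
have [r [le_r ge_r]] := principal_rank pg lam12 Nneg Nnonneg.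
by apply: (@kronecker_spread _ _ _ _ _ _ r le_r ge_r); exact: lie_poisson_linear.
Qed.

Lemma cartan_split_closed (C : numClosedFieldType) (g : lieAlgType C) (h : {vspace g}) :
  cartan_subalgebra h -> split_cartan_subalgebra h.
Proof.
move=> hC; split=> // x _; set p := char_poly _.
have [s sE] := closed_field_poly_normal p.
by exists s; rewrite sE (monicP (char_poly_monic _)) scale1r.
Qed.

Theorem mainTheorem3 (R : realType) :
  (* K = C *)
  (forall (g : lieAlgType R[i]) (h : {vspace g})
          (P : seq 'Hom(subvs_of h, R[i]^o)) (lam1 lam2 : R[i]) (N : 'End(g)),
     lie_semisimple g ->
     cartan_subalgebra h ->
     positive_system P ->
     lam1 != lam2 ->
     (forall x, x \in nminus P -> N x = lam1 *: x) ->
     (forall x, x \in borel P -> N x = lam2 *: x) ->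
     nijenhuis N /\ kronecker (nijenhuis_pencil N))
  /\
  (* K = R *)
  (forall (g : lieAlgType R) (h : {vspace g})
          (P : seq 'Hom(subvs_of h, R^o)) (lam1 lam2 : R) (N : 'End(g)),
     lie_semisimple g ->
     split_lie_algebra g ->
     split_cartan_subalgebra h ->
     positive_system P ->
     lam1 != lam2 ->
     (forall x, x \in nminus P -> N x = lam1 *: x) ->
     (forall x, x \in borel P -> N x = lam2 *: x) ->
     nijenhuis N /\ kronecker (nijenhuis_pencil (complexify_end N))).
Proof.
split=> g h P lam1 lam2 N gss.
  move=> /cartan_split_closed hC Ppos lam12 Nminus Nborel.
  have [H [e [f [m [pr [pg prminus prborel]]]]]] := principal_grading_exists hC gss Ppos.
  have Nneg (k : int) v : k < 0 -> N (pr k v) = lam1 *: pr k v by move/(prminus k v)/Nminus.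
  have Nnonneg (k : int) v : 0 <= k -> N (pr k v) = lam2 *: pr k v by move/(prborel k v)/Nborel.
  split; first exact: (grading_nijenhuis pg Nneg Nnonneg).
  exact: (grading_kronecker pg lam12 Nneg Nnonneg).
move=> _ hC Ppos lam12 Nminus Nborel.
have [H [e [f [m [pr [pg prminus prborel]]]]]] := principal_grading_exists hC gss Ppos.
have Nneg (k : int) v : k < 0 -> N (pr k v) = lam1 *: pr k v by move/(prminus k v)/Nminus.
have Nnonneg (k : int) v : 0 <= k -> N (pr k v) = lam2 *: pr k v by move/(prborel k v)/Nborel.
split; first exact: (grading_nijenhuis pg Nneg Nnonneg).
apply: (grading_kronecker (lam1 := lam1%:C%C) (lam2 := lam2%:C%C) (complexify_grading pg)).
- by rewrite (inj_eq (fmorph_inj _)).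
- move=> k v k0; rewrite !complexify_endE /= !Nneg // complexificationZ /=.
  by rewrite !scale0r subr0 addr0.
move=> k v k0; rewrite !complexify_endE /= !Nnonneg // complexificationZ /=.
by rewrite !scale0r subr0 addr0.
Qed.
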